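(* Let $s>0$, $n,m\in\mathbb{N}$, and $s<n\le 2m$. Then $$\mathcal{E}_{2m,s}(u,v)=\mathcal{E}_s(u,v)\qquad\text{for }u,v\in H^s(\mathbb{R}^N),$$ and $$\int_{\mathbb{R}^N}L_{n,s}u(x)\,v(x)\,dx=\mathcal{E}_{2m,s}(u,v)\qquad\text{for }u,v\in C^\infty_c(\mathbb{R}^N).$$
   Context: $N\in\mathbb{N}=\{1,2,\ldots\}$ is the dimension. Functions are real-valued on $\mathbb{R}^N$; $H^s(\mathbb{R}^N)$ is the usual ($L^2$-based) Sobolev space. For $m\in\mathbb{N}$, $\delta_m u(x,y):=\sum_{k=-m}^m(-1)^k\binom{2m}{m-k}u(x+ky)$. For $m\in\mathbb{N}$ and $s\in(0,m)$, $$L_{m,s}u(x):=\frac{c_{N,m,s}}{2}\int_{\mathbb{R}^N}\frac{\delta_m u(x,y)}{|y|^{N+2s}}\,dy,$$ where $$c_{N,m,s}:=\frac{4^s\Gamma(\frac N2+s)}{\pi^{N/2}\Gamma(-s)}\Big(\sum_{k=1}^m(-1)^k\binom{2m}{m-k}k^{2s}\Big)^{-1}\quad\text{if }s\in(0,m)\setminus\mathbb{N},$$ $$c_{N,m,s}:=\frac{4^s\Gamma(\frac N2+s)\,s!}{2\pi^{N/2}}\Big(\sum_{k=2}^m(-1)^{k-s+1}\binom{2m}{m-k}k^{2s}\ln(k)\Big)^{-1}\quad\text{if }s\in\{1,\ldots,m-1\}.$$ For $m\in\mathbb{N}$ and $s\in(0,2m)$, $$\mathcal{E}_{2m,s}(u,v):=\frac{c_{N,2m,s}}{2}\int_{\mathbb{R}^N}\int_{\mathbb{R}^N}\frac{\delta_m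 u(x,y)\,\delta_m v(x,y)}{|y|^{N+2s}}\,dx\,dy.$$ For $\sigma\in(0,1)$, $$\mathcal{E}_\sigma(u,v):=\frac{c_{N,1,\sigma}}{2}\int_{\mathbb{R}^N}\int_{\mathbb{R}^N}\frac{(u(x)-u(y))(v(x)-v(y))}{|x-y|^{N+2\sigma}}\,dx\,dy.$$ For $s=\ell+\sigma$ with $\ell\in\mathbb{N}$, $\sigma\in(0,1)$: $\mathcal{E}_s(u,v):=\mathcal{E}_\sigma((-\Delta)^{\ell/2}u,(-\Delta)^{\ell/2}v)$ if $\ell$ is even, and $\mathcal{E}_s(u,v):=\sum_{k=1}^N\mathcal{E}_\sigma(\partial_k(-\Delta)^{\frac{\ell-1}{2}}u,\partial_k(-\Delta)^{\frac{\ell-1}{2}}v)$ if $\ell$ is odd, where $(-\Delta)^j=(-\sum_{i=1}^N\partial_{ii})^j$ in the weak sense. For $s\in\mathbb{N}$, $\mathcal{E}_s(u,v):=\int_{\mathbb{R}^N}|\xi|^{2s}\mathcal{F}u(\xi)\overline{\mathcal{F}v(\xi)}\,d\xi$, with $\mathcal{F}$ the unitary Fourier transform on $L^2(\mathbb{R}^N)$ (a formula which also holds for non-integer $s$). *)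

(* Defs.v *)
From HB Require Import structures.
From mathcomp Require Import all_boot all_order all_algebra.
From mathcomp Require Import all_classical all_reals all_analysis.
From mathcomp Require Import complex.

Set Implicit Arguments.
Unset Strict Implicit.
Unset Printing Implicit Defensive.

Import Order.TTheory GRing.Theory Num.Theory.
Import numFieldNormedType.Exports.

Local Open Scope classical_set_scope.
Local Open Scope ring_scope.
Local Open Scope complex_scope.

(* R^N is 'rV[R]_N, with the sigma-algebra generated by the coordinates
   (equivalently, the Borel sigma-algebra). *)
Section measurable_rV.
Context (R : realType) (n : nat).

Definition rV_coord (i : 'I_n) (x : 'rV[R]_n) : measurableTypeR R := x 0 i.

Let rV_set0 : g_sigma_preimage rV_coord set0.
Proof. exact: sigma_algebra0. Qed.

Let rV_setC A : g_sigma_preimage rV_coord A -> g_sigma_preimage rV_coord (~` A).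
Proof. exact: sigma_algebraC. Qed.

Let rV_bigcup (F : (set 'rV[R]_n)^nat) :
  (forall i, g_sigma_preimage rV_coord (F i)) ->
  g_sigma_preimage rV_coord (\bigcup_i (F i)).
Proof. exact: sigma_algebra_bigcup. Qed.

HB.instance Definition _ := @isMeasurable.Build default_measure_display
  'rV[R]_n (g_sigma_preimage rV_coord) rV_set0 rV_setC rV_bigcup.

End measurable_rV.

Lemma measurable_rV_coord (R : realType) (n : nat) (i : 'I_n) :
  measurable_fun [set: 'rV[R]_n] (@rV_coord R n i).
Proof.
move=> _ Y mY; rewrite setTI; apply: sub_sigma_algebra => /=.
rewrite -bigcup_seq/=; exists i => /=; first by rewrite mem_index_enum.
by exists Y => //; rewrite setTI.
Qed.

Lemma measurable_fun_rVP d (T : measurableType d) (R : realType) (n : nat)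
    (f : T -> 'rV[R]_n) :
  (forall i, measurable_fun setT (@rV_coord R n i \o f)) ->
  measurable_fun setT f.
Proof.
move=> mf.
suff prefS : g_sigma_preimage (fun i => @rV_coord R n i \o f) `<=` measurable.
  move: prefS; rewrite g_sigma_preimage_comp => prefS.
  by move=> _ A mA; apply: prefS; exists A.
apply: smallest_sub; first exact: sigma_algebra_measurable.
case: n => [|n] in f mf *; first by rewrite big_ord0.
rewrite -bigcup_mkord_ord; apply: bigcup_sub => i Ii.
by move=> A [B mB <-]; exact: mf.
Qed.

Definition rV_cons (R : realType) (n : nat)
    (p : measurableTypeR R * 'rV[R]_n) : 'rV[R]_n.+1 :=
  \row_i (if unlift ord0 i is Some j then p.2 0 j else p.1).

Lemma measurable_rV_cons (R : realType) (n : nat) :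
  measurable_fun setT (@rV_cons R n).
Proof.
apply: measurable_fun_rVP => i.
case: (unliftP ord0 i) => [j ->|->].
- rewrite (_ : _ \o _ = @rV_coord R n j \o snd); last first.
    by apply/funext => p; rewrite /= /rV_coord mxE liftK.
  by apply: measurableT_comp; [exact: measurable_rV_coord|exact: measurable_snd].
- rewrite (_ : _ \o _ = fst); first exact: measurable_fst.
  by apply/funext => p; rewrite /= /rV_coord mxE unlift_none.
Qed.

Definition lebesgue_rV_step (R : realType) (n : nat)
    (mu : {measure set 'rV[R]_n -> \bar R}) :
    {measure set 'rV[R]_n.+1 -> \bar R} :=
  measure_function_pushforward__canonical__measure_function_Measure
    (@lebesgue_measure R \x^ mu)%E (@measurable_rV_cons R n).

(* N-dimensional Lebesgue measure, as an iterated product of the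
   one-dimensional one; see lebesgue_rV_box below. *)
Fixpoint lebesgue_rV (R : realType) (n : nat) :
    {measure set 'rV[R]_n -> \bar R} :=
  match n return {measure set 'rV[R]_n -> \bar R} with
  | 0%N => @dirac _ 'rV[R]_0 0 R
  | n'.+1 => lebesgue_rV_step (lebesgue_rV R n')
  end.

Lemma lebesgue_rV_box (R : realType) (n : nat)
    (A : 'I_n -> set (measurableTypeR R)) : (forall i, measurable (A i)) ->
  lebesgue_rV R n [set x : 'rV[R]_n | forall i, A i (x 0 i)] =
  (\prod_(i < n) lebesgue_measure (A i))%E.
Proof.
elim: n => [|n IHn] in A * => mA.
  by rewrite big_ord0 /= diracE mem_set// => -[].
rewrite big_ord_recl -IHn//.
rewrite -product_measure2E//; last first.
  rewrite (_ : [set x : 'rV[R]_n | _] = \big[setI/setT]_(i < n)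
      (@rV_coord R n i @^-1` A (lift ord0 i))).
    by apply: bigsetI_measurable => i _; rewrite -[X in measurable X]setTI;
      exact: measurable_rV_coord.
  rewrite -bigcap_seq; apply/seteqP; split => x /= Ax.
    by move=> i _; exact: Ax.
  by move=> i; apply: (Ax i); rewrite /= mem_index_enum.
rewrite /= /pushforward; congr (_ _); apply/seteqP; split => -[a x] /= Ax.
  split; first by have := Ax ord0; rewrite mxE unlift_none.
  by move=> i; have := Ax (lift ord0 i); rewrite mxE liftK.
by move=> i; rewrite mxE; case: unliftP => [j ->|->] /=; [apply: Ax.2|apply: Ax.1].
Qed.

(* The norm of the normed module 'rV[R]_N is the sup norm. *)
Definition enorm (R : realType) (N : nat) (x : 'rV[R]_N) : R :=
  Num.sqrt (\sum_i x 0 i ^+ 2).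

Definition dotrv (R : realType) (N : nat) (x y : 'rV[R]_N) : R :=
  \sum_i x 0 i * y 0 i.

Definition partial (R : realType) (N : nat) (i : 'I_N) (f : 'rV[R]_N -> R) :
    'rV[R]_N -> R :=
  fun x => 'D_(delta_mx 0 i) f x.

Definition smooth (R : realType) (N : nat) (f : 'rV[R]_N -> R) : Prop :=
  forall I : seq 'I_N, let g := foldr (@partial R N) f I in
    continuous g /\ forall x i, derivable g x (delta_mx 0 i).

Definition Cc_infty (R : realType) (N : nat) : set ('rV[R]_N -> R) :=
  [set f | smooth f /\ compact (closure [set x | f x != 0])].

Definition locally_integrable_rV (R : realType) (N : nat)
    (f : 'rV[R]_N -> R) : Prop :=
  measurable_fun setT f /\ forall K : set 'rV[R]_N, compact K ->
    (lebesgue_rV R N).-integrable K (EFin \o f).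

Definition is_weak_partial (R : realType) (N : nat) (i : 'I_N)
    (u g : 'rV[R]_N -> R) : Prop :=
  [/\ locally_integrable_rV u, locally_integrable_rV g &
    forall phi, Cc_infty phi ->
      \int[lebesgue_rV R N]_x (u x * partial i phi x) =
      - \int[lebesgue_rV R N]_x (g x * phi x)].

(* Some weak partial derivative of u (they agree almost everywhere), or 0 if
   there is none. *)
Definition weak_partial (R : realType) (N : nat) (i : 'I_N)
    (u : 'rV[R]_N -> R) : 'rV[R]_N -> R :=
  xget (fun=> 0) [set g | is_weak_partial i u g].

Definition weak_neg_laplacian (R : realType) (N : nat) (u : 'rV[R]_N -> R) :
    'rV[R]_N -> R :=
  fun x => - \sum_i weak_partial i (weak_partial i u) x.

Definition cintegral (R : realType) (N : nat) (f : 'rV[R]_N -> R[i]) : R[i] :=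
  (\int[lebesgue_rV R N]_x complex.Re (f x)) +i*
  (\int[lebesgue_rV R N]_x complex.Im (f x)).

Definition expi (R : realType) (t : R) : R[i] := cos t +i* sin t.

Definition sqrnormc (R : realType) (z : R[i]) : R :=
  complex.Re z ^+ 2 + complex.Im z ^+ 2.

Definition fourierL1 (R : realType) (N : nat) (u : 'rV[R]_N -> R) :
    'rV[R]_N -> R[i] :=
  fun xi => ((2 * pi) `^ (- (N%:R / 2)))%:C *
    cintegral (fun x => expi (- dotrv x xi) * (u x)%:C).

(* The continuous extension of fourierL1 from L^1 \cap L^2 to L^2. *)
Definition is_fourierL2 (R : realType) (N : nat) (u : 'rV[R]_N -> R)
    (U : 'rV[R]_N -> R[i]) : Prop :=
  let mu := lebesgue_rV R N in
  [/\ measurable_fun setT (fun xi => complex.Re (U xi)),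
      measurable_fun setT (fun xi => complex.Im (U xi)) &
      exists w : nat -> 'rV[R]_N -> R,
      [/\ forall k, w k \in Lfun mu 1%E /\ w k \in Lfun mu 2%:E,
          (\int[mu]_x ((w k x - u x) ^+ 2)%:E)%E @[k --> \oo] --> 0%E &
          (\int[mu]_xi (sqrnormc (fourierL1 (w k) xi - U xi))%:E)%E
            @[k --> \oo] --> 0%E]].

(* Some representative of the (almost everywhere unique) transform. *)
Definition fourier (R : realType) (N : nat) (u : 'rV[R]_N -> R) :
    'rV[R]_N -> R[i] :=
  xget (fun=> 0) [set U | is_fourierL2 u U].

Definition sobolev (R : realType) (N : nat) (s : R) : set ('rV[R]_N -> R) :=
  let mu := lebesgue_rV R N in
  [set u | u \in Lfun mu 2%:E /\
    (\int[mu]_xi ((1 + enorm xi ^+ 2) `^ s * sqrnormc (fourier u xi))%:E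
      < +oo)%E].

(* The Gamma function: Euler's integral for x > 0, continued to negative
   non-integers by Gamma(x) = Gamma(x + k) / (x (x + 1) ... (x + k - 1)). *)

Definition Gamma_pos (R : realType) (x : R) : R :=
  \int[lebesgue_measure]_(t in `]0, +oo[) (t `^ (x - 1) * expR (- t)).

Definition Gamma (R : realType) (x : R) : R :=
  let k := if 0 < x then 0%N else (Num.truncn (- x)).+1 in
  Gamma_pos (x + k%:R) / (\prod_(i < k) (x + i%:R)).

Definition cNms (R : realType) (N m : nat) (s : R) : R :=
  if s \is a Num.nat then
    4 `^ s * Gamma (N%:R / 2 + s) * (Num.truncn s)`!%:R
      / (2 * pi `^ (N%:R / 2))
      / (\sum_(2 <= k < m.+1)
          (-1) ^ (k%:Z - (Num.truncn s)%:Z + 1) * 'C(2 * m, m - k)%:R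
            * k%:R `^ (2 * s) * ln k%:R)
  else
    4 `^ s * Gamma (N%:R / 2 + s) / (pi `^ (N%:R / 2) * Gamma (- s))
      / (\sum_(1 <= k < m.+1)
          (-1) ^+ k * 'C(2 * m, m - k)%:R * k%:R `^ (2 * s)).

(* \sum_(k = -m)^m (-1)^k 'C(2m, m - k) u(x + k y), with k = j - m *)
Definition delta (R : realType) (N m : nat) (u : 'rV[R]_N -> R)
    (x y : 'rV[R]_N) : R :=
  \sum_(0 <= j < (2 * m).+1)
    let k := j%:Z - m%:Z in
    (-1) ^ k * 'C(2 * m, 2 * m - j)%:R * u (x + y *~ k).

Definition Lms (R : realType) (N m : nat) (s : R) (u : 'rV[R]_N -> R) :
    'rV[R]_N -> R :=
  fun x => cNms N m s / 2 *
    \int[lebesgue_rV R N]_y (delta m u x y / enorm y `^ (N%:R + 2 * s)).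

Definition E2ms (R : realType) (N m : nat) (s : R) (u v : 'rV[R]_N -> R) : R :=
  cNms N (2 * m) s / 2 *
    \int[lebesgue_rV R N]_y \int[lebesgue_rV R N]_x
      (delta m u x y * delta m v x y / enorm y `^ (N%:R + 2 * s)).

Definition Esigma (R : realType) (N : nat) (sigma : R)
    (u v : 'rV[R]_N -> R) : R :=
  cNms N 1 sigma / 2 *
    \int[lebesgue_rV R N]_y \int[lebesgue_rV R N]_x
      ((u x - u y) * (v x - v y) / enorm (x - y) `^ (N%:R + 2 * sigma)).

(* Complex-valued because of the Fourier integral. *)
Definition Es (R : realType) (N : nat) (s : R) (u v : 'rV[R]_N -> R) : R[i] :=
  if s \is a Num.nat then
    cintegral (fun xi : 'rV[R]_N =>
      (enorm xi `^ (2 * s))%:C * fourier u xi * conjc (fourier v xi))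
  else if s < 1 then (Esigma s u v)%:C
  else
    let l := Num.truncn s in
    let sigma := s - l%:R in
    if odd l then
      (\sum_(k < N) Esigma sigma
        (weak_partial k (iter (l.-1)./2 (@weak_neg_laplacian R N) u))
        (weak_partial k (iter (l.-1)./2 (@weak_neg_laplacian R N) v)))%:C
    else
      (Esigma sigma (iter l./2 (@weak_neg_laplacian R N) u)
                    (iter l./2 (@weak_neg_laplacian R N) v))%:C.

(* Main.v *)
Require Import Defs.
From HB Require Import structures.
From mathcomp Require Import all_boot all_order all_algebra.
From mathcomp Require Import all_classical all_reals all_analysis.
From mathcomp Require Import complex measurable_realfun.
From mathcomp Require Import ring lra zify.

Import Order.TTheory GRing.Theory Num.Theory.
Import numFieldNormedType.Exports.

Local Open Scope classical_set_scope.
Local Open Scope ring_scope.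

Set Implicit Arguments.
Unset Strict Implicit.
Unset Printing Implicit Defensive.

(** On the Fourier side the three forms have the same expression, the integral of
|xi|^(2s) U(xi) conj(V(xi)), where U and V are the transforms of u and v ([sform]).

The weights of [delta] m are those of a difference of order 2m centred at x, so
[delta] m u (., y) has the transform (2 - 2 cos (y . xi))^m U(xi) ([FT_delta]). By
Plancherel, the integral over x in the form E_{2m,s} is the integral of
(2 - 2 cos (y . xi))^(2m) U conj(V), and the pairing of [delta] n u (., y) with v is the
integral of (2 - 2 cos (y . xi))^n U conj(V). In both cases Fubini leaves the integral of
(2 - 2 cos (y . xi))^n |y|^(-N-2s) over y, which is 2 / c_{N,n,s} times |xi|^(2s) as soon
as 0 < s < n ([int_dsym_radial], [cNms_radial_const], [spectral_form]). This is why n and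
m disappear from the result.

For that integral, the power of |y| is written as a superposition of Gaussians, whose
transforms are known. What remains is the Mellin transform of a combination of
exponentials exp (- k^2 r) whose first moments vanish ([int_heat]). Replacing each
exponential by a Taylor remainder makes the terms converge; they give Gamma (- s) k^(2s)
when s is not an integer, and a Frullani integral, whence the logarithms, when it is.

For the form of order s = l + sigma, a difference u (x + h) - u x has the multiplier
exp (i h . xi) - 1, of squared modulus 2 - 2 cos (h . xi), which is the case above with
n = 1 ([Esigma_sform]); the weak derivatives of order l supply the factor |xi|^(2l)
([Es_sform]). A weak derivative is obtained as a limit of difference quotients, which
converge because their transforms do ([FT_weak_partial]); it is the only one by the lemma
of du Bois-Reymond ([locally_integrable_eq0]).

In the second identity the two integrals must also be exchanged. The transform of a
test function decays faster than any power, because derivatives of test functions are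
test functions ([Cc_decay]); this dominates the pairing of |[delta] n u (., y)| with |v|
by an integrable function of y ([Lms_sform]).

The transform of a square-integrable function is handled as a closed isometric relation
between u and the real and imaginary parts of U ([FT]), which contains the transform of
the statement ([fourier_FT]). It rests on Plancherel's theorem for integrable
square-integrable functions ([plancherel_L1]). *)

(** * Lebesgue measure on R^N *)

Section Box.
Context {R : realType} {N : nat}.
Implicit Types (c d x : 'rV[R]_N).

Definition box c d : set 'rV[R]_N :=
  [set x : 'rV[R]_N | forall i, c 0 i < x 0 i /\ x 0 i < d 0 i].

Definition cube (r : R) : set 'rV[R]_N := box (const_mx (- r)) (const_mx r).

Lemma measurable_coord i : measurable_fun setT (fun x : 'rV[R]_N => x 0 i).
Proof. exact: (@measurable_rV_coord R N i). Qed.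

Lemma boxE c d :
  box c d = \big[setI/setT]_(i < N) ((fun x : 'rV[R]_N => x 0 i) @^-1` `]c 0 i, d 0 i[).
Proof.
rewrite -bigcap_seq; apply/seteqP; split => x /= H i.
  by move=> _; rewrite /= in_itv/=; apply/andP; exact: H.
by have := H i; rewrite /= mem_index_enum => /(_ isT); rewrite in_itv/= => /andP.
Qed.

Lemma measurable_box c d : measurable (box c d).
Proof.
rewrite boxE; apply: bigsetI_measurable => i _.
by rewrite -[X in measurable X]setTI; apply: measurable_coord => //; exact: measurable_itv.
Qed.

Lemma box_measure c d :
  lebesgue_rV R N (box c d) = (\prod_(i < N) Num.max 0 (d 0 i - c 0 i))%:E.
Proof.
have -> : box c d = [set x : 'rV[R]_N | forall i, `]c 0 i, d 0 i[%classic (x 0 i)].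
  apply/seteqP; split => x /= H i; first by rewrite /= in_itv/=; apply/andP; exact: H.
  by have := H i; rewrite /= in_itv/= => /andP.
rewrite (@lebesgue_rV_box R N (fun i => `]c 0 i, d 0 i[%classic)); last first.
  by move=> i; exact: measurable_itv.
rewrite -prodEFin; apply: eq_bigr => i _.
rewrite lebesgue_measure_itv/= lte_fin; case: ltP => [cd|dc].
  by rewrite -EFinB max_r// subr_ge0 ltW.
by rewrite max_l// subr_le0.
Qed.

Lemma box_measure_lty c d : (lebesgue_rV R N (box c d) < +oo)%E.
Proof. by rewrite box_measure ltry. Qed.

Lemma coord_bounded x : exists k : nat, cube k%:R x.
Proof.
pose f := fun i => (Num.truncn `|x 0 i|).+1.
exists (\max_i f i)%N => i; rewrite !mxE.
have : `|x 0 i| < (\max_i f i)%N%:R.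
  apply: (@lt_le_trans _ _ (f i)%:R); first exact: truncnS_gt.
  by rewrite ler_nat; exact: leq_bigmax.
by rewrite ltr_norml => /andP.
Qed.

Lemma cube_cover : \bigcup_(k : nat) cube k%:R = setT.
Proof.
by apply/seteqP; split => // x _; have [k kx] := coord_bounded x; exists k.
Qed.

Lemma subset_cube r s : r <= s -> cube r `<=` cube s.
Proof.
move=> rs x + i => /(_ i); rewrite !mxE => -[h1 h2]; split.
  by rewrite (le_lt_trans _ h1)// lerN2.
exact: lt_le_trans rs.
Qed.

Lemma boxI c d c' d' : box c d `&` box c' d' =
  box (\row_i Num.max (c 0 i) (c' 0 i)) (\row_i Num.min (d 0 i) (d' 0 i)).
Proof.
apply/seteqP; split => x /=.
  by move=> [h h'] i; rewrite !mxE gt_max lt_min; have [-> ->] := h i; have [-> ->] := h' i.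
move=> h; split=> i; have := h i; rewrite !mxE gt_max lt_min.
  by move=> [/andP[? ?] /andP[? ?]].
by move=> [/andP[? ?] /andP[? ?]].
Qed.

Definition boxes : set (set 'rV[R]_N) := [set A | exists c d, A = box c d].

Lemma boxes_setI_closed : setI_closed boxes.
Proof.
by move=> _ _ [c [d ->]] [c' [d' ->]]; rewrite boxI; do 2 eexists.
Qed.

(** A preimage of an interval under one coordinate is a countable union of
boxes which are large in the other coordinates. *)
Lemma measurable_boxes : @measurable _ 'rV[R]_N = <<s boxes >>.
Proof.
apply/seteqP; split; last first.
  apply: smallest_sub; first exact: sigma_algebra_measurable.
  by move=> _ [c [d ->]]; exact: measurable_box.
suff mid : @measurable_fun _ _ (g_sigma_algebraType boxes) 'rV[R]_N setT id.
  by move=> A mA; have := mid measurableT A mA; rewrite setTI preimage_id.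
apply: measurable_fun_rVP => i.
apply: (measurability _ (@RGenOInfty.measurableE R)) => // _ [_ [a ->] <-].
rewrite setTI.
pose c k : 'rV[R]_N := \row_j if j == i then a else - k%:R.
suff -> : (@rV_coord R N i \o id) @^-1` `]a, +oo[%classic =
    \bigcup_(k : nat) (box (c k) (const_mx k%:R)).
  by apply: bigcupT_measurable => k; apply: sub_sigma_algebra; do 2 eexists.
apply/seteqP; split => x /=; rewrite in_itv/= andbT.
  move=> ax; have [k kx] := coord_bounded x; exists k => // j.
  have := kx j; rewrite !mxE => -[h1 h2]; split => //.
  by case: eqP => [->|_].
by move=> [k _ /(_ i)]; rewrite !mxE eqxx => -[].
Qed.

(** Boxes generate the sigma-algebra, are stable under intersection, and countably
many of them cover the space. *)
Lemma measure_eq_on_boxes (m1 m2 : {measure set 'rV[R]_N -> \bar R}) :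
  (forall c d, m1 (box c d) = m2 (box c d)) ->
  (forall c d, m1 (box c d) < +oo)%E ->
  forall A, measurable A -> m1 A = m2 A.
Proof.
move=> m12 m1oo A mA.
apply: (measure_unique boxes (fun k => cube k%:R)) => //.
- exact: measurable_boxes.
- exact: boxes_setI_closed.
- by move=> i; do 2 eexists.
- exact: cube_cover.
- by move=> _ [c [d ->]].
- by move=> k; exact: m1oo.
Qed.

End Box.

Section LebesgueRV.
Context (R : realType) (N : nat).

Let lebesgue_rV_sigma_finite : sigma_finite setT (lebesgue_rV R N).
Proof.
exists (fun k => cube k%:R); first by rewrite cube_cover.
by move=> k; split; [exact: measurable_box|exact: box_measure_lty].
Qed.

Definition lebRV_ : set 'rV[R]_N -> \bar R := lebesgue_rV R N.
HB.instance Definition _ := Measure.on lebRV_.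
HB.instance Definition _ :=
  Measure_isSigmaFinite.Build _ _ _ lebRV_ lebesgue_rV_sigma_finite.

(** The same measure, with the structure that Fubini needs. *)
Definition lebRV : {sigma_finite_measure set 'rV[R]_N -> \bar R} := lebRV_.

End LebesgueRV.

Section Borel.
Context {R : realType} {N : nat}.
Implicit Types (x : 'rV[R]_N).

Lemma measurable_open (U : set 'rV[R]_N) : open U -> measurable U.
Proof.
move=> oU.
pose B (p : 'rV[rat]_N * nat) := box (\row_i (ratr (p.1 0 i) - p.2.+1%:R^-1) : 'rV[R]_N)
  (\row_i (ratr (p.1 0 i) + p.2.+1%:R^-1)).
pose F p := if asbool (B p `<=` U) then B p else set0.
suff -> : U = \bigcup_p F p.
  apply: countable_bigcupT_measurable; first exact: countableP.
  by move=> p; rewrite /F; case: ifP => _; [exact: measurable_box|exact: measurable0].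
apply/seteqP; split => x; last first.
  by move=> [p _]; rewrite /F; case: asboolP => // + Bx; apply.
move=> Ux; have := open_nbhs_nbhs (conj oU Ux); rewrite -nbhs_ballE => -[e /= e0 eU].
have [k hk] : exists k : nat, k.+1%:R^-1 < e / 2.
  exists (Num.truncn (e / 2)^-1); rewrite invf_plt ?posrE ?divr_gt0//.
  exact: truncnS_gt.
have q i : exists q : rat, x 0 i - k.+1%:R^-1 < ratr q /\ ratr q < x 0 i + k.+1%:R^-1.
  have : x 0 i - k.+1%:R^-1 < x 0 i + k.+1%:R^-1.
    by rewrite ltrD2l gt0_cp// invr_gt0.
  by move=> /rat_in_itvoo[q]; rewrite in_itv/= => /andP[? ?]; exists q.
pose qx : 'rV[rat]_N := \row_i sval (cid (q i)).
have qxP i : x 0 i - k.+1%:R^-1 < ratr (qx 0 i) /\ ratr (qx 0 i) < x 0 i + k.+1%:R^-1.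
  by rewrite mxE; case: cid.
exists (qx, k) => //; rewrite /F asboolT.
  by move=> i; have := qxP i; rewrite !mxE/= ltrBlDr => -[? ?]; rewrite ltrBlDr.
move=> y Hy; apply: eU; split => // i j; rewrite ord1.
have := Hy j; have := qxP j; rewrite !mxE/=.
move: (ratr _) hk; move: (k.+1%:R^-1) => e' r he [h1 h2] [h3 h4].
by rewrite /ball/= ltr_norml; apply/andP; split; lra.
Qed.

Lemma measurable_compact (K : set 'rV[R]_N) : compact K -> measurable K.
Proof.
move=> cK; rewrite -[K]setCK; apply: measurableC; apply: measurable_open.
by apply: closed_openC; exact: compact_closed (@norm_hausdorff _ _) cK.
Qed.

Lemma continuous_measurable_rV (f : 'rV[R]_N -> R) :
  continuous f -> measurable_fun setT f.
Proof.
move=> cf; apply: (measurability _ (@RGenOInfty.measurableE R)) => // _ [_ [a ->] <-].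
rewrite setTI; apply: measurable_open.
by move/continuousP : cf; apply; rewrite set_itvoy; exact: open_gt.
Qed.

Lemma measurable_dotrv (h : 'rV[R]_N) : measurable_fun setT (dotrv h).
Proof.
apply: measurable_sum => i; apply: measurable_funM => //.
exact: measurable_coord.
Qed.

Lemma measurable_enorm : measurable_fun setT (@enorm R N).
Proof.
apply: (measurableT_comp (continuous_measurable_fun (@sqrt_continuous R))).
apply: measurable_sum => i; apply: measurable_funX; exact: measurable_coord.
Qed.

End Borel.

Section ChangeOfVariables.
Context {R : realType} {N : nat}.
Local Open Scope ereal_scope.

Lemma measurable_affine (a : R) (b : 'rV[R]_N) :
  measurable_fun setT (fun x : 'rV[R]_N => a *: x + b)%R.
Proof.
apply: measurable_fun_rVP => i.
rewrite (_ : _ \o _ = fun x : 'rV[R]_N => a * x 0 i + b 0 i)%R; last first.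
  by apply/funext => x; rewrite /= /rV_coord !mxE.
apply: measurable_funD => //; apply: measurable_funM => //; exact: measurable_coord.
Qed.

Let pf (a : R) (b : 'rV[R]_N) : {measure set 'rV[R]_N -> \bar R} :=
  measure_function_pushforward__canonical__measure_function_Measure
    (lebRV R N) (measurable_affine a b).

Lemma lebRV_affine (a : R) (b : 'rV[R]_N) A : (0 < a)%R -> measurable A ->
  (a ^+ N)%:E * lebRV R N ((fun x : 'rV[R]_N => a *: x + b)%R @^-1` A) =
  lebRV R N A.
Proof.
move=> a0 mA.
have k0 : (0 <= a ^+ N)%R by rewrite exprn_ge0// ltW.
have preE c d : (fun x : 'rV[R]_N => a *: x + b)%R @^-1` box c d =
    box (a^-1 *: (c - b))%R (a^-1 *: (d - b))%R.
  by apply/seteqP; split => x /= h i; have := h i; rewrite !mxE ltr_pdivrMl// ltr_pdivlMl//;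
    rewrite ltrBlDr ltrBrDr.
have scE B : mscale (NngNum k0) (pf a b) B =
  (a ^+ N)%:E * lebRV R N ((fun x : 'rV[R]_N => a *: x + b)%R @^-1` B) by [].
rewrite -scE; apply: (@measure_eq_on_boxes R N (mscale (NngNum k0) (pf a b)) (lebRV R N)) => //.
  move=> c d; rewrite [LHS]scE preE /lebRV/= /lebRV_ !box_measure -EFinM; congr EFin.
  have -> : (a ^+ N = \prod_(i < N) a)%R by rewrite prodr_const card_ord.
  rewrite -big_split/=; apply: eq_bigr => i _.
  rewrite !mxE maxr_pMr ?ltW// mulr0; congr (Num.max _ _).
  by field; rewrite gt_eqF.
move=> c d; rewrite [X in X < _]scE preE; rewrite /lebRV/= /lebRV_ box_measure.
by rewrite -EFinM ltry.
Qed.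

Lemma measurable_oppRV : measurable_fun setT (fun x : 'rV[R]_N => - x)%R.
Proof.
rewrite (_ : (fun x => - x)%R = fun x : 'rV[R]_N => (-1) *: x + 0)%R; last first.
  by apply/funext => x; rewrite scaleN1r addr0.
exact: measurable_affine.
Qed.

Lemma lebRV_opp (A : set 'rV[R]_N) : measurable A ->
  lebRV R N ((fun x : 'rV[R]_N => - x)%R @^-1` A) = lebRV R N A.
Proof.
move=> mA.
pose po : {measure set 'rV[R]_N -> \bar R} :=
  measure_function_pushforward__canonical__measure_function_Measure
    (lebRV R N) measurable_oppRV.
have preE c d : (fun x : 'rV[R]_N => - x)%R @^-1` box c d = box (- d)%R (- c)%R.
  by apply/seteqP; split => x /= h i; have [] := h i; rewrite !mxE => ? ?; split; lra.
have poE B : po B = lebRV R N ((fun x : 'rV[R]_N => - x)%R @^-1` B) by [].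
rewrite -poE; apply: (@measure_eq_on_boxes R N po (lebRV R N)) => //.
  move=> c d; rewrite [LHS]poE preE /lebRV/= /lebRV_ !box_measure; congr EFin.
  by apply: eq_bigr => i _; rewrite !mxE opprK addrC.
move=> c d; rewrite [X in X < _]poE preE; exact: box_measure_lty.
Qed.

Lemma integral_translate (f : 'rV[R]_N -> \bar R) (b : 'rV[R]_N) :
  measurable_fun setT f ->
  \int[lebRV R N]_x f (x + b)%R = \int[lebRV R N]_x f x.
Proof.
move=> mf.
have mt : measurable_fun setT (fun x : 'rV[R]_N => x + b)%R.
  have := measurable_affine 1 b; congr (measurable_fun _ _).
  by apply/funext => x; rewrite scale1r.
have ge0 g : measurable_fun setT g -> (forall x, 0 <= g x) ->
    \int[lebRV R N]_x g (x + b)%R = \int[lebRV R N]_x g x.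
  move=> mg g0; rewrite -[LHS](@ge0_integral_pushforward _ _ _ _ _ _ mt (lebRV R N) setT)//.
  apply: eq_measure_integral => A mA _ /=; rewrite /pushforward.
  rewrite -[RHS](lebRV_affine b ltr01 mA) expr1n mul1e; congr (lebRV R N _).
  by apply/seteqP; split => x /=; rewrite scale1r.
rewrite integralE [RHS]integralE -(ge0 f^\+)//; last exact: measurable_funepos.
rewrite -(ge0 f^\-)//; last exact: measurable_funeneg.
by rewrite (funepos_comp f (fun x : 'rV[R]_N => x + b)%R) (funeneg_comp f (fun x : 'rV[R]_N => x + b)%R).
Qed.

Lemma integral_oppRV (f : 'rV[R]_N -> \bar R) :
  measurable_fun setT f ->
  \int[lebRV R N]_x f (- x)%R = \int[lebRV R N]_x f x.
Proof.
move=> mf.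
have ge0 g : measurable_fun setT g -> (forall x, 0 <= g x) ->
    \int[lebRV R N]_x g (- x)%R = \int[lebRV R N]_x g x.
  move=> mg g0.
  have <- : \int[pushforward (lebRV R N) (fun x => - x)%R]_x g x =
      \int[lebRV R N]_x g (- x)%R.
    by rewrite (@ge0_integral_pushforward _ _ _ _ _ _ measurable_oppRV (lebRV R N) setT)//.
  by apply: eq_measure_integral; [exact: measurable_oppRV|move=> mo A mA _; exact: (lebRV_opp mA)].
rewrite integralE [RHS]integralE -(ge0 f^\+)//; last exact: measurable_funepos.
rewrite -(ge0 f^\-)//; last exact: measurable_funeneg.
by rewrite (funepos_comp f (fun x : 'rV[R]_N => - x)%R) (funeneg_comp f (fun x : 'rV[R]_N => - x)%R).
Qed.

Lemma ge0_integral_scale (f : 'rV[R]_N -> \bar R) (a : R) : (0 < a)%R ->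
  measurable_fun setT f -> (forall x, 0 <= f x) ->
  (a ^+ N)%:E * \int[lebRV R N]_x f (a *: x)%R = \int[lebRV R N]_x f x.
Proof.
move=> a0 mf f0.
have mt : measurable_fun setT (fun x : 'rV[R]_N => a *: x)%R.
  have := measurable_affine a 0; congr (measurable_fun _ _).
  by apply/funext => x; rewrite addr0.
have k0 : (0 <= a ^+ N)%R by rewrite exprn_ge0// ltW.
rewrite -[X in _ * X](@ge0_integral_pushforward _ _ _ _ _ _ mt (lebRV R N) setT)//.
rewrite -[LHS](@ge0_integral_mscale _ _ _
  (measure_function_pushforward__canonical__measure_function_Measure
    (lebRV R N) mt) _ _ (NngNum k0))//.
apply: eq_measure_integral => A mA _.
rewrite -[RHS](lebRV_affine 0%R a0 mA).
rewrite [LHS](_ : _ = (a ^+ N)%:E * lebRV R N ((fun x : 'rV[R]_N => a *: x)%R @^-1` A))//.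
congr (_ * lebRV R N _).
by apply/seteqP; split => x /=; rewrite addr0.
Qed.

End ChangeOfVariables.

Section Tonelli.
Context {R : realType} {N : nat}.
Local Open Scope ereal_scope.

(** The product structure of the measure, for inductions on the dimension. *)
Lemma integral_rV_cons (f : 'rV[R]_N.+1 -> \bar R) : measurable_fun setT f ->
  (forall x, 0 <= f x) ->
  \int[lebRV R N.+1]_x f x =
  \int[@lebesgue_measure R]_t \int[lebRV R N]_x f (rV_cons (t, x)).
Proof.
move=> mf f0.
pose m2 : {sigma_finite_measure set 'rV[R]_N -> \bar R} := lebRV R N.
transitivity (\int[pushforward (@lebesgue_measure R \x^ m2) (@rV_cons R N)]_x f x) => //.
rewrite (@ge0_integral_pushforward _ _ _ _ _ _ (@measurable_rV_cons R N) _ setT)//.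
rewrite preimage_setT.
have mfc : measurable_fun setT (f \o @rV_cons R N).
  by apply: measurableT_comp => //; exact: measurable_rV_cons.
rewrite -[RHS](@fubini_tonelli1 _ _ _ _ _ (@lebesgue_measure R) m2 (f \o @rV_cons R N))//; last by move=> x /=; exact: f0.
symmetry.
apply: eq_measure_integral => //= A mA _.
by apply: product_measure_unique => // B C mB mC/=; rewrite product_measure2E.
Qed.

End Tonelli.

(** * Square-integrable functions *)

Lemma EFin_cvg (R : realType) (u : nat -> R) (a : R) :
  u @ \oo --> a -> (u n)%:E @[n --> \oo] --> a%:E.
Proof. by move=> ua; apply/fine_cvgP; split; [exact: nearW|exact: ua]. Qed.

Section L2.
Context {d} {T : measurableType d} {R : realType} (mu : {measure set T -> \bar R}).
Implicit Types f g h : T -> R.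

Definition Int f := mu.-integrable setT (fun x => (f x)%:E).

Lemma IntP f : Int f <->
  measurable_fun setT f /\ (\int[mu]_x `|f x|%:E < +oo)%E.
Proof.
split=> [/integrableP[/measurable_EFinP mf fi]|[mf fi]] //.
by apply/integrableP; split => //; exact/measurable_EFinP.
Qed.

Lemma Int_measurable f : Int f -> measurable_fun setT f.
Proof. by move=> /IntP[]. Qed.

Lemma IntD f g : Int f -> Int g -> Int (fun x => f x + g x).
Proof. by move=> fi gi; have := integrableD measurableT fi gi. Qed.

Lemma IntZ (k : R) f : Int f -> Int (fun x => k * f x).
Proof. by move=> fi; have := integrableZl measurableT k fi. Qed.

Lemma IntN f : Int f -> Int (fun x => - f x).
Proof. by move=> fi; have := integrableN fi. Qed.

Lemma IntB f g : Int f -> Int g -> Int (fun x => f x - g x).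
Proof. by move=> fi /IntN gi; exact: IntD fi gi. Qed.

Lemma Int0 : Int (fun=> 0).
Proof. exact: integrable0. Qed.

Lemma Int_sum (I : Type) (r : seq I) (F : I -> T -> R) :
  (forall i, Int (F i)) -> Int (fun x => \sum_(i <- r) F i x).
Proof.
move=> Fi; elim: r => [|i r IH].
  by under eq_fun do rewrite big_nil; exact: Int0.
by under eq_fun do rewrite big_cons; exact: IntD.
Qed.

Lemma le_Int f g : measurable_fun setT f -> (forall x, `|f x| <= `|g x|) ->
  Int g -> Int f.
Proof.
move=> mf fg gi; apply: (le_integrable measurableT _ _ gi).
  exact/measurable_EFinP.
by move=> x _; rewrite /= lee_fin.
Qed.

Lemma ge0_IntP f : (forall x, 0 <= f x) -> Int f <->
  measurable_fun setT f /\ (\int[mu]_x (f x)%:E < +oo)%E.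
Proof.
move=> f0; rewrite IntP.
by under eq_integral do rewrite ger0_norm//.
Qed.

Lemma Int_abs f : Int f -> Int (fun x => `|f x|).
Proof.
move=> fi; apply: (le_Int _ _ fi) => [|x]; last by rewrite normr_id.
by apply: measurableT_comp => //; exact: Int_measurable.
Qed.

Lemma RintegralE f : Int f -> (\int[mu]_x f x)%:E = (\int[mu]_x (f x)%:E)%E.
Proof. by move=> fi; rewrite /Rintegral fineK//; exact: integrable_fin_num. Qed.

Lemma RintD f g : Int f -> Int g ->
  \int[mu]_x (f x + g x) = \int[mu]_x f x + \int[mu]_x g x.
Proof. exact: RintegralD. Qed.

Lemma RintZ (k : R) f : Int f -> \int[mu]_x (k * f x) = k * \int[mu]_x f x.
Proof. exact: RintegralZl. Qed.

Lemma RintN f : Int f -> \int[mu]_x (- f x) = - \int[mu]_x f x.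
Proof.
by move=> fi; under eq_Rintegral do rewrite -mulN1r; rewrite RintZ// mulN1r.
Qed.

Lemma RintB f g : Int f -> Int g ->
  \int[mu]_x (f x - g x) = \int[mu]_x f x - \int[mu]_x g x.
Proof. by move=> fi gi; rewrite RintD ?RintN//; exact: IntN. Qed.

Lemma Rint_cst0 : \int[mu]_x (0 : R) = 0.
Proof. by rewrite /Rintegral integral0. Qed.

Lemma Rint_sum (I : Type) (r : seq I) (F : I -> T -> R) :
  (forall i, Int (F i)) ->
  \int[mu]_x (\sum_(i <- r) F i x) = \sum_(i <- r) \int[mu]_x F i x.
Proof.
move=> Fi; elim: r => [|i r IH].
  by under eq_Rintegral do rewrite big_nil; rewrite big_nil Rint_cst0.
under eq_Rintegral do rewrite big_cons.
by rewrite big_cons RintD ?IH//; exact: Int_sum.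
Qed.

Lemma le_Rint f g : Int f -> Int g -> (forall x, f x <= g x) ->
  \int[mu]_x f x <= \int[mu]_x g x.
Proof. by move=> fi gi fg; exact: le_Rintegral. Qed.

Lemma Rint_ge0 f : (forall x, 0 <= f x) -> 0 <= \int[mu]_x f x.
Proof. by move=> f0; exact: Rintegral_ge0. Qed.

Lemma ae_eq_Rint f g : measurable_fun setT f -> measurable_fun setT g ->
  {ae mu, forall x, f x = g x} -> \int[mu]_x f x = \int[mu]_x g x.
Proof.
move=> mf mg fg; rewrite /Rintegral; congr fine.
apply: ae_eq_integral => //; [exact/measurable_EFinP|exact/measurable_EFinP|].
by apply: filterS fg => x /= ->.
Qed.

Definition L2 f := measurable_fun setT f /\ (\int[mu]_x (f x ^+ 2)%:E < +oo)%E.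

Lemma L2P f : f \in Lfun mu 2%:E <-> L2 f.
Proof.
split=> [f2|[mf f2]].
  split; first by move: f2; rewrite inE => /andP[/[!inE]].
  have /integrableP[_] := Lfun2_integrable_sqr f2; apply: le_lt_trans.
  rewrite le_eqVlt; apply/orP; left; apply/eqP; apply: eq_integral => x _ /=.
  by rewrite ger0_norm// sqr_ge0.
rewrite inE; apply/andP; split; rewrite inE//=.
rewrite /finite_norm unlock /Lnorm.
apply: poweR_lty; apply: le_lt_trans f2.
rewrite le_eqVlt; apply/orP; left; apply/eqP; apply: eq_integral => x _ /=.
by rewrite powR_mulrn// -normrX ger0_norm ?sqr_ge0.
Qed.

Lemma L2_sqr f : L2 f <-> measurable_fun setT f /\ Int (fun x => f x ^+ 2).
Proof.
split=> -[mf fi]; split => //.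
  by apply/ge0_IntP => [x|]; [exact: sqr_ge0|split => //; exact: measurable_funX].
by have [] := (ge0_IntP (fun x => sqr_ge0 (f x))).1 fi.
Qed.

Lemma L2M f g : L2 f -> L2 g -> Int (fun x => f x * g x).
Proof.
move=> /L2_sqr[mf fi] /L2_sqr[mg gi].
apply: (le_Int _ _ (IntD fi gi)); first exact: measurable_funM.
move=> x; rewrite normrM [leRHS]ger0_norm ?addr_ge0 ?sqr_ge0//.
rewrite -[f x ^+ 2]real_normK ?num_real// -[g x ^+ 2]real_normK ?num_real//.
have := normr_ge0 (f x); have := normr_ge0 (g x).
move: `|f x| `|g x| => a b a0 b0; have := sqr_ge0 (a - b); nra.
Qed.

Lemma le_L2 f g : measurable_fun setT f -> (forall x, `|f x| <= `|g x|) ->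
  L2 g -> L2 f.
Proof.
move=> mf fg /L2_sqr[mg gi]; apply/L2_sqr; split => //.
apply: (le_Int _ _ gi) => [|x]; first exact: measurable_funX.
by rewrite !normrX lerXn2r// nnegrE.
Qed.

Lemma L2Z (k : R) f : L2 f -> L2 (fun x => k * f x).
Proof.
move=> /L2_sqr[mf fi]; apply/L2_sqr; split; first exact: measurable_funM.
by under eq_fun do rewrite exprMn; exact: IntZ.
Qed.

Lemma L2D f g : L2 f -> L2 g -> L2 (fun x => f x + g x).
Proof.
move=> f2 g2; have [mf fi] := (L2_sqr f).1 f2; have [mg gi] := (L2_sqr g).1 g2.
apply/L2_sqr; split; first exact: measurable_funD.
under eq_fun do rewrite sqrrD.
by apply: IntD => //; apply: IntD => //; apply: (IntD (L2M f2 g2) (L2M f2 g2)).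
Qed.

Lemma L2N f : L2 f -> L2 (fun x => - f x).
Proof. by move=> f2; under eq_fun do rewrite -mulN1r; exact: L2Z. Qed.

Lemma L2B f g : L2 f -> L2 g -> L2 (fun x => f x - g x).
Proof. by move=> f2 /L2N g2; exact: L2D f2 g2. Qed.

Lemma L2_0 : L2 (fun=> 0).
Proof.
by apply/L2_sqr; split => //; under eq_fun do rewrite expr0n/=; exact: Int0.
Qed.

Lemma L2_sum (I : Type) (r : seq I) (F : I -> T -> R) :
  (forall i, L2 (F i)) -> L2 (fun x => \sum_(i <- r) F i x).
Proof.
move=> Fi; elim: r => [|i r IH].
  by under eq_fun do rewrite big_nil; exact: L2_0.
by under eq_fun do rewrite big_cons; exact: L2D.
Qed.

Lemma L2_measurable f : L2 f -> measurable_fun setT f.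
Proof. by case. Qed.

(** The inner product, and the square of the norm. *)
Definition ip f g : R := \int[mu]_x (f x * g x).
Definition nsq f : R := ip f f.

Lemma ipC f g : ip f g = ip g f.
Proof. by apply: eq_Rintegral => x _; rewrite mulrC. Qed.

Lemma ipDl f g h : L2 f -> L2 g -> L2 h ->
  ip (fun x => f x + g x) h = ip f h + ip g h.
Proof.
move=> f2 g2 h2; rewrite /ip; under eq_Rintegral do rewrite mulrDl.
by rewrite RintD//; exact: L2M.
Qed.

Lemma ipZl (k : R) f g : L2 f -> L2 g -> ip (fun x => k * f x) g = k * ip f g.
Proof.
move=> f2 g2; rewrite /ip; under eq_Rintegral do rewrite -mulrA.
by rewrite RintZ//; exact: L2M.
Qed.

Lemma ipBl f g h : L2 f -> L2 g -> L2 h ->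
  ip (fun x => f x - g x) h = ip f h - ip g h.
Proof.
move=> f2 g2 h2; rewrite /ip; under eq_Rintegral do rewrite mulrBl.
by rewrite RintB//; exact: L2M.
Qed.

Lemma ipDr f g h : L2 f -> L2 g -> L2 h ->
  ip h (fun x => f x + g x) = ip h f + ip h g.
Proof. by move=> *; rewrite ipC ipDl// ![ip _ h]ipC. Qed.

Lemma ipZr (k : R) f g : L2 f -> L2 g -> ip g (fun x => k * f x) = k * ip g f.
Proof. by move=> *; rewrite ipC ipZl// ipC. Qed.

Lemma ipBr f g h : L2 f -> L2 g -> L2 h ->
  ip h (fun x => f x - g x) = ip h f - ip h g.
Proof. by move=> *; rewrite ipC ipBl// ![ip _ h]ipC. Qed.

Lemma nsq_ge0 f : 0 <= nsq f.
Proof. by apply: Rint_ge0 => x; rewrite -expr2 sqr_ge0. Qed.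

Lemma nsqE f : L2 f -> (\int[mu]_x (f x ^+ 2)%:E)%E = (nsq f)%:E.
Proof. by move=> /L2_sqr[_ fi]; rewrite /nsq /ip -RintegralE//. Qed.

Lemma nsqD f g : L2 f -> L2 g ->
  nsq (fun x => f x + g x) = nsq f + 2 * ip f g + nsq g.
Proof.
move=> f2 g2; rewrite /nsq ipDl ?ipDr//; last exact: L2D.
by rewrite (ipC g f); ring.
Qed.

Lemma nsqZ (k : R) f : L2 f -> nsq (fun x => k * f x) = k ^+ 2 * nsq f.
Proof. by move=> f2; rewrite /nsq ipZl ?ipZr//; [ring|exact: L2Z]. Qed.

Lemma nsqB f g : L2 f -> L2 g ->
  nsq (fun x => f x - g x) = nsq f - 2 * ip f g + nsq g.
Proof.
move=> f2 g2; rewrite /nsq ipBl ?ipBr//; last exact: L2B.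
by rewrite (ipC g f); ring.
Qed.

Lemma nsqBC f g : nsq (fun x => f x - g x) = nsq (fun x => g x - f x).
Proof. by apply: eq_Rintegral => x _; ring. Qed.

Lemma nsqD_le f g : L2 f -> L2 g ->
  nsq (fun x => f x + g x) <= 2 * nsq f + 2 * nsq g.
Proof.
move=> f2 g2; rewrite nsqD//.
by have := nsq_ge0 (fun x => f x - g x); rewrite nsqB//; lra.
Qed.

Lemma nsqB_tri f g h : L2 f -> L2 g -> L2 h ->
  nsq (fun x => f x - g x) <= 2 * nsq (fun x => f x - h x) + 2 * nsq (fun x => h x - g x).
Proof.
move=> f2 g2 h2; rewrite -[leLHS](_ : nsq (fun x => (f x - h x) + (h x - g x)) = _).
  by apply: nsqD_le; exact: L2B.
by apply: eq_Rintegral => x _; ring.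
Qed.

Lemma le_nsq f g : L2 f -> L2 g -> (forall x, `|f x| <= `|g x|) -> nsq f <= nsq g.
Proof.
move=> f2 g2 fg; apply: le_Rint; [exact: L2M|exact: L2M|move=> x].
by rewrite -!expr2 -[_ ^+ 2]real_normK ?num_real// -[leRHS]real_normK ?num_real// lerXn2r// nnegrE.
Qed.

Lemma cauchy_schwarz f g : L2 f -> L2 g -> ip f g ^+ 2 <= nsq f * nsq g.
Proof.
move=> f2 g2; have [g0|g0] := eqVneq (nsq g) 0.
  suff -> : ip f g = 0 by rewrite expr0n/= g0 mulr0.
  have H t : 0 <= nsq f - 2 * t * ip f g.
    have := nsq_ge0 (fun x => f x - t * g x).
    by rewrite nsqB ?nsqZ ?ipZr//; [rewrite g0; lra|exact: L2Z].
  apply/eqP; apply: contraT => i0.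
  have := H ((nsq f + 1) / (2 * ip f g)).
  rewrite (_ : 2 * _ * _ = nsq f + 1); last by field.
  by lra.
have gp : 0 < nsq g by rewrite lt_neqAle eq_sym g0 nsq_ge0.
have := nsq_ge0 (fun x => f x - (ip f g / nsq g) * g x).
rewrite nsqB ?nsqZ ?ipZr//; last exact: L2Z.
rewrite (_ : _ - _ + _ = nsq f - ip f g ^+ 2 / nsq g); last by field.
by rewrite subr_ge0 ler_pdivrMr.
Qed.

Lemma ip_le f g : L2 f -> L2 g -> `|ip f g| <= Num.sqrt (nsq f) * Num.sqrt (nsq g).
Proof.
move=> f2 g2; rewrite -sqrtrM ?nsq_ge0// -sqrtr_sqr ler_wsqrtr//.
exact: cauchy_schwarz.
Qed.

Definition L2cvg (F : nat -> T -> R) f := nsq (fun x => F k x - f x) @[k --> \oo] --> 0.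

Lemma ip_cvg (F G : nat -> T -> R) f g :
  (forall k, L2 (F k)) -> (forall k, L2 (G k)) -> L2 f -> L2 g ->
  L2cvg F f -> L2cvg G g -> ip (F k) (G k) @[k --> \oo] --> ip f g.
Proof.
move=> F2 G2 f2 g2 Ff Gg.
have E k : ip (F k) (G k) = ip f g +
   (ip (fun x => F k x - f x) (fun x => G k x - g x) +
    ip (fun x => F k x - f x) g + ip f (fun x => G k x - g x)).
  rewrite !ipBl ?ipBr//; first (by ring); exact: L2B.
rewrite (funext E).
rewrite -[X in _ --> X]addr0; apply: cvgD; first exact: cvg_cst.
have s0 : Num.sqrt (0 : R) = 0 by rewrite sqrtr0.
have Fs : Num.sqrt (nsq (fun x => F k x - f x)) @[k --> \oo] --> 0.
  by rewrite -s0; apply: continuous_cvg => //; exact: sqrt_continuous.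
have Gs : Num.sqrt (nsq (fun x => G k x - g x)) @[k --> \oo] --> 0.
  by rewrite -s0; apply: continuous_cvg => //; exact: sqrt_continuous.
have bnd (u v : nat -> T -> R) (a b : R) :
    (forall k, L2 (u k)) -> (forall k, L2 (v k)) ->
    Num.sqrt (nsq (u k)) @[k --> \oo] --> a -> Num.sqrt (nsq (v k)) @[k --> \oo] --> b ->
    a * b = 0 -> ip (u k) (v k) @[k --> \oo] --> 0.
  move=> u2 v2 ua vb ab; apply: norm_cvg0.
  apply: (@squeeze_cvgr _ _ _ _ (fun=> 0) (fun k => Num.sqrt (nsq (u k)) * Num.sqrt (nsq (v k)))).
  - by apply: nearW => k; rewrite normr_ge0 ip_le.
  - exact: cvg_cst.
  - by rewrite -ab; exact: cvgM.
rewrite -[X in _ --> X](addr0 0); apply: cvgD; last first.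
  apply: (bnd (fun=> f) (fun k x => G k x - g x) _ 0) => //; last by rewrite mulr0.
    by move=> k; exact: L2B.
  exact: cvg_cst.
rewrite -[X in _ --> X](addr0 0); apply: cvgD.
  apply: (bnd _ _ 0 0) => //; last by rewrite mulr0.
  - by move=> k; exact: L2B.
  - by move=> k; exact: L2B.
apply: (bnd _ (fun=> g) 0) => //; last by rewrite mul0r.
- by move=> k; exact: L2B.
- exact: cvg_cst.
Qed.

Lemma L2cvg_cst f : L2cvg (fun=> f) f.
Proof.
rewrite /L2cvg (_ : (fun _ => _) = cst 0); first exact: cvg_cst.
apply/funext => k; rewrite /nsq /ip; under eq_Rintegral do rewrite subrr mulr0.
exact: Rint_cst0.
Qed.

Lemma nsq_cvg (F : nat -> T -> R) f :
  (forall k, L2 (F k)) -> L2 f -> L2cvg F f -> nsq (F k) @[k --> \oo] --> nsq f.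
Proof. by move=> F2 f2 Ff; exact: ip_cvg. Qed.

Lemma Rint_dominated (F : nat -> T -> R) f g :
  (forall k, measurable_fun setT (F k)) -> Int g ->
  (forall x, F k x @[k --> \oo] --> f x) -> (forall k x, `|F k x| <= g x) ->
  Int f /\ \int[mu]_x F k x @[k --> \oo] --> \int[mu]_x f x.
Proof.
move=> mF Ig Ff Fg.
have mE k : measurable_fun setT (fun x => (F k x)%:E) by exact/measurable_EFinP.
have mf : measurable_fun setT f by apply: (measurable_fun_cvg mF) => x _; exact: Ff.
have [||||If _ H] := @dominated_convergence _ _ _ mu setT measurableT
  (fun k x => (F k x)%:E) (fun x => (f x)%:E) (fun x => (g x)%:E) mE.
- exact/measurable_EFinP.
- by apply: aeW => x _; exact: EFin_cvg.
- exact: Ig.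
- by apply: aeW => x k _; rewrite /= lee_fin.
split => //; move: H; rewrite -RintegralE// => H.
have E k : (\int[mu]_x (F k x)%:E)%E = (\int[mu]_x F k x)%:E.
  rewrite RintegralE//; apply: le_Int Ig => // x.
  by apply: le_trans (Fg k x) (ler_norm _).
by move: H; under eq_fun do rewrite E; move/fine_cvg.
Qed.

Lemma L2_dominated (F : nat -> T -> R) f g :
  (forall k, measurable_fun setT (F k)) -> L2 g ->
  (forall x, F k x @[k --> \oo] --> f x) -> (forall k x, `|F k x| <= g x) ->
  [/\ forall k, L2 (F k), L2 f & L2cvg F f].
Proof.
move=> mF g2 Ff Fg.
have mf : measurable_fun setT f by apply: (measurable_fun_cvg mF) => x _; exact: Ff.
have g0 x : 0 <= g x by exact: le_trans (Fg 0%N x).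
have fg x : `|f x| <= g x.
  have /cvg_norm cfx := Ff x.
  rewrite -(cvg_lim _ cfx)//; apply: limr_le; first exact: (cvgP _ cfx).
  by apply: nearW => k; exact: Fg.
have F2 k : L2 (F k) by apply: (le_L2 _ _ g2) => // x; rewrite (ger0_norm (g0 x)).
have f2 : L2 f by apply: (le_L2 _ _ g2) => // x; rewrite (ger0_norm (g0 x)).
split => //; rewrite /L2cvg.
have [||||_] := @Rint_dominated (fun k x => (F k x - f x) * (F k x - f x)) (fun=> 0)
  (fun x => 4 * g x ^+ 2).
- by move=> k; apply: measurable_funM; apply: measurable_funB.
- by apply: IntZ; have [] := (L2_sqr g).1 g2.
- move=> x; have D0 : F n x - f x @[n --> \oo] --> 0 by apply/subr_cvg0.
  by rewrite -[X in _ --> X](mulr0 0); exact: cvgM.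
- move=> k x; rewrite -expr2 ger0_norm ?sqr_ge0//.
  have := Fg k x; have := fg x; rewrite !ler_norml => /andP[? ?] /andP[? ?].
  by have := g0 x; nra.
by rewrite Rint_cst0.
Qed.

(** Decay of a limit from a uniform bound on the norms, without a dominating
function. *)
Lemma L2_Fatou (F : nat -> T -> R) f (M : R) :
  (forall k, L2 (F k)) -> (forall x, F k x @[k --> \oo] --> f x) ->
  (\forall k \near \oo, nsq (F k) <= M) -> L2 f /\ nsq f <= M.
Proof.
move=> F2 Ff FM.
have mf : measurable_fun setT f.
  by apply: (measurable_fun_cvg (fun k => L2_measurable (F2 k))) => x _; exact: Ff.
have mF k : measurable_fun setT (fun x => (F k x ^+ 2)%:E).
  by apply/measurable_EFinP/measurable_funX/L2_measurable.
have F0 k x : setT x -> (0 <= (F k x ^+ 2)%:E)%E by rewrite lee_fin sqr_ge0.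
have H : (\int[mu]_x (f x ^+ 2)%:E <= M%:E)%E.
  have := @fatou _ _ _ mu setT measurableT _ mF F0.
  rewrite (eq_integral (fun x => (f x ^+ 2)%:E)); last first.
    move=> x _; apply: (cvg_limn_einf_sup _).1; apply: EFin_cvg.
    rewrite (_ : (fun n => F n x ^+ 2) = (fun n => F n x * F n x))//.
    by rewrite expr2; exact: cvgM.
  move=> /le_trans; apply.
  rewrite limn_einf_lim; apply: lime_le; first exact: is_cvg_einfs.
  have [K _ HK] := FM; exists K => // k /= Kk.
  apply: (@le_trans _ _ (nsq (F k))%:E); last by rewrite lee_fin; exact: HK.
  by rewrite -nsqE//; apply: ereal_inf_lbound; exists k => /=.
have f2 : L2 f by split => //; exact: le_lt_trans H (ltry _).
by split => //; rewrite -lee_fin -nsqE.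
Qed.

Lemma ae_eq_nsq f g : measurable_fun setT f -> measurable_fun setT g ->
  {ae mu, forall x, f x = g x} -> nsq f = nsq g.
Proof.
move=> mf mg fg; apply: ae_eq_Rint; [exact: measurable_funM|exact: measurable_funM|].
by apply: filterS fg => x ->.
Qed.

Lemma ae_eq_L2 f g : measurable_fun setT f ->
  {ae mu, forall x, f x = g x} -> L2 g -> L2 f.
Proof.
move=> mf fg [mg g2]; split => //; rewrite (ae_eq_integral (fun x => (g x ^+ 2)%:E))//.
- exact/measurable_EFinP/measurable_funX.
- exact/measurable_EFinP/measurable_funX.
- by apply: filterS fg => x /= ->.
Qed.

(** Riesz-Fischer: along a subsequence with increments of square norm at most
4^-j, the weighted sum of the squared increments is integrable, hence finite
almost everywhere, and the subsequence converges there. *)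
Lemma L2_complete (F : nat -> T -> R) : (forall k, L2 (F k)) ->
  (forall e, 0 < e -> exists K, forall k l, (K <= k)%N -> (K <= l)%N ->
     nsq (fun x => F k x - F l x) <= e) ->
  exists2 f, L2 f & L2cvg F f.
Proof.
move=> F2 Fc.
have q0 j : 0 < (4^-1 : R) ^+ j by rewrite exprn_gt0// invr_gt0.
have KP j := cid (Fc _ (q0 j)).
pose K j := sval (KP j).
pose phi j := (\sum_(i < j.+1) (K i).+1)%N.
have phi_ge j : (K j <= phi j)%N.
  by rewrite /phi big_ord_recr/= (leq_trans _ (leq_addl _ _)).
have phiS j : (phi j <= phi j.+1)%N by rewrite [phi j.+1]/phi big_ord_recr/= leq_addr.
have phi_id j : (j <= phi j)%N.
  elim: j => // j IH; rewrite [phi j.+1]/phi big_ord_recr/= addnS ltnS.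
  exact: leq_trans IH (leq_addr _ _).
pose G j x := F (phi j.+1) x - F (phi j) x.
have G2 j : L2 (G j) by exact: L2B.
have Gle j : nsq (G j) <= 4^-1 ^+ j.
  exact: (svalP (KP j) _ _ (leq_trans (phi_ge j) (phiS j)) (phi_ge j)).
(* The weight 2 ^+ j leaves an integrable sum, as the squared norm of G j is at
   most 4 ^ - j, and still bounds `|G j x| by a summable sequence. *)
pose s j x := (2 ^+ j * G j x ^+ 2)%:E.
have s0 j x : (0 <= s j x)%E by rewrite lee_fin mulr_ge0 ?sqr_ge0// exprn_ge0.
have ms j : measurable_fun setT (s j).
  by apply/measurable_EFinP/measurable_funM => //; apply/measurable_funX/L2_measurable.
have mS : measurable_fun setT (fun x => \sum_(j <oo) s j x)%E.
  exact: ge0_emeasurable_sum.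
have iS : mu.-integrable setT (fun x => \sum_(j <oo) s j x)%E.
  apply/integrableP; split => //.
  under eq_integral do rewrite gee0_abs ?nneseries_ge0//.
  rewrite integral_nneseries//.
  apply: (@le_lt_trans _ _ (\sum_(j <oo) ((2 : R) / (2 ^ j.+1)%:R)%:E)%E); last first.
    by rewrite (le_lt_trans (epsilon_trick0 xpredT _))// ltry.
  apply: lee_nneseries => [j _ _|j _]; first exact: integral_ge0.
  rewrite /s; under eq_integral do rewrite EFinM.
  rewrite ge0_integralZl//; last 2 first.
  - exact/measurable_EFinP/measurable_funX/L2_measurable.
  - by move=> x _; rewrite lee_fin sqr_ge0.
  rewrite nsqE// -EFinM lee_fin.
  rewrite (le_trans (ler_wpM2l _ (Gle j))) ?exprn_ge0//.
  rewrite exprVn (_ : 4 = 2 * 2 :> R); last by ring.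
  rewrite natrX exprMn exprS le_eqVlt; apply/orP; left; apply/eqP.
  by field; rewrite expf_neq0.
have [N [mN N0 SN]] := integrable_ae measurableT iS.
(* Cutting off the null set N makes the subsequence converge everywhere. *)
pose h j x := F (phi j) x * \1_(~` N) x.
have mh j : measurable_fun setT (h j).
  apply: measurable_funM; first exact: L2_measurable.
  by apply: measurable_indic; exact: measurableC.
have aeh j : {ae mu, forall x, h j x = F (phi j) x}.
  exists N; split => // x /= hx; apply: contrapT => Nx; apply: hx.
  by rewrite /h indicE mem_set// mulr1.
have h2 j : L2 (h j) by apply: ae_eq_L2 (aeh j) (F2 _).
have cvh x : cvgn (h ^~ x).
  have [xN|xN] := pselect (N x).
    rewrite (_ : h ^~ x = cst 0); first exact: is_cvg_cst.
    by apply/funext => j; rewrite /h indicE memNset ?mulr0//= => /(_ xN).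
  rewrite (_ : h ^~ x = (fun j => F (phi j) x)); last first.
    by apply/funext => j; rewrite /h indicE mem_set ?mulr1.
  have Sfin : (\sum_(j <oo) s j x)%E \is a fin_num.
    by apply: contrapT => Sx; apply: xN; apply: SN => /(_ I).
  have cs : cvgn (series (fun j => 2 ^+ j * G j x ^+ 2)).
    apply: nondecreasing_is_cvgn.
      apply/nondecreasing_seqP => n; rewrite seriesSr lerDl.
      by rewrite mulr_ge0 ?sqr_ge0// exprn_ge0.
    exists (fine (\sum_(j <oo) s j x)%E) => _ [n _ <-].
    rewrite -lee_fin fineK// /series/= -sumEFin.
    by apply: (@nneseries_lim_ge R (fun j => s j x) xpredT 0 n) => j _ _; exact: s0.
  have cg : cvgn (series (geometric 1 (2^-1 : R))).
    by apply: is_cvg_geometric_series; rewrite ger0_norm ?invr_ge0// invf_lt1// ltr1n.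
  have cG : cvgn (series (fun j => G j x)).
    apply: normed_cvg.
    apply: (@series_le_cvg _ _ (fun j => 2 ^+ j * G j x ^+ 2 + geometric 1 2^-1 j)) => //.
    - by move=> j /=; exact: normr_ge0.
    - by move=> j; rewrite /geometric/= mul1r; apply: addr_ge0; [apply: mulr_ge0; [exact: exprn_ge0|exact: sqr_ge0]|apply: exprn_ge0; rewrite invr_ge0].
    - move=> j; rewrite /geometric/= mul1r exprVn -[G j x ^+ 2]real_normK ?num_real//.
      have p0 : 0 < (2 : R) ^+ j by rewrite exprn_gt0.
      move: (`|G j x|) (normr_ge0 (G j x)) p0; move: (2 ^+ j) => p a a0 p0.
      have pi0 : 0 < p^-1 by rewrite invr_gt0.
      have E : p * a ^+ 2 + p^-1 - 2 * a = p^-1 * (p * a - 1) ^+ 2.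
        by field; rewrite gt_eqF.
      have : 0 <= p^-1 * (p * a - 1) ^+ 2 by rewrite mulr_ge0 ?sqr_ge0// ltW.
      by rewrite -E; lra.
    - rewrite (_ : series _ = series (fun j => 2 ^+ j * G j x ^+ 2) + series (geometric 1 2^-1)).
        exact: is_cvgD.
      by apply/funext => n; rewrite /series/= big_split.
  have -> : (fun j => F (phi j) x) = (fun j => F (phi 0%N) x + series (fun j => G j x) j).
    by apply/funext => j; rewrite /series/= /G telescope_sumr// addrC subrK.
  by apply: is_cvgD => //; exact: is_cvg_cst.
pose f x := limn (h ^~ x).
have hf x : h j x @[j --> \oo] --> f x by exact: cvh.
have key e K0 : (forall k l, (K0 <= k)%N -> (K0 <= l)%N ->
     nsq (fun x => F k x - F l x) <= e) -> forall k, (K0 <= k)%N ->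
     L2 (fun x => F k x - f x) /\ nsq (fun x => F k x - f x) <= e.
  move=> He k K0k; apply: (@L2_Fatou (fun j x => F k x - h j x)).
  - by move=> j; exact: L2B.
  - by move=> x; apply: cvgB => //; exact: cvg_cst.
  - exists K0 => // j /= K0j.
    rewrite (_ : nsq _ = nsq (fun x => F k x - F (phi j) x)).
      by apply: He => //; exact: leq_trans (phi_id j).
    apply: ae_eq_nsq; [exact/L2_measurable/L2B|exact/L2_measurable/L2B|].
    by apply: filterS (aeh j) => x ->.
have f2 : L2 f.
  have [K0 HK0] := Fc 1 ltr01; have [D2 _] := key _ _ HK0 K0 (leqnn _).
  rewrite (_ : f = (fun x => F K0 x - (F K0 x - f x))); first exact: L2B.
  by apply/funext => x; rewrite subKr.
exists f => //; apply/cvgrPdist_le => /= e e0; have [K0 HK0] := Fc e e0.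
exists K0 => // k /= K0k; rewrite sub0r normrN ger0_norm ?nsq_ge0//.
by have [] := key _ _ HK0 k K0k.
Qed.

Lemma L2cvg_cauchy (F : nat -> T -> R) f : (forall k, L2 (F k)) -> L2 f -> L2cvg F f ->
  forall e, 0 < e -> exists K, forall k l, (K <= k)%N -> (K <= l)%N ->
     nsq (fun x => F k x - F l x) <= e.
Proof.
move=> F2 f2 Ff e e0.
have e4 : 0 < e / 4 by rewrite divr_gt0.
have /cvgrPdist_le/(_ _ e4)[K _ HK] := Ff; exists K => k l Kk Kl.
have H n : (K <= n)%N -> nsq (fun x => F n x - f x) <= e / 4.
  by move=> /HK /=; rewrite sub0r normrN ger0_norm ?nsq_ge0.
apply: le_trans (nsqB_tri (F2 k) (F2 l) f2) _.
by rewrite [X in _ + 2 * X]nsqBC; have := H k Kk; have := H l Kl; lra.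
Qed.

Lemma nsq_eq0 f : L2 f -> nsq f = 0 -> {ae mu, forall x, f x = 0}.
Proof.
move=> f2 f0.
have mf : measurable_fun setT (fun x => (f x ^+ 2)%:E).
  exact/measurable_EFinP/measurable_funX/L2_measurable.
have := (ae_eq_integral_abs mu measurableT mf).1.
under eq_integral do rewrite gee0_abs ?lee_fin ?sqr_ge0//.
rewrite nsqE// f0 => /(_ erefl); apply: filterS => x /(_ I)/= [] /eqP.
by rewrite sqrf_eq0 => /eqP.
Qed.

End L2.

(** * One-dimensional integrals *)

Section HalfLine.
Context {R : realType}.
Notation leb := (@lebesgue_measure R).
Notation D := (`]0%R, +oo[%classic : set R).

Lemma FTC_itv (F f : R -> R) (a b : R) : (a <= b)%R ->
  (forall x : R, (a <= x <= b)%R -> is_derive x 1 F (f x)) ->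
  (forall x : R, (a <= x <= b)%R -> {for x, continuous f}) ->
  (\int[leb]_(x in `[a, b]) (f x)%:E)%E = (F b - F a)%:E.
Proof.
rewrite le_eqVlt => /predU1P[->|ab] dF cf.
  by rewrite set_itv1 integral_set1 subrr.
have cF (x : R) : (a <= x <= b)%R -> {for x, continuous F}.
  move=> xab; apply: differentiable_continuous; apply/derivable1_diffP.
  by have [] := dF x xab.
rewrite (@continuous_FTC2 _ f F)//.
- apply/continuous_within_itvP => //; split.
  + by move=> x; rewrite in_itv/= => /andP[/ltW ax /ltW xb]; apply: cf; rewrite ax xb.
  + by apply: cvg_at_right_filter; apply: cf; rewrite lexx ltW.
  + by apply: cvg_at_left_filter; apply: cf; rewrite lexx ltW.
- split.
  + move=> x; rewrite in_itv/= => /andP[/ltW ax /ltW xb].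
    by have [] : is_derive x 1 F (f x) by apply: dF; rewrite ax xb.
  + by apply: cvg_at_right_filter; apply: cF; rewrite lexx ltW.
  + by apply: cvg_at_left_filter; apply: cF; rewrite lexx ltW.
- move=> x; rewrite in_itv/= => /andP[/ltW ax /ltW xb].
  have xab : (a <= x <= b)%R by rewrite ax xb.
  by rewrite derive1E; have [_ ->] := dF x xab.
Qed.

Lemma FTC_y (F f : R -> R) (a l : R) : (forall x : R, (a <= x)%R -> (0 <= f x)%R) ->
  (forall x : R, (a <= x)%R -> is_derive x 1 F (f x)) ->
  (forall x : R, (a <= x)%R -> {for x, continuous f}) ->
  F x @[x --> +oo] --> l ->
  (\int[leb]_(x in `[a, +oo[) (f x)%:E)%E = (l - F a)%:E.
Proof.
move=> f0 dF cf Fl.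
have cF (x : R) : (a <= x)%R -> {for x, continuous F}.
  move=> xab; apply: differentiable_continuous; apply/derivable1_diffP.
  by have [] := dF x xab.
rewrite (@ge0_continuous_FTC2y _ f F _ l)//.
- apply/continuous_within_itvcyP; split.
  + by move=> x; rewrite in_itv/= andbT => /ltW ax; exact: cf.
  + by apply: cvg_at_right_filter; exact: cf.
- by move=> x /ltW ax; have [] := dF x ax.
- by apply: cvg_at_right_filter; exact: cF.
- move=> x; rewrite in_itv/= andbT => /ltW ax.
  by rewrite derive1E; have [_ ->] := dF x ax.
Qed.

Lemma continuous_powR (a x : R) : (0 < x)%R -> {for x, continuous (fun t => powR t a)}.
Proof.
move=> x0; apply: differentiable_continuous; apply/derivable1_diffP.
by have [] := is_derive1_powR a x0.
Qed.

Lemma powR_cvgNy (s : R) : (0 < s)%R -> x `^ (- s) @[x --> +oo] --> (0 : R).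
Proof.
move=> s0; apply/cvgrPdist_le => /= e e0; near=> x.
have x0 : (0 < x)%R by near: x; exact: nbhs_pinfty_gt.
have xe : e^-1 `^ (s^-1) <= x by near: x; exact: nbhs_pinfty_ge.
rewrite sub0r normrN ger0_norm ?powR_ge0// powRN invf_ple ?posrE ?powR_gt0//.
apply: (@le_trans _ _ ((e^-1 `^ (s^-1)) `^ s)%R).
  by rewrite -powRrM mulVf ?gt_eqF// powRr1// invr_ge0 ltW.
by apply: ge0_ler_powR; rewrite ?nnegrE ?powR_ge0 ?(ltW s0) ?(ltW x0).
Unshelve. all: by end_near. Qed.

Lemma int_powR_tail (s tau : R) : (0 < s)%R -> (0 < tau)%R ->
  (\int[leb]_(r in `]tau, +oo[) (r `^ (- s - 1))%:E)%E = (tau `^ (- s) / s)%:E.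
Proof.
move=> s0 t0.
rewrite integral_itv_obnd_cbnd; last first.
  by apply: measurable_funTS; apply/measurable_EFinP; exact: measurable_powR.
transitivity ((0 - (- s^-1 * tau `^ (- s)))%:E); last by congr EFin; ring.
apply: (@FTC_y (fun x => - s^-1 * x `^ (- s))).
- by move=> x _; exact: powR_ge0.
- move=> x tx; have x0 := lt_le_trans t0 tx.
  have H := is_derive1_powR (- s) x0.
  apply: is_derive_eq; rewrite /GRing.scale/= mulrA; rewrite mulrNN mulVf ?mul1r ?gt_eqF//.
- by move=> x tx; apply: continuous_powR; exact: lt_le_trans tx.
- by rewrite -[X in _ --> X](mulr0 (- s^-1)%R); apply: cvgM; [exact: cvg_cst|exact: powR_cvgNy].
Qed.

Lemma int_powR_head (s tau : R) : 0 < s -> 0 < tau ->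
  (\int[leb]_(r in `]0%R, tau[) (r `^ (s - 1))%:E)%E = (tau `^ s / s)%:E.
Proof.
move=> s0 t0.
have mp : measurable_fun setT (fun r : R => (r `^ (s - 1))%:E).
  by apply/measurable_EFinP; exact: measurable_powR.
pose F k := `[tau / k.+1%:R, tau]%classic : set R.
have lek k : tau / k.+1%:R <= tau.
  by rewrite ler_pdivrMr// ler_peMr ?ler1n// ltW.
have pk k : 0 < tau / k.+1%:R by rewrite divr_gt0.
have FE : `]0%R, tau]%classic = \bigcup_k F k.
  apply/seteqP; split => x /=.
    rewrite in_itv/= => /andP[x0 xt]; exists (Num.truncn (tau / x)) => //.
    rewrite /F/= in_itv/= xt andbT ler_pdivrMr// mulrC -ler_pdivrMr//.
    exact: ltW (truncnS_gt _).
  move=> [k _]; rewrite /F/= !in_itv/= => /andP[kx ->]; rewrite andbT.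
  exact: lt_le_trans kx.
transitivity (\int[leb]_(r in `]0%R, tau]) (r `^ (s - 1))%:E)%E.
  by rewrite integral_itv_bndo_bndc//; exact: measurable_funTS.
rewrite FE.
have cv1 : (\int[leb]_(x in F k) (x `^ (s - 1))%:E)%E @[k --> \oo] -->
    (\int[leb]_(x in \bigcup_k F k) (x `^ (s - 1))%:E)%E.
  apply: ge0_nondecreasing_set_cvg_integral => //.
  - apply/nondecreasing_seqP => k; rewrite subsetEset => x; rewrite /F/= !in_itv/=.
    move=> /andP[kx ->]; rewrite andbT (le_trans _ kx)// ler_wpM2l ?ltW//.
    by rewrite ltf_pV2 ?posrE// ltr_nat.
  - by move=> k; exact: measurable_itv.
  - by move=> k; exact: measurable_funTS.
  - by move=> k x _; rewrite lee_fin powR_ge0.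
have iE k : (\int[leb]_(x in F k) (x `^ (s - 1))%:E)%E =
    (s^-1 * (tau `^ s) - s^-1 * (tau / k.+1%:R) `^ s)%:E.
  apply: (@FTC_itv (fun x => s^-1 * x `^ s)) => //.
  - move=> x /andP[kx _]; have x0 := lt_le_trans (pk k) kx.
    have H := is_derive1_powR s x0.
    by apply: is_derive_eq; rewrite /GRing.scale/= mulrA mulVf ?mul1r ?gt_eqF.
  - by move=> x /andP[kx _]; apply: continuous_powR; exact: lt_le_trans kx.
rewrite (funext iE) in cv1.
have cv2 : (s^-1 * (tau `^ s) - s^-1 * (tau / k.+1%:R) `^ s)%:E @[k --> \oo] -->
    (tau `^ s / s)%:E.
  apply/fine_cvgP; split; first exact: nearW.
  rewrite [X in _ --> X](_ : _ = (s^-1 * tau `^ s - s^-1 * 0)); last by rewrite mulr0 subr0 mulrC.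
  apply: cvgB; first exact: cvg_cst.
  apply: cvgM; first exact: cvg_cst.
  have /cvg_at_rightP := powR_cvg0 s0; apply; split => //.
  rewrite -[X in _ --> X](mulr0 tau); apply: cvgM; first exact: cvg_cst.
  exact: cvg_harmonic.
by rewrite -(cvg_lim _ cv1)// (cvg_lim _ cv2).
Qed.

(** The two ways of slicing a region of the quadrant, which the applications below use
to exchange a primitive with a power weight. *)
Lemma tonelli_rel (P : set (R * R)) (w k : R -> R) :
  measurable P -> measurable_fun setT w -> measurable_fun setT k ->
  (forall r t, P (r, t) -> [/\ 0 < r, 0 < t, 0 <= w r & 0 <= k t]) ->
  (\int[leb]_(r in D) ((w r)%:E * \int[leb]_(t in [set t | P (r, t)]) (k t)%:E) =
   \int[leb]_(t in D) ((k t)%:E * \int[leb]_(r in [set r | P (r, t)]) (w r)%:E))%E.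
Proof.
move=> mP mw mk P0.
pose f (z : R * R) := (w z.1 * k z.2 * \1_P z)%:E.
have f0 z : (0 <= f z)%E.
  rewrite /f lee_fin indicE; case: z => r t; have [|] := boolP ((r, t) \in P).
    by rewrite inE => /P0[_ _ w0 k0]; rewrite mulr1 mulr_ge0.
  by rewrite mulr0.
have mf : measurable_fun setT f.
  apply/measurable_EFinP/measurable_funM; last exact: measurable_indic.
  by apply: measurable_funM; apply: measurableT_comp.
have := @fubini_tonelli _ _ _ _ _ leb leb f mf f0.
have Px r : measurable [set t | P (r, t)].
  have := measurable_xsection r mP; congr measurable.
  by apply/seteqP; split => t /=; rewrite /xsection/= inE.
have Py t : measurable [set r | P (r, t)].
  have := measurable_ysection t mP; congr measurable.
  by apply/seteqP; split => r /=; rewrite /ysection/= inE.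
have EL r : (\int[leb]_t f (r, t) = (((w r)%:E * \int[leb]_(t in [set t | P (r, t)]) (k t)%:E)) )%E.
  have [[t0 Pt0]|nP] := pselect (exists t, P (r, t)).
    have [_ _ w0 _] := P0 _ _ Pt0.
    rewrite -ge0_integralZl//=;
      do ?[exact: Px r|exact/measurable_funTS/measurable_EFinP|by move=> t /P0[]].
    rewrite [RHS]integral_mkcond; apply: eq_integral => t _.
    rewrite /f/= patchE indicE; have [|] := boolP ((r, t) \in P).
      by rewrite inE => Pt; rewrite mem_set//= mulr1 EFinM.
    by rewrite mulr0 => /negP Pt; rewrite memNset//= => Pt'; apply: Pt; rewrite inE.
  rewrite (_ : [set t | P (r, t)] = set0); last first.
    by apply/seteqP; split => t //= Pt; apply: nP; exists t.
  rewrite integral_set0 mule0; apply: integral0_eq => t _.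
  by rewrite /f indicE memNset ?mulr0// => Pt; apply: nP; exists t.
have ER t : (\int[leb]_r f (r, t) = (((k t)%:E * \int[leb]_(r in [set r | P (r, t)]) (w r)%:E)) )%E.
  have [[r0 Pr0]|nP] := pselect (exists r, P (r, t)).
    have [_ _ _ k0] := P0 _ _ Pr0.
    rewrite -ge0_integralZl//=;
      do ?[exact: Py t|exact/measurable_funTS/measurable_EFinP|by move=> r /P0[]].
    rewrite [RHS]integral_mkcond; apply: eq_integral => r _.
    rewrite /f/= patchE indicE; have [|] := boolP ((r, t) \in P).
      by rewrite inE => Pt; rewrite mem_set//= mulr1 EFinM muleC.
    by rewrite mulr0 => /negP Pt; rewrite memNset//= => Pt'; apply: Pt; rewrite inE.
  rewrite (_ : [set r | P (r, t)] = set0); last first.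
    by apply/seteqP; split => r //= Pt; apply: nP; exists r.
  rewrite integral_set0 mule0; apply: integral0_eq => r _.
  by rewrite /f indicE memNset ?mulr0// => Pt; apply: nP; exists r.
under eq_integral do rewrite EL; under [X in _ = X -> _]eq_integral do rewrite ER.
move=> E; rewrite [LHS]integral_mkcond [RHS]integral_mkcond.
rewrite [LHS](_ : _ = (\int[leb]_r ((w r)%:E * \int[leb]_(t in [set t | P (r, t)]) (k t)%:E))%E); last first.
  apply: eq_integral => r _; rewrite patchE; case: ifPn => // /negP rD.
  rewrite (_ : [set t | P (r, t)] = set0) ?integral_set0 ?mule0//.
  apply/seteqP; split => t //= /P0[r0 _ _ _]; apply: rD.
  by rewrite inE/= in_itv/= r0.
rewrite E; apply: eq_integral => t _; rewrite patchE; case: ifPn => // /negP rD.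
rewrite (_ : [set r | P (r, t)] = set0) ?integral_set0 ?mule0//.
apply/seteqP; split => r //= /P0[_ t0 _ _]; apply: rD.
by rewrite inE/= in_itv/= t0.
Qed.

Lemma measurable_lt_set (f g : R * R -> R) :
  measurable_fun setT f -> measurable_fun setT g ->
  measurable [set z : R * R | f z < g z].
Proof.
move=> mf mg; rewrite -[X in measurable X]setTI.
exact: (measurable_fun_ltr mf mg measurableT (Y := [set true])).
Qed.

(** Tonelli in place of integration by parts: no boundary terms appear and
convergence need not be known in advance. *)
Lemma mellin_primitive (s : R) (k h : R -> R) : 0 < s -> measurable_fun setT k ->
  (forall t, 0 < t -> 0 <= k t) ->
  (forall r, 0 < r -> (\int[leb]_(t in `]0%R, r[) (k t)%:E)%E = (h r)%:E) ->
  (\int[leb]_(r in D) (r `^ (- s - 1) * h r)%:E)%E =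
  (s^-1%:E * \int[leb]_(t in D) (t `^ (- s) * k t)%:E)%E.
Proof.
move=> s0 mk k0 hE.
have := @tonelli_rel [set z | 0 < z.2 /\ z.2 < z.1] (fun r => r `^ (- s - 1)) k.
have mP : measurable [set z : R * R | 0 < z.2 /\ z.2 < z.1].
  rewrite (_ : [set _ | _] = [set z : R * R | 0 < z.2] `&` [set z | z.2 < z.1])//.
  by apply: measurableI; apply: measurable_lt_set.
move=> /(_ mP (measurable_powR _) mk) H.
have {}H := H _; rewrite /= in H.
rewrite [LHS](_ : _ = (\int[leb]_(r in D) ((r `^ (- s - 1))%:E *
    \int[leb]_(t in [set t | (0 < t)%R /\ (t < r)%R]) (k t)%:E))%E); last first.
  apply: eq_integral => r; rewrite inE/= in_itv/= andbT => r0.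
  rewrite EFinM -hE//; congr (_ * integral _ _ _)%E.
  by apply/seteqP; split => t /=; rewrite in_itv/= => /andP.
rewrite H; last first.
  move=> r t [t0 tr]; split => //; [exact: lt_trans tr|exact: powR_ge0|exact: k0].
rewrite -ge0_integralZl/=; last 4 first.
- exact: measurable_itv.
- apply/measurable_funTS/measurable_EFinP/measurable_funM => //; exact: measurable_powR.
- by move=> t; rewrite in_itv/= andbT => t0; rewrite lee_fin mulr_ge0 ?powR_ge0 ?k0.
- by rewrite lee_fin invr_ge0 ltW.
apply: eq_integral => t; rewrite inE/= in_itv/= andbT => t0.
rewrite (_ : [set r | _] = `]t, +oo[%classic); last first.
  apply/seteqP; split => r /=; rewrite in_itv/= andbT; first by case.
  by [].
rewrite int_powR_tail// -!EFinM; congr EFin; ring.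
Qed.

(** The inversion r |-> lam / r is carried out by slicing the region t * r < lam
in both directions, which replaces a change of variables. *)
Lemma mellin_primitive_inv (s lam : R) (k h : R -> R) : 0 < s -> 0 < lam ->
  measurable_fun setT k ->
  (forall t, 0 < t -> 0 <= k t) ->
  (forall r, 0 < r -> (\int[leb]_(t in `]0%R, r[) (k t)%:E)%E = (h r)%:E) ->
  (\int[leb]_(r in D) (r `^ (s - 1) * h (lam / r))%:E)%E =
  ((lam `^ s)%:E * \int[leb]_(r in D) (r `^ (- s - 1) * h r)%:E)%E.
Proof.
move=> s0 lam0 mk k0 hE.
rewrite (mellin_primitive s0 mk k0 hE) muleA -EFinM.
have mP : measurable [set z : R * R | (0 < z.2 /\ 0 < z.1) /\ z.2 * z.1 < lam].
  rewrite (_ : [set _ | _] = ([set z : R * R | 0 < z.2] `&` [set z | 0 < z.1]) `&`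
     [set z | z.2 * z.1 < lam])//.
  apply: measurableI; first apply: measurableI.
  - exact: measurable_lt_set.
  - exact: measurable_lt_set.
  - by apply: measurable_lt_set => //; exact: measurable_funM.
have H := @tonelli_rel [set z | (0 < z.2 /\ 0 < z.1) /\ z.2 * z.1 < lam]
  (fun r => r `^ (s - 1)) k mP (measurable_powR _) mk.
rewrite /= in H.
rewrite [LHS](_ : _ = (\int[leb]_(r in D) ((r `^ (s - 1))%:E *
    \int[leb]_(t in [set t | ((0 < t)%R /\ (0 < r)%R) /\ (t * r < lam)%R]) (k t)%:E))%E); last first.
  apply: eq_integral => r; rewrite inE/= in_itv/= andbT => r0.
  rewrite EFinM -hE ?divr_gt0//; congr (_ * integral _ _ _)%E.
  apply/seteqP; split => t /=; rewrite in_itv/= ltr_pdivlMr//; last first.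
    by move=> [[-> _] ->].
  by move=> /andP[].
rewrite H; last first.
  by move=> r t [[t0 r0] tr]; split => //; [exact: powR_ge0|exact: k0].
rewrite -ge0_integralZl/=; last 4 first.
- exact: measurable_itv.
- apply/measurable_funTS/measurable_EFinP/measurable_funM => //; exact: measurable_powR.
- by move=> t; rewrite in_itv/= andbT => t0; rewrite lee_fin mulr_ge0 ?powR_ge0 ?k0.
- by rewrite lee_fin mulr_ge0 ?powR_ge0// invr_ge0 ltW.
apply: eq_integral => t; rewrite inE/= in_itv/= andbT => t0.
rewrite (_ : [set r | _] = `]0%R, (lam / t)[%classic); last first.
  apply/seteqP; split => r /=; rewrite in_itv/= ltr_pdivlMr// mulrC.
    by move=> [[_ ->]].
  by move=> /andP[-> ->].
rewrite int_powR_head ?divr_gt0// -!EFinM; congr EFin.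
rewrite powRM ?ltW ?invr_gt0// -powR_inv1 ?ltW// -powRrM mulN1r; ring.
Qed.

(** Each application of [mellin_primitive] lowers the exponent by one, until the
integral of f 0 is reached; the factors (s - i)^-1 that come out are those of the
recursion of the Gamma function. *)
Lemma mellin_primitives (f : nat -> R -> R) (K : nat) (s : R) :
  (forall j, f j.+1 0 = 0) ->
  (forall j (x : R), is_derive x 1 (f j.+1) (f j x)) ->
  (forall j, continuous (f j)) ->
  (forall t, 0 < t -> 0 <= f 0%N t) ->
  K%:R - 1 < s ->
  (forall j t, 0 < t -> 0 <= f j t) /\
  (\int[leb]_(r in D) (r `^ (- s - 1) * f K r)%:E)%E =
  ((\prod_(i < K) (s - i%:R)^-1)%:E *
   \int[leb]_(r in D) (r `^ (K%:R - s - 1) * f 0%N r)%:E)%E.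
Proof.
move=> f00 df cf f0 sK.
have mf j A : measurable_fun A (fun x => (f j x)%:E).
  by apply/measurable_funTS/measurable_EFinP; exact: continuous_measurable_fun (cf j).
have fE j r : 0 < r -> (\int[leb]_(t in `[0%R, r]) (f j t)%:E)%E = (f j.+1 r)%:E.
  move=> r0; rewrite (@FTC_itv (f j.+1)) ?f00 ?subr0//; first exact: ltW.
  by move=> x _; exact: cf.
have fge0 j t : 0 < t -> 0 <= f j t.
  elim: j t => [//|j IH t t0]; rewrite -lee_fin -fE//.
  rewrite -integral_itv_obnd_cbnd//.
  by apply: integral_ge0 => x; rewrite /= in_itv/= => /andP[x0 _]; rewrite lee_fin IH.
split => //.
elim: K s sK => [|K IH] s sK.
  by rewrite big_ord0 mul1e; apply: eq_integral => r _; rewrite sub0r.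
have s0 : 0 < s by rewrite (le_lt_trans _ sK)// subr_ge0 ler1n.
rewrite (@mellin_primitive s (f K))//.
- rewrite (_ : - s = - (s - 1) - 1); last by ring.
  rewrite IH; last by move: sK; rewrite -natr1; lra.
  rewrite muleA -EFinM big_ord_recl subr0; congr ((_ * _)%:E * _)%E.
    by apply: eq_bigr => i _; rewrite lift0 -natr1; congr (_^-1); ring.
  by apply: eq_integral => r _; rewrite -natr1; congr ((_ `^ _ * _)%:E); ring.
- exact: continuous_measurable_fun.
- by move=> r r0; exact: fge0.
- by move=> r r0; rewrite -fE// integral_itv_bndo_bndc// integral_itv_obnd_cbnd.
Qed.

End HalfLine.

(** * Gaussian integrals *)

Section Gauss1.
Context {R : realType}.
Notation leb := (@lebesgue_measure R).
Variable t : R.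
Hypothesis t0 : 0 < t.

Lemma gauss1_ge0 : (\int[leb]_x (expR (- (t * x ^+ 2)))%:E)%E = (Num.sqrt (pi / t))%:E.
Proof.
pose sg : R := Num.sqrt ((2 * t)^-1).
have sg0 : sg != 0 by rewrite gt_eqF// sqrtr_gt0 invr_gt0 mulr_gt0.
have sg2 : sg ^+ 2 = (2 * t)^-1 by rewrite sqr_sqrtr// invr_ge0 mulr_ge0// ltW.
have pE : normal_peak sg = (Num.sqrt (pi / t))^-1.
  by rewrite /normal_peak sg2 -mulr_natl; congr (Num.sqrt _)^-1; field; rewrite gt_eqF.
have p0 : 0 < normal_peak sg by exact: normal_peak_gt0.
have := integral_normal_pdf 0 sg.
under eq_integral do rewrite normal_pdfE// EFinM.
rewrite ge0_integralZl//; last 3 first.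
- by apply/measurable_EFinP; exact: measurable_normal_fun.
- by move=> x _; rewrite lee_fin normal_fun_ge0.
- by rewrite lee_fin ltW.
have -> : (\int[leb]_x (normal_fun 0 sg x)%:E)%E = (\int[leb]_x (expR (- (t * x ^+ 2)))%:E)%E.
  apply: eq_integral => x _; rewrite /normal_fun subr0 sg2 -mulr_natl; congr (expR _)%:E.
  by field; rewrite gt_eqF.
move=> H.
have : ((normal_peak sg)^-1%:E * ((normal_peak sg)%:E * \int[leb]_x (expR (- (t * x ^+ 2)))%:E))%E = (normal_peak sg)^-1%:E.
  by rewrite H mule1.
by rewrite muleA -EFinM mulVf ?gt_eqF// mul1e pE invrK.
Qed.

Lemma measurable_gauss1 : measurable_fun setT (fun x : R => expR (- (t * x ^+ 2))).
Proof.
apply: measurableT_comp => //; apply: measurable_funN.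
by apply: measurable_funM => //; exact: measurable_funX.
Qed.

Lemma gauss1_Int : Int leb (fun x => expR (- (t * x ^+ 2))).
Proof.
apply/ge0_IntP => [x|]; first exact: expR_ge0.
by split; [exact: measurable_gauss1|rewrite gauss1_ge0 ltry].
Qed.

Lemma gauss1_Rint : \int[leb]_x expR (- (t * x ^+ 2)) = Num.sqrt (pi / t).
Proof. by rewrite /Rintegral gauss1_ge0. Qed.

End Gauss1.

Section Gauss1Fourier.
Context {R : realType}.
Notation leb := (@lebesgue_measure R).
Variable t : R.
Hypothesis t0 : 0 < t.
Let e x : R := expR (- (t * x ^+ 2)).

Lemma xgauss1_Int : Int leb (fun x => `|x| * e x).
Proof.
have t20 : 0 < t / 2 by rewrite divr_gt0.
apply: (le_Int _ _ (IntZ (1 + 2 / t) (gauss1_Int t20))).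
  by apply: measurable_funM; [exact: normr_measurable|exact: measurable_gauss1].
move=> x; rewrite [leLHS]ger0_norm ?mulr_ge0 ?expR_ge0// [leRHS]ger0_norm; last first.
  by rewrite mulr_ge0 ?expR_ge0// addr_ge0// divr_ge0// ltW.
have -> : e x = expR (- (t / 2 * x ^+ 2)) * expR (- (t / 2 * x ^+ 2)).
  by rewrite -expRD; congr expR; field.
rewrite mulrA ler_wpM2r ?expR_ge0// expRN -ler_pdivlMr ?invr_gt0 ?expR_gt0// invrK.
have h := expR_ge1Dx (t / 2 * x ^+ 2).
have tt : 0 < 2 / t by rewrite divr_gt0.
apply: (@le_trans _ _ ((1 + 2 / t) * (1 + t / 2 * x ^+ 2))); last first.
  by rewrite ler_wpM2l// addr_ge0// ltW.
have -> : (1 + 2 / t) * (1 + t / 2 * x ^+ 2) = 1 + 2 / t + t / 2 * x ^+ 2 + x ^+ 2.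
  by field; rewrite gt_eqF.
have : 0 <= t / 2 * x ^+ 2 by rewrite mulr_ge0 ?sqr_ge0// ltW.
rewrite -[x ^+ 2]real_normK ?num_real//.
have := sqr_ge0 (`|x| - 1); nra.
Qed.

Lemma gauss1_cos_Int (q a : R) : Int leb (fun x => e x * cos (q * x + a)).
Proof.
apply: (le_Int _ _ (gauss1_Int t0)).
  apply: measurable_funM; first exact: measurable_gauss1.
  apply: continuous_measurable_fun => x; apply: continuous_comp.
    by apply: cvgD; [apply: cvgM; [exact: cvg_cst|exact: cvg_id]|exact: cvg_cst].
  exact: continuous_cos.
move=> x; rewrite normrM ler_piMr//; exact: cos_max.
Qed.

Lemma Rint_derivative (H h : R -> R) :
  (forall x : R, is_derive x 1 H (h x)) -> continuous h -> Int leb h ->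
  H (k%:R) @[k --> \oo] --> (0 : R) -> H (- k%:R) @[k --> \oo] --> (0 : R) ->
  \int[leb]_x h x = 0.
Proof.
move=> dH ch ih H1 H2.
have mh : measurable_fun setT h by exact: continuous_measurable_fun.
have [||||_ h1] := @Rint_dominated _ _ _ leb (fun k x => h x * \1_(`[- k%:R, k%:R]) x) h
   (fun x => `|h x|).
- by move=> k; apply: measurable_funM.
- exact: Int_abs.
- move=> x; apply/cvgrPdist_le => /= ep ep0.
  near=> k; rewrite indicE mem_set ?mulr1 ?subrr ?normr0 ?ltW//=.
  rewrite in_itv/= -ler_norml.
  by near: k; exact: nbhs_infty_ger.
- by move=> k x; rewrite normrM ler_piMr// indicE; case: (_ \in _); rewrite ?normr1// normr0.
have E k : \int[leb]_x (h x * \1_(`[- k%:R, k%:R]) x) = H k%:R - H (- k%:R).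
  apply: EFin_inj; rewrite -(@FTC_itv _ H h)//; [|by rewrite -subr_ge0 opprK addr_ge0|by move=> x _; exact: ch].
  rewrite [RHS]integral_mkcond RintegralE; last first.
    apply: (le_Int _ _ ih) => [|x]; first exact: measurable_funM.
    by rewrite normrM ler_piMr// indicE; case: (_ \in _); rewrite ?normr1// normr0.
  apply: eq_integral => x _; rewrite patchE indicE.
  by case: ifPn; rewrite ?mulr1 ?mulr0.
rewrite (funext E) in h1.
have h2 : H k%:R - H (- k%:R) @[k --> \oo] --> (0 : R).
  by rewrite -[X in _ --> X](subr0 0); exact: cvgB.
by rewrite -(cvg_lim _ h1)// (cvg_lim _ h2).
Unshelve. all: by end_near. Qed.

Lemma gauss1_cvg0 (k : nat -> R) : (forall j, j%:R <= `|k j|) ->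
  e (k j) @[j --> \oo] --> (0 : R).
Proof.
move=> kj; apply/cvgrPdist_le => /= ep ep0.
near=> j; rewrite sub0r normrN ger0_norm ?expR_ge0//.
rewrite /e expRN invf_ple ?posrE ?expR_gt0//.
apply: le_trans (expR_ge1Dx _).
have j1 : (1 : R) <= j%:R by near: j; exact: nbhs_infty_ger.
have je : (ep^-1 / t) <= j%:R by near: j; exact: nbhs_infty_ger.
have k2 : j%:R <= k j ^+ 2.
  rewrite -[k j ^+ 2]real_normK ?num_real//; have := kj j; nra.
have : ep^-1 <= t * k j ^+ 2.
  by rewrite mulrC -ler_pdivrMr// (le_trans je).
lra.
Unshelve. all: by end_near. Qed.

Let Phi (a q : R) := \int[leb]_x (e x * cos (q * x + a)).

Let S (a q : R) := \int[leb]_x (- x * e x * sin (q * x + a)).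

Let S_Int a q : Int leb (fun x => - x * e x * sin (q * x + a)).
Proof.
apply: (le_Int _ _ xgauss1_Int).
  apply: measurable_funM.
    by apply: measurable_funM; [exact: oppr_measurable|exact: measurable_gauss1].
  apply: continuous_measurable_fun => x; apply: continuous_comp.
    by apply: cvgD; [apply: cvgM; [exact: cvg_cst|exact: cvg_id]|exact: cvg_cst].
  exact: continuous_sin.
move=> x; rewrite !normrM normrN normr_id ler_piMr ?mulr_ge0//; exact: sin_max.
Qed.

(** Integration by parts turns the derivative S of Phi into a multiple of Phi. *)
Let S_eq a q : S a q = - (q / (2 * t)) * Phi a q.
Proof.
have d (x : R) : is_derive x 1 (fun x => e x * sin (q * x + a))
    (2 * t * (- x * e x * sin (q * x + a)) + q * (e x * cos (q * x + a))).
  rewrite /e; apply: is_derive_eq; rewrite /GRing.scale/=; ring.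
have ih : Int leb (fun x => 2 * t * (- x * e x * sin (q * x + a)) + q * (e x * cos (q * x + a))).
  by apply: IntD; apply: IntZ; [exact: S_Int|exact: gauss1_cos_Int].
have := Rint_derivative d _ ih; rewrite RintD ?RintZ; last 4 first.
- exact: gauss1_cos_Int.
- exact: S_Int.
- by apply: IntZ; exact: S_Int.
- by apply: IntZ; exact: gauss1_cos_Int.
have bnd (k : nat -> R) : (forall j, j%:R <= `|k j|) ->
    e (k j) * sin (q * k j + a) @[j --> \oo] --> (0 : R).
  move=> kj; apply: norm_cvg0; apply: (@squeeze_cvgr _ _ _ _ (fun=> 0) (fun j => e (k j))).
  - apply: nearW => j; rewrite normr_ge0/= normrM (ger0_norm (expR_ge0 _)) ler_piMr ?expR_ge0//.
    exact: sin_max.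
  - exact: cvg_cst.
  - exact: gauss1_cvg0.
move=> /(_ _ _ _)H; have : 2 * t * S a q + q * Phi a q = 0.
  apply: H.
  - move=> x; apply: differentiable_continuous; apply/derivable1_diffP.
    by apply: ex_derive.
  - by apply: bnd => j; rewrite ger0_norm.
  - by apply: bnd => j; rewrite normrN ger0_norm.
move=> E; apply: (mulfI (_ : 2 * t != 0)); first by rewrite mulf_neq0 ?gt_eqF.
rewrite -[LHS](addrK (q * Phi a q)) E; field; rewrite gt_eqF//.
Qed.

(** By [S_eq], Phi solves Phi' = - q / (2 t) * Phi, so that its product with
exp (q^2 / (4 t)) is constant. *)
Lemma gauss1_cos (a q : R) :
  \int[leb]_x (e x * cos (q * x + a)) =
  Num.sqrt (pi / t) * expR (- (q ^+ 2 / (4 * t))) * cos a.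
Proof.
have dPhi (p : R) : is_derive p 1 (Phi a) (S a p).
  have pin : `]p - 1, p + 1[%classic p by rewrite /= in_itv/=; apply/andP; split; lra.
  pose f q x := e x * cos (q * x + a).
  have df (q' x : R) : is_derive q' 1 (f ^~ x) (- x * e x * sin (q' * x + a)).
    by rewrite /f; apply: is_derive_eq; rewrite /GRing.scale/=; ring.
  have d1 (q' x : R) : partial1of2 f q' x = - x * e x * sin (q' * x + a).
    by rewrite partial1of2E; have [_ ->] := df q' x.
  have bd (q' x : R) : `|partial1of2 f q' x| <= `|x| * e x.
    rewrite d1 !normrM normrN (ger0_norm (expR_ge0 _)) ler_piMr ?mulr_ge0 ?expR_ge0//.
    exact: sin_max.
  have fi (q' : R) : `]p - 1, p + 1[%classic q' -> Int leb (f q').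
    by move=> _; exact: gauss1_cos_Int.
  have fd (q' x : R) : `]p - 1, p + 1[%classic q' -> setT x -> derivable (f ^~ x) q' 1.
    by move=> _ _; have [] := df q' x.
  have G0 (x : R) : 0 <= `|x| * e x by rewrite mulr_ge0// expR_ge0.
  have Hd := @derivable_under_integral _ _ _ leb f setT measurableT p _ _ pin fi fd _ G0 xgauss1_Int (fun q' x _ _ => bd q' x).
  have HE := @differentiation_under_integral _ _ _ leb f setT measurableT p _ _ pin fi fd _ G0 xgauss1_Int (fun q' x _ _ => bd q' x).
  apply: DeriveDef; first exact: Hd.
  by rewrite -derive1E HE; apply: eq_Rintegral => x _; rewrite d1.
pose Psi (p : R) := Phi a p * expR (p ^+ 2 / (4 * t)).
have dPsi (p : R) : is_derive p 1 Psi 0.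
  have := dPhi p; rewrite S_eq => dP; rewrite /Psi.
  apply: is_derive_eq; rewrite /GRing.scale/=; field; rewrite gt_eqF//.
have PsiE : Psi q = Psi 0 by exact: is_derive_0_is_cst.
have : Phi a q = Psi q * expR (- (q ^+ 2 / (4 * t))).
  by rewrite /Psi -mulrA -expRD subrr expR0 mulr1.
rewrite PsiE /Psi expr0n/= mul0r expR0 mulr1 => E.
rewrite -/(Phi a q) E /Phi; under eq_Rintegral do rewrite mul0r add0r mulrC.
rewrite RintZ ?gauss1_Rint//; [ring|exact: gauss1_Int].
Qed.

End Gauss1Fourier.

Section GaussN.
Context {R : realType}.
Notation leb := (@lebesgue_measure R).
Variable t : R.
Hypothesis t0 : 0 < t.

Definition sqn {N} (y : 'rV[R]_N) : R := \sum_i y 0 i ^+ 2.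

Lemma sqn_ge0 N (y : 'rV[R]_N) : 0 <= sqn y.
Proof. by apply: sumr_ge0 => i _; exact: sqr_ge0. Qed.

Lemma enorm_sqr N (y : 'rV[R]_N) : enorm y ^+ 2 = sqn y.
Proof. by rewrite sqr_sqrtr// sqn_ge0. Qed.

Lemma enorm_ge0 N (y : 'rV[R]_N) : 0 <= enorm y.
Proof. exact: sqrtr_ge0. Qed.

Lemma sqn_cons N (a : R) (y : 'rV[R]_N) : sqn (rV_cons (a, y)) = a ^+ 2 + sqn y.
Proof.
rewrite /sqn big_ord_recl !mxE unlift_none; congr (_ + _).
by apply: eq_bigr => i _; rewrite !mxE liftK.
Qed.

Lemma dotrv_cons N (xi : 'rV[R]_N.+1) (a : R) (y : 'rV[R]_N) :
  dotrv xi (rV_cons (a, y)) = xi 0 ord0 * a + dotrv (\row_i xi 0 (lift ord0 i)) y.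
Proof.
rewrite /dotrv big_ord_recl !mxE unlift_none; congr (_ + _).
by apply: eq_bigr => i _; rewrite !mxE liftK.
Qed.

Lemma sqn_recl N (xi : 'rV[R]_N.+1) :
  sqn xi = xi 0 ord0 ^+ 2 + sqn (\row_i xi 0 (lift ord0 i) : 'rV[R]_N).
Proof.
rewrite /sqn big_ord_recl; congr (_ + _).
by apply: eq_bigr => i _; rewrite !mxE.
Qed.

Lemma measurable_sqn N : measurable_fun setT (@sqn N).
Proof. by apply: measurable_sum => i; apply: measurable_funX; exact: measurable_coord. Qed.

Lemma measurable_gaussN N : measurable_fun setT (fun y : 'rV[R]_N => expR (- (t * sqn y))).
Proof.
apply: measurableT_comp => //; apply: measurable_funN.
by apply: measurable_funM => //; exact: measurable_sqn.
Qed.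

Lemma measurable_cos_dotrv N (xi : 'rV[R]_N) (a : R) :
  measurable_fun setT (fun y : 'rV[R]_N => cos (dotrv xi y + a)).
Proof.
apply: (measurableT_comp (continuous_measurable_fun (@continuous_cos R))).
by apply: measurable_funD => //; exact: measurable_dotrv.
Qed.

Let c := Num.sqrt (pi / t).

(** The wave is shifted by 1 to stay within nonnegative integrands; the phase
makes the induction on the dimension go through. *)
Lemma gaussN_1cos N (xi : 'rV[R]_N) (a : R) :
  (\int[lebRV R N]_y (expR (- (t * sqn y)) * (1 + cos (dotrv xi y + a)))%:E)%E =
  (c ^+ N * (1 + expR (- (sqn xi / (4 * t))) * cos a))%:E.
Proof.
have mf M (x : 'rV[R]_M) b : measurable_fun setT
    (fun y : 'rV[R]_M => (expR (- (t * sqn y)) * (1 + cos (dotrv x y + b)))%:E).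
  apply/measurable_EFinP/measurable_funM; first exact: measurable_gaussN.
  by apply: measurable_funD => //; exact: measurable_cos_dotrv.
have f0 M (x : 'rV[R]_M) b y :
    (0 <= (expR (- (t * sqn y)) * (1 + cos (dotrv x y + b)))%:E)%E.
  rewrite lee_fin; apply: mulr_ge0; first exact: expR_ge0.
  by have := cos_geN1 (dotrv x y + b); lra.
elim: N xi a => [|N IH] xi a.
  transitivity (\int[@dirac _ 'rV[R]_0 0%R R]_y
    (expR (- (t * sqn y)) * (1 + cos (dotrv xi y + a)))%:E)%E => //.
  rewrite integral_dirac//; last exact: mf.
  rewrite diracE mem_set// mul1e.
  by rewrite /sqn /dotrv !big_ord0 mul0r mulr0 oppr0 expR0 !mul1r add0r.
rewrite integral_rV_cons//.
set q := sqn (\row_i xi 0 (lift ord0 i) : 'rV[R]_N); set E := expR (- (q / (4 * t))).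
have E1 y0 : (\int[lebRV R N]_y (expR (- (t * sqn (rV_cons (y0, y)))) *
      (1 + cos (dotrv xi (rV_cons (y0, y)) + a)))%:E)%E =
    (c ^+ N * (expR (- (t * y0 ^+ 2)) +
     E * (expR (- (t * y0 ^+ 2)) * cos (xi 0 ord0 * y0 + a))))%:E.
  transitivity ((expR (- (t * y0 ^+ 2)))%:E *
    (c ^+ N * (1 + E * cos (xi 0 ord0 * y0 + a)))%:E)%E; last first.
    by rewrite -EFinM; congr EFin; ring.
  rewrite -IH -ge0_integralZl//; last exact: mf.
  apply: eq_integral => y _; rewrite -EFinM sqn_cons dotrv_cons mulrA -expRD.
  congr (expR _ * (1 + cos _))%:E; ring.
under eq_integral do rewrite E1.
have ih := gauss1_cos_Int t0 (xi 0 ord0) a.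
rewrite -RintegralE; last by apply: IntZ; apply: IntD; [exact: gauss1_Int|exact: IntZ].
rewrite RintZ; last by apply: IntD; [exact: gauss1_Int|exact: IntZ].
rewrite RintD; [|exact: gauss1_Int|exact: IntZ].
rewrite RintZ// gauss1_Rint// gauss1_cos// -/c sqn_recl -/q (exprS c).
have -> : expR (- ((xi 0 ord0 ^+ 2 + q) / (4 * t))) = expR (- (xi 0 ord0 ^+ 2 / (4 * t))) * E.
  by rewrite /E -expRD; congr expR; ring.
by congr EFin; ring.
Qed.

Lemma gaussN_ge0 N :
  (\int[lebRV R N]_y (expR (- (t * sqn y)))%:E)%E = (c ^+ N)%:E.
Proof.
have H := @gaussN_1cos N 0 0.
have : ((2^-1)%:E * \int[lebRV R N]_y (expR (- (t * sqn y)) * (1 + cos (dotrv 0 y + 0)))%:E)%E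
   = (c ^+ N)%:E.
  rewrite H -EFinM; congr EFin; rewrite cos0 /sqn big1 ?mul0r ?oppr0 ?expR0; first by field.
  by move=> i _; rewrite mxE expr0n.
have f0 y : (0 <= (expR (- (t * sqn y)) * (1 + cos (dotrv (0 : 'rV[R]_N) y + 0)))%:E)%E.
  rewrite lee_fin; apply: mulr_ge0; first exact: expR_ge0.
  by have := cos_geN1 (dotrv (0 : 'rV[R]_N) y + 0); lra.
rewrite -ge0_integralZl//; last first.
  apply/measurable_EFinP/measurable_funM; first exact: measurable_gaussN.
  by apply: measurable_funD => //; exact: measurable_cos_dotrv.
move=> <-; apply: eq_integral => y _; rewrite -EFinM; congr EFin.
rewrite /dotrv big1 ?addr0 ?cos0; first by field.
by move=> i _; rewrite mxE mul0r.
Qed.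

Lemma gaussN_Int N : Int (lebRV R N) (fun y : 'rV[R]_N => expR (- (t * sqn y))).
Proof.
apply/ge0_IntP => [x|]; first exact: expR_ge0.
by split; [exact: measurable_gaussN|rewrite gaussN_ge0 ltry].
Qed.

Lemma gaussN_cos_Int N (xi : 'rV[R]_N) a :
  Int (lebRV R N) (fun y => expR (- (t * sqn y)) * cos (dotrv xi y + a)).
Proof.
apply: (le_Int _ _ (gaussN_Int N)).
  by apply: measurable_funM; [exact: measurable_gaussN|exact: measurable_cos_dotrv].
by move=> x; rewrite normrM ler_piMr//; exact: cos_max.
Qed.

Lemma gaussN_cos N (xi : 'rV[R]_N) a :
  \int[lebRV R N]_y (expR (- (t * sqn y)) * cos (dotrv xi y + a)) =
  c ^+ N * expR (- (sqn xi / (4 * t))) * cos a.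
Proof.
have ig := gaussN_Int N; have ic := gaussN_cos_Int xi a.
have : (\int[lebRV R N]_y (expR (- (t * sqn y)) + expR (- (t * sqn y)) * cos (dotrv xi y + a)))%:E
  = (c ^+ N * (1 + expR (- (sqn xi / (4 * t))) * cos a))%:E.
  rewrite RintegralE; last exact: IntD.
  by rewrite -gaussN_1cos; apply: eq_integral => y _; rewrite mulrDr mulr1.
rewrite RintD// => -[]; rewrite {1}/Rintegral gaussN_ge0/= mulrDr mulr1 => /addrI ->.
by rewrite mulrA.
Qed.

End GaussN.

(** * Finite differences *)

Section FiniteDifference.
Context {R : realType}.
Implicit Types F : int -> R.

Definition fdiff F : int -> R := fun p => F p - F (p + 1).

Lemma iter_fdiff M F p :
  iter M fdiff F p = \sum_(0 <= j < M.+1) (-1) ^+ j * 'C(M, j)%:R * F (p + j%:Z).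
Proof.
elim: M p => [|M IH] p.
  by rewrite big_nat1 bin0 !mul1r addr0.
rewrite iterS /fdiff !IH [RHS]big_nat_recl// bin0 expr0 mul1r addr0.
rewrite [X in _ = _ + X](eq_bigr (fun j => (-1) ^+ j.+1 * 'C(M, j.+1)%:R * F (p + j.+1%:Z) -
   (-1) ^+ j * 'C(M, j)%:R * F (p + 1 + j%:Z))); last first.
  move=> j _; rewrite binS natrD (_ : p + 1 + j%:Z = p + j.+1%:Z); last first.
    by rewrite -addrA -PoszD add1n.
  by rewrite exprS; ring.
rewrite sumrB addrA; congr (_ - _).
rewrite [X in _ = _ + X]big_nat_recr//= (bin_small (ltnSn M)) mulr0 mul0r addr0.
by rewrite [LHS]big_nat_recl// bin0 expr0 !mul1r addr0.
Qed.

Lemma fdiffE F G : F =1 G -> fdiff F =1 fdiff G.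
Proof. by move=> FG p; rewrite /fdiff !FG. Qed.

Lemma iter_fdiffE M F G : F =1 G -> iter M fdiff F =1 iter M fdiff G.
Proof. by move=> FG; elim: M => // M IH p /=; exact: fdiffE. Qed.

Lemma iter_fdiff_lin M (I : Type) (r : seq I) (c : I -> R) (F : I -> int -> R) p :
  iter M fdiff (fun q => \sum_(i <- r) c i * F i q) p =
  \sum_(i <- r) c i * iter M fdiff (F i) p.
Proof.
rewrite iter_fdiff; under eq_bigr do rewrite mulr_sumr.
rewrite exchange_big/=; apply: eq_bigr => i _; rewrite iter_fdiff mulr_sumr.
by apply: eq_bigr => j _; ring.
Qed.

Lemma iter_fdiff_monomial M i p : (i < M)%N ->
  iter M fdiff (fun q => (q%:~R : R) ^+ i) p = 0.
Proof.
elim: M i p => // M IH i p iM; rewrite iterSr.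
rewrite (@iter_fdiffE _ _ (fun q => \sum_(j < i) (- 'C(i, j)%:R) * (q%:~R : R) ^+ j)); last first.
  move=> q; rewrite /fdiff rmorphD/= mulr1z (addrC q%:~R) exprDn big_ord_recr/= subnn expr0 binn mul1r mulr1n.
  rewrite opprD addrCA subrr addr0 -sumrN; apply: eq_bigr => j _.
  by rewrite expr1n mul1r -mulr_natl mulNr.
rewrite iter_fdiff_lin big1// => j _; rewrite IH ?mulr0//.
exact: leq_trans (ltn_ord j) iM.
Qed.

(** The weights in the sum that defines [delta], indexed as there. *)
Definition dcoef m (j : nat) : R := (-1) ^ (j%:Z - m%:Z) * 'C(2 * m, 2 * m - j)%:R.

Lemma sum_dcoef m F : \sum_(0 <= j < (2 * m).+1) dcoef m j * F (j%:Z - m%:Z) =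
  (-1) ^+ m * iter (2 * m) fdiff F (- m%:Z).
Proof.
rewrite iter_fdiff mulr_sumr; apply: eq_big_nat => j /andP[_ j2m].
rewrite /dcoef bin_sub// (addrC (- _)) expfzDr ?oppr_eq0 ?oner_eq0//.
rewrite -exprnP -exprnN -exprVn invrN invr1; ring.
Qed.

(** A difference of order 2m annihilates the powers below 2m, in particular the even
ones. *)
Lemma sum_dcoef_monomial m i : (i < m)%N ->
  \sum_(0 <= j < (2 * m).+1) dcoef m j * ((j%:Z - m%:Z)%:~R ^+ 2) ^+ i = 0.
Proof.
move=> im; rewrite (eq_bigr (fun j => dcoef m j * (fun q => (q%:~R : R) ^+ (2 * i)) (j%:Z - m%:Z))); last first.
  by move=> j _; rewrite exprM.
by rewrite (@sum_dcoef m (fun q => (q%:~R : R) ^+ (2 * i))) iter_fdiff_monomial ?mulr0// ltn_mul2l.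
Qed.

(** Up to a shift by m, the difference of order 2m is the m-th power of the centred
second difference, here with its sign changed. *)
Lemma sum_dcoef_eigen m c F : (forall p, 2 * F p - F (p - 1) - F (p + 1) = c * F p) ->
  \sum_(0 <= j < (2 * m).+1) dcoef m j * F (j%:Z - m%:Z) = c ^+ m * F 0.
Proof.
move=> Fc; rewrite sum_dcoef.
suff H p : iter (2 * m) fdiff F p = (- c) ^+ m * F (p + m%:Z).
  by rewrite H addNr mulrA -exprMn mulN1r opprK.
elim: m p => [|m IH] p; first by rewrite muln0 addr0 expr0 mul1r.
rewrite mulnS iterD /= /fdiff !IH -!addrA.
have := Fc (p + (m%:Z + 1)).
rewrite (_ : p + (m%:Z + 1) - 1 = p + m%:Z); last by ring.
rewrite (_ : p + (m%:Z + 1) + 1 = p + (1 + (1 + m%:Z))); last by ring.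
rewrite (_ : p + m.+1%:Z = p + (m%:Z + 1)); last by rewrite -addn1 PoszD.
rewrite exprS => E; transitivity (- (c * F (p + (m%:Z + 1))) * (- c) ^+ m); last by ring.
by rewrite -E; ring.
Qed.

(** The Fourier multiplier of [delta] m, as a function of the phase y . xi. *)
Definition dsym m (th : R) : R := (2 - 2 * cos th) ^+ m.

Lemma dsym_ge0 m th : 0 <= dsym m th.
Proof. by rewrite exprn_ge0//; have := cos_le1 th; lra. Qed.

Lemma dsymM m k th : dsym m th * dsym k th = dsym (m + k) th.
Proof. by rewrite /dsym exprD. Qed.

Lemma cosD_sub (a b : R) : cos (a - b) + cos (a + b) = 2 * cos a * cos b.
Proof. by rewrite cosB cosD; ring. Qed.

Lemma sum_dcoef_cos m (th a : R) :
  \sum_(0 <= j < (2 * m).+1) dcoef m j * cos ((j%:Z - m%:Z)%:~R * th + a) =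
  dsym m th * cos a.
Proof.
rewrite (@sum_dcoef_eigen m (2 - 2 * cos th) (fun p => cos (p%:~R * th + a))).
  by rewrite mul0r add0r.
move=> p; rewrite rmorphB rmorphD/= mulr1z.
rewrite (_ : (_ - 1) * th + a = (p%:~R * th + a) - th); last by ring.
rewrite (_ : (_ + 1) * th + a = (p%:~R * th + a) + th); last by ring.
by rewrite -addrA -opprD cosD_sub; ring.
Qed.

(** The nodes k and - k carry the same weight. *)
Lemma sum_dcoef_sym m (f : R -> R) : f 0 = 0 ->
  \sum_(0 <= j < (2 * m).+1) dcoef m j * f ((j%:Z - m%:Z)%:~R ^+ 2) =
  2 * \sum_(1 <= k < m.+1) (-1) ^+ k * 'C(2 * m, m - k)%:R * f (k%:R ^+ 2).
Proof.
move=> f0.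
have -> : (2 * m).+1 = (m + m.+1)%N by rewrite addnS addnn mul2n.
rewrite (@big_cat_nat _ _ _ m)//=; last by rewrite leq_addr.
rewrite [X in _ + X](_ : _ = \sum_(0 <= k < m.+1) (-1) ^+ k * 'C(2 * m, m - k)%:R * f (k%:R ^+ 2)); last first.
  rewrite -[X in index_iota X _]add0n [X in index_iota _ X]addnC big_addn addnK.
  apply: eq_big_nat => k /andP[_ km].
  rewrite /dcoef PoszD addrK -exprnP; congr (_ * _%:R * _).
  by congr 'C(_, _); rewrite mul2n -addnn; lia.
rewrite [X in X + _](_ : _ = \sum_(1 <= k < m.+1) (-1) ^+ k * 'C(2 * m, m - k)%:R * f (k%:R ^+ 2)); last first.
  rewrite big_nat_rev/= big_add1/= add0n; apply: eq_big_nat => j /andP[_ jm].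
  have -> : (m - j.+1)%:Z - m%:Z = - j.+1%:Z by rewrite -subzn//; ring.
  rewrite /dcoef; have -> : (m - j.+1)%:Z - m%:Z = - j.+1%:Z by rewrite -subzn//; ring.
  rewrite -exprnN -exprVn invrN invr1 rmorphN/= sqrrN; congr (_ * _%:R * _).
  have j2 : (m - j.+1 <= 2 * m)%N by lia.
  exact: bin_sub.
rewrite [X in _ + X]big_ltn//= expr0n/= f0 mulr0 add0r.
by rewrite -mulr2n mulr_natl.
Qed.

End FiniteDifference.

(** * The Gamma integral *)

Section GammaFacts.
Context {R : realType}.
Notation leb := (@lebesgue_measure R).
Notation D := (`]0%R, +oo[%classic : set R).

Definition eGamma (x : R) : \bar R := (\int[leb]_(t in D) (t `^ (x - 1) * expR (- t))%:E)%E.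

Lemma measurable_eGamma (x : R) A : measurable_fun A (fun t : R => (t `^ (x - 1) * expR (- t))%:E).
Proof.
apply/measurable_funTS/measurable_EFinP/measurable_funM; first exact: measurable_powR.
by apply: measurableT_comp => //; exact: oppr_measurable.
Qed.

Lemma eGamma_lty (x : R) : 0 < x -> (eGamma x < +oo)%E.
Proof.
move=> x0; rewrite /eGamma.
have -> : D = `]0%R, 1%R[%classic `|` `[1%R, +oo[%classic.
  apply/seteqP; split => t /=; rewrite !in_itv/= !andbT.
    by move=> ->; case: (ltP t 1) => h; [left|right].
  by move=> [/andP[]//|]; apply: lt_le_trans.
have f0 (t : R) : (0 <= (t `^ (x - 1) * expR (- t))%:E)%E.
  by rewrite lee_fin mulr_ge0 ?powR_ge0 ?expR_ge0.
rewrite ge0_integral_setU//=; [|exact: measurable_eGamma|]; last first.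
  rewrite disj_set2E; apply/eqP/seteqP; split => t //= [].
  by rewrite !in_itv/= andbT => /andP[_ h1] h2; have := lt_le_trans h1 h2; rewrite ltxx.
rewrite lte_add_pinfty//.
  apply: (@le_lt_trans _ _ (\int[leb]_(r in `]0%R, 1%R[) (r `^ (x - 1))%:E)%E).
    apply: ge0_le_integral => //.
    - exact: measurable_eGamma.
    - by apply/measurable_funTS/measurable_EFinP; exact: measurable_powR.
    - move=> t; rewrite /= in_itv/= => /andP[t0 _].
      by rewrite lee_fin ler_piMr ?powR_ge0// expR_le1 oppr_le0 ltW.
  by rewrite int_powR_head// ltry.
pose n := (Num.truncn (x + 1)).
apply: (@le_lt_trans _ _ (\int[leb]_(r in `[1%R, +oo[) ((n.+1`!)%:R%:E * (r `^ (- 1 - 1))%:E))%E).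
  apply: ge0_le_integral => //.
  - exact: measurable_eGamma.
  - apply: measurable_funeM.
    by apply/measurable_funTS/measurable_EFinP; exact: measurable_powR.
  - move=> t; rewrite /= in_itv/= andbT => t1.
    have t0 : 0 < t by rewrite (lt_le_trans ltr01).
    rewrite -EFinM lee_fin expRN ler_pdivrMr ?expR_gt0//.
    rewrite (_ : x - 1 = (x + 1) + (- 1 - 1)); last by ring.
    rewrite powRD; last by rewrite (lt0r_neq0 t0) implybT.
    rewrite mulrAC ler_wpM2r ?powR_ge0//.
    apply: (@le_trans _ _ (t ^+ n.+1)).
      rewrite -powR_mulrn ?(ltW t0)//; apply: ler_powR => //; exact: ltW (truncnS_gt _).
    rewrite -ler_pdivrMl ?ltr0n ?fact_gt0// mulrC.
    by have := expR_ge1Dxn n (ltW t0); lra.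
rewrite ge0_integralZl//; last 2 first.
- by apply/measurable_funTS/measurable_EFinP; exact: measurable_powR.
- by move=> t _; rewrite lee_fin powR_ge0.
rewrite -integral_itv_obnd_cbnd; last first.
  by apply/measurable_funTS/measurable_EFinP; exact: measurable_powR.
by rewrite int_powR_tail// -EFinM ltry.
Qed.

Lemma Gamma_posE (x : R) : 0 < x -> (Gamma_pos x)%:E = eGamma x.
Proof.
move=> x0; rewrite /Gamma_pos /Rintegral fineK// ge0_fin_numE; first exact: eGamma_lty.
by apply: integral_ge0 => t _; rewrite lee_fin mulr_ge0 ?powR_ge0 ?expR_ge0.
Qed.

Lemma Gamma_pos_gt0 (x : R) : 0 < x -> 0 < Gamma_pos x.
Proof.
move=> x0; rewrite -lte_fin Gamma_posE// lt_neqAle; apply/andP; split; last first.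
  by apply: integral_ge0 => t _; rewrite lee_fin mulr_ge0 ?powR_ge0 ?expR_ge0.
apply/eqP => G0.
have := (ae_eq_integral_abs leb (measurable_itv `]0%R, +oo[)
  (measurable_eGamma x (A := `]0%R, +oo[%classic))).1.
under eq_integral do rewrite gee0_abs ?lee_fin ?mulr_ge0 ?powR_ge0 ?expR_ge0//.
move=> /(_ (esym G0)) [N [mN N0 sN]].
have : leb `[1%R, 2%R]%classic = 0%E.
  apply: (@subset_measure0 _ _ _ leb _ N) => //.
  move=> t /= t12; apply: sN => /=.
  move: t12; rewrite in_itv/= => /andP[t1 _].
  have t0 : 0 < t by rewrite (lt_le_trans ltr01).
  have tD : t \in `]0, +oo[ by rewrite in_itv/= t0.
  move=> /(_ tD)[] /eqP.
  by rewrite mulf_eq0 (gt_eqF (expR_gt0 _)) orbF gt_eqF// powR_gt0.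
rewrite lebesgue_measure_itv/= lte_fin ltr1n/= -EFinB => -[].
by move=> h; have := @ltr01 R; lra.
Qed.

Lemma Gamma_gt0E (x : R) : 0 < x -> Gamma x = Gamma_pos x.
Proof. by move=> x0; rewrite /Gamma x0 big_ord0 divr1 addr0. Qed.

Lemma int_expR_tail (a : R) : (\int[leb]_(u in `]a, +oo[) (expR (- u))%:E)%E = (expR (- a))%:E.
Proof.
rewrite integral_itv_obnd_cbnd; last first.
  by apply/measurable_funTS/measurable_EFinP; apply: measurableT_comp => //; exact: oppr_measurable.
transitivity ((0 - (- expR (- a)))%:E); last by rewrite sub0r opprK.
apply: (@FTC_y _ (fun u => - expR (- u)) (fun u => expR (- u)) a 0).
- by move=> u _; exact: expR_ge0.
- by move=> u _; apply: is_derive_eq; rewrite /GRing.scale/=; ring.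
- move=> u _; apply: continuous_comp; [exact: continuousN|exact: continuous_expR].
- by rewrite -[X in _ --> X]oppr0; apply: cvgN; exact: cvgr_expR.
Qed.

(** The scaling rule of the Gamma integral; exp(-ct) is written as the tail
integral of exp over u > ct, which moves the scale to the bounds. *)
Lemma eGamma_scale (x c : R) : 0 < x -> 0 < c ->
  (\int[leb]_(t in D) (t `^ (x - 1) * expR (- (c * t)))%:E)%E = (Gamma_pos x / c `^ x)%:E.
Proof.
move=> x0 c0.
have me : measurable_fun setT (fun u : R => expR (- u)).
  by apply: measurableT_comp => //; exact: oppr_measurable.
pose B := (\int[leb]_(u in D) (expR (- u) * (u `^ x / x))%:E)%E.
have main (b : R) : 0 < b -> (\int[leb]_(t in D) (t `^ (x - 1) * expR (- (b * t)))%:E)%E =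
    ((b `^ x)^-1%:E * B)%E.
  move=> b0.
  have mP : measurable [set z : R * R | (0 < z.1 /\ 0 < z.2) /\ b * z.1 < z.2].
    rewrite (_ : [set _ | _] = ([set z : R * R | 0 < z.1] `&` [set z | 0 < z.2]) `&`
       [set z | b * z.1 < z.2])//.
    apply: measurableI; first apply: measurableI.
    - exact: measurable_lt_set.
    - exact: measurable_lt_set.
    - by apply: measurable_lt_set => //; exact: measurable_funM.
  have H := @tonelli_rel R [set z | (0 < z.1 /\ 0 < z.2) /\ b * z.1 < z.2]
    (fun r => r `^ (x - 1)) (fun u => expR (- u)) mP (measurable_powR _) me.
  rewrite /= in H.
  rewrite [LHS](_ : _ = (\int[leb]_(r in D) ((r `^ (x - 1))%:E *
    \int[leb]_(t in [set t | ((0 < r)%R /\ (0 < t)%R) /\ (b * r < t)%R]) (expR (- t))%:E))%E); last first.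
    apply: eq_integral => r; rewrite inE/= in_itv/= andbT => r0.
    rewrite EFinM -int_expR_tail; congr (_ * integral _ _ _)%E.
    apply/seteqP; split => t /=; rewrite in_itv/= andbT; last by case.
    by move=> brt; split => //; split => //; apply: lt_trans brt; rewrite mulr_gt0.
  rewrite H; last first.
    by move=> r t [[t0 r0] tr]; split => //; do ?[exact: powR_ge0|exact: expR_ge0].
  rewrite /B -ge0_integralZl/=; last 4 first.
  - exact: measurable_itv.
  - by apply/measurable_funTS/measurable_EFinP; apply: measurable_funM => //;
      apply: measurable_funM => //; exact: measurable_powR.
  - by move=> t _; rewrite lee_fin mulr_ge0 ?expR_ge0// divr_ge0 ?powR_ge0// ltW.
  - by rewrite lee_fin invr_ge0 powR_ge0.
  apply: eq_integral => t; rewrite inE/= in_itv/= andbT => t0.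
  rewrite (_ : [set r | _] = `]0%R, (t / b)[%classic); last first.
    apply/seteqP; split => r; rewrite /= in_itv/= (ltr_pdivlMr _ _ b0) mulrC.
      by move=> [[-> _] ->].
    by move=> /andP[-> ->].
  rewrite int_powR_head ?divr_gt0// -!EFinM; congr EFin.
  rewrite powRM ?ltW ?invr_gt0// -powR_inv1 ?ltW// -powRrM mulN1r powRN; ring.
rewrite main// muleC EFinM; congr (_ * _)%E.
rewrite Gamma_posE// /eGamma.
have H := main 1 ltr01; rewrite powR1 invr1 mul1e in H; rewrite -H.
by apply: eq_integral => t _; rewrite mul1r.
Qed.

End GammaFacts.

(** * Mellin transforms of regularised exponentials *)

Section KeyConstant.
Context {R : realType}.
Notation leb := (@lebesgue_measure R).
Notation D := (`]0%R, +oo[%classic : set R).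

(** The Taylor remainders of exp(-x), normalised to be nonnegative on x > 0;
each one is the primitive of the previous one vanishing at 0. *)
Fixpoint rho (K : nat) (x : R) : R :=
  if K is K'.+1 then x ^+ K' / K'`!%:R - rho K' x else expR (- x).

Lemma rhoSE K x : rho K.+1 x = x ^+ K / K`!%:R - rho K x.
Proof. by []. Qed.

Lemma expR_rho K x :
  expR (- x) = (-1) ^+ K * rho K x + \sum_(j < K) (- x) ^+ j / j`!%:R.
Proof.
elim: K => [|K IH]; first by rewrite big_ord0 mul1r addr0.
by rewrite big_ord_recr/= IH exprS [(- x) ^+ K]exprNn; ring.
Qed.

Lemma rhoS0 K : rho K.+1 0 = 0.
Proof.
elim: K => [|K IH]; first by rewrite /= oppr0 expR0 expr0 fact0 divr1 subrr.
by rewrite rhoSE IH expr0n/= mul0r subrr.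
Qed.

Lemma is_derive_rho K (x : R) : is_derive x 1 (rho K.+1) (rho K x).
Proof.
elim: K => [|K IH].
  rewrite [X in is_derive _ _ X _](_ : _ = fun x => 1 - expR (- x)); last first.
    by apply/funext => y; rewrite /= expr0 fact0 divr1.
  apply: is_derive_eq; rewrite /GRing.scale/=; ring.
have h0 : is_derive x 1 (fun y : R => y ^+ K.+1) (K.+1%:R * x ^+ K).
  rewrite (_ : (fun y : R => y ^+ K.+1) = (@id R : R -> R) ^+ K.+1); last by rewrite exprfctE.
  by apply: is_derive_eq; rewrite /GRing.scale/= mulr1.
have h : is_derive x 1 (fun y : R => (K.+1`!%:R)^-1 * y ^+ K.+1) (x ^+ K / K`!%:R).
  have h1 : (K.+1%:R : R) != 0 by rewrite pnatr_eq0.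
  have h2 : (K`!%:R : R) != 0 by rewrite pnatr_eq0 -lt0n fact_gt0.
  have h3 := is_deriveM (is_derive_cst ((K.+1`!%:R)^-1 : R) x (1 : R)) h0.
  rewrite (_ : x ^+ K / _ = cst (K.+1)`!%:R^-1 x *: (K.+1%:R * x ^+ K) + x ^+ K.+1 *: 0); last first.
    by rewrite scaler0 addr0 /GRing.scale/= factS natrM invfM mulrACA mulVf// mul1r mulrC.
  exact: h3.
rewrite [X in is_derive _ _ X _](_ : _ = (fun y : R => (K.+1`!%:R)^-1 * y ^+ K.+1) - rho K.+1); last first.
  by apply/funext => y; rewrite rhoSE mulrC.
exact: is_deriveB.
Qed.

Lemma continuous_rho K : continuous (rho K).
Proof.
case: K => [|K] x; last first.
  apply: differentiable_continuous; apply/derivable1_diffP.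
  by have [] := is_derive_rho K x.
by apply: continuous_comp; [exact: continuousN|exact: continuous_expR].
Qed.

Lemma rho_ge0 K t : 0 < t -> 0 <= rho K t.
Proof.
have [] := @mellin_primitives R rho K K%:R rhoS0 is_derive_rho continuous_rho.
- by move=> u _; exact: expR_ge0.
- by rewrite gtrBl.
- by move=> + _; apply.
Qed.

Lemma prim_rho K r : 0 < r -> (\int[leb]_(t in `]0%R, r[) (rho K t)%:E)%E = (rho K.+1 r)%:E.
Proof.
move=> r0.
have mr A : measurable_fun A (fun x => (rho K x)%:E).
  by apply/measurable_funTS/measurable_EFinP; exact: continuous_measurable_fun (@continuous_rho K).
rewrite integral_itv_bndo_bndc// integral_itv_obnd_cbnd//.
have -> := @FTC_itv _ (rho K.+1) (rho K) 0 r (ltW r0)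
  (fun x _ => is_derive_rho K x) (fun x _ => @continuous_rho K x).
by rewrite rhoS0 subr0.
Qed.

Definition rho_const (K : nat) (s : R) : R :=
  \prod_(i < K) (s - i%:R)^-1 * Gamma_pos (K%:R - s).

(** Taking K primitives brings the integral back to that of exp (- t), at the
exponent K - s in ]0, 1[. *)
Lemma int_rho K s lam : (0 < K)%N -> 0 < s -> K%:R - 1 < s -> s < K%:R -> 0 <= lam ->
  (\int[leb]_(t in D) (t `^ (s - 1) * rho K (lam / t))%:E)%E =
  (lam `^ s * rho_const K s)%:E.
Proof.
move=> K0 s0 Ks sK; rewrite le_eqVlt => /predU1P[<-|lam0].
  rewrite powR0 ?mul0r ?gt_eqF//; apply: integral0_eq => t _.
  by rewrite mul0r; case: K K0 {Ks sK} => // K _; rewrite rhoS0 mulr0.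
case: K K0 Ks sK => // K _ Ks sK.
rewrite (@mellin_primitive_inv _ s lam (rho K))//; last 3 first.
- exact: continuous_measurable_fun (@continuous_rho K).
- by move=> t; exact: rho_ge0.
- exact: prim_rho.
have [] := @mellin_primitives R rho K.+1 s rhoS0 is_derive_rho continuous_rho _ Ks.
  by move=> u _; exact: expR_ge0.
move=> _ ->; rewrite EFinM; congr (_ * _)%E; rewrite /rho_const EFinM; congr (_ * _)%E.
by rewrite Gamma_posE// subr_gt0.
Qed.

(** The Cauchy-Saalschuetz formula: off the integers, the continuation of Gamma to
- s is the Mellin transform of a Taylor remainder of the exponential. *)
Lemma GammaN_rho (s : R) : 0 < s -> s \isn't a Num.nat ->
  Gamma (- s) = (-1) ^+ (Num.truncn s).+1 * rho_const (Num.truncn s).+1 s.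
Proof.
move=> s0 sN; rewrite /Gamma oppr_gt0 ltNge (ltW s0)/= opprK /rho_const.
rewrite (addrC (- s)) mulrA [LHS]mulrC; congr (_ * _).
set K := _.+1; rewrite -prodfV (_ : (-1) ^+ K = \prod_(i < K) (-1 : R)); last first.
  by rewrite prodr_const card_ord.
rewrite -big_split/=.
apply: eq_bigr => i _; rewrite mulN1r -invrN; congr (_^-1); ring.
Qed.

(** At the integer exponent l the Mellin integral of rho l diverges at 0; the leading
term x^l / l! cancels in this difference of two dilates, which for l = 0 is the
integrand of Frullani. *)
Definition frul (kap : R) (l : nat) (x : R) : R := rho l x - kap^-1 ^+ l * rho l (kap * x).

Lemma frul_prim kap l (x : R) : kap != 0 -> is_derive x 1 (frul kap l.+1) (frul kap l x).
Proof.
move=> k0; rewrite /frul.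
have h1 := is_derive_rho l x.
have h2 : is_derive (kap * x) 1 (rho l.+1) (rho l (kap * x)) by exact: is_derive_rho.
have h3 : is_derive x 1 (fun y : R => kap * y) kap.
  by apply: is_derive_eq; rewrite /GRing.scale/= mulr1.
have h4 : is_derive x 1 (fun y => rho l.+1 (kap * y)) (kap * rho l (kap * x)).
  by apply: is_derive_eq (is_derive1_comp h2 h3) _; rewrite mulrC.
apply: is_derive_eq; rewrite /GRing.scale/= exprS; field.
by rewrite k0.
Qed.

Lemma continuous_frul kap l : continuous (frul kap l).
Proof.
move=> x; apply: cvgB; first exact: continuous_rho.
apply: cvgM; first exact: cvg_cst.
apply: continuous_comp; last exact: continuous_rho.
by apply: cvgM; [exact: cvg_cst|exact: cvg_id].
Qed.

Lemma frulS0 kap l : frul kap l.+1 0 = 0.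
Proof. by rewrite /frul mulr0 rhoS0 mulr0 subrr. Qed.

Lemma frul0_ge0 kap t : 1 <= kap -> 0 < t -> 0 <= frul kap 0 t.
Proof.
move=> k1 t0; rewrite /frul/= expr0 mul1r subr_ge0 ler_expR lerN2.
by rewrite ler_peMl// ltW.
Qed.

(** The function exp (- r) - exp (- kap r) is the integral of r exp (- u r) over u
from 1 to kap; Tonelli then leaves the integral of 1 / u. *)
Lemma int_frullani kap : 1 <= kap ->
  (\int[leb]_(r in D) (r `^ (- 1) * frul kap 0 r)%:E)%E = (ln kap)%:E.
Proof.
move=> k1; have k0 : 0 < kap by rewrite (lt_le_trans ltr01).
have lnE : (\int[leb]_(u in `[1%R, kap]) (u^-1)%:E)%E = (ln kap)%:E.
  transitivity ((ln kap - ln 1)%:E); last by rewrite ln1 subr0.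
  apply: (@FTC_itv _ (@ln R) (fun u => u^-1) 1 kap) => //.
  - by move=> x /andP[x1 _]; apply: is_derive1_ln; rewrite (lt_le_trans ltr01).
  - move=> x /andP[x1 _]; apply: continuousV => //.
    by rewrite gt_eqF// (lt_le_trans ltr01).
have eE r : 0 < r -> (\int[leb]_(u in `[1%R, kap]) (r * expR (- (u * r)))%:E)%E = (frul kap 0 r)%:E.
  move=> r0; transitivity ((- expR (- (kap * r)) - (- expR (- (1 * r))))%:E); last first.
    by rewrite /frul/= expr0 !mul1r opprK addrC.
  apply: (@FTC_itv _ (fun u => - expR (- (u * r))) (fun u => r * expR (- (u * r))) 1 kap) => //.
  - by move=> x _; apply: is_derive_eq; rewrite /GRing.scale/=; ring.
  - move=> x _; apply: cvgM; first exact: cvg_cst.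
    apply: continuous_comp; last exact: continuous_expR.
    by apply: cvgN; apply: cvgM; [exact: cvg_id|exact: cvg_cst].
have iE u : 0 < u -> (\int[leb]_(r in D) (expR (- (u * r)))%:E)%E = (u^-1)%:E.
  move=> u0; have := eGamma_scale ltr01 u0; rewrite powRr1 ?ltW//.
  rewrite (_ : Gamma_pos 1 = 1) ?div1r.
    move=> <-; apply: eq_integral => r; rewrite inE/= in_itv/= andbT => r0.
    by rewrite subrr powRr0 mul1r.
  have [] : (Gamma_pos (1 : R))%:E = 1%:E; last by [].
  rewrite Gamma_posE// /eGamma.
  transitivity (\int[leb]_(t in D) (expR (- t))%:E)%E.
    apply: eq_integral => r; rewrite inE/= in_itv/= andbT => r0.
    by rewrite subrr powRr0 mul1r.
  by rewrite int_expR_tail oppr0 expR0.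
have me : measurable_fun setT (fun z : R * R => expR (- (z.2 * z.1))).
  apply: measurableT_comp => //; apply: measurable_funN; exact: measurable_funM.
pose f (z : R * R) := (expR (- (z.2 * z.1)) * \1_D z.1 * \1_(`[1%R, kap]%classic : set R) z.2)%:E.
have mf : measurable_fun setT f.
  apply/measurable_EFinP; apply: measurable_funM; first apply: measurable_funM => //.
    by apply: measurableT_comp => //; apply: measurable_indic; exact: measurable_itv.
  by apply: measurableT_comp => //; apply: measurable_indic; exact: measurable_itv.
have f0 z : (0 <= f z)%E.
  by rewrite lee_fin mulr_ge0// mulr_ge0// expR_ge0.
have := @fubini_tonelli _ _ _ _ _ leb leb f mf f0.
have -> : (\int[leb]_x \int[leb]_y f (x, y))%E = (\int[leb]_(r in D) (r `^ (- 1) * frul kap 0 r)%:E)%E.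
  rewrite [RHS]integral_mkcond; apply: eq_integral => r _; rewrite patchE.
  case: ifPn => [|rD]; last first.
    by apply: integral0_eq => y _; rewrite /f/= !indicE (negbTE rD) mulr0 mul0r.
  move=> /[dup] rD; rewrite inE/= in_itv/= andbT => r0.
  rewrite EFinM -eE// -ge0_integralZl//; last 3 first.
  - apply/measurable_funTS/measurable_EFinP/measurable_funM => //.
    by apply: measurableT_comp => //; apply: measurable_funN; exact: measurable_funM.
  - by move=> u _; rewrite lee_fin mulr_ge0 ?expR_ge0// ltW.
  - by rewrite lee_fin powR_ge0.
  rewrite [RHS]integral_mkcond; apply: eq_integral => u _; rewrite patchE /f/=.
  rewrite !indicE rD mulr1; case: ifPn => _; rewrite ?mulr0// mulr1.
  by rewrite -EFinM powR_inv1 ?ltW// mulrA mulVf ?mul1r ?gt_eqF.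
move=> ->; rewrite -lnE [RHS]integral_mkcond; apply: eq_integral => u _; rewrite patchE.
case: ifPn => [|uD]; last first.
  by apply: integral0_eq => y _; rewrite /f/= !indicE (negbTE uD) mulr0.
move=> /[dup] uD; rewrite inE/= in_itv/= => /andP[u1 _].
rewrite -iE ?(lt_le_trans ltr01)// [RHS]integral_mkcond; apply: eq_integral => r _.
rewrite patchE /f/= !indicE uD mulr1.
by case: ifPn => _; rewrite ?mulr0// mulr1.
Qed.

(** The powers of r match so that l primitives bring the integral back to the
logarithmic one, and the factors 1 / (l - i) form 1 / l!. *)
Lemma int_frul l kap lam : (0 < l)%N -> 1 <= kap -> 0 <= lam ->
  (\int[leb]_(t in D) (t `^ (l%:R - 1) * frul kap l (lam / t))%:E)%E =
  (lam ^+ l * (ln kap / l`!%:R))%:E.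
Proof.
move=> l0 k1; have k0 : 0 < kap by rewrite (lt_le_trans ltr01).
rewrite le_eqVlt => /predU1P[<-|lam0].
  rewrite expr0n gtn_eqF//= mul0r; apply: integral0_eq => t _.
  by rewrite mul0r; case: l l0 => // l _; rewrite frulS0 mulr0.
have dfr j (x : R) : is_derive x 1 (frul kap j.+1) (frul kap j x).
  by apply: frul_prim; rewrite gt_eqF.
have ge00 t : 0 < t -> 0 <= frul kap 0 t by exact: frul0_ge0.
case: l l0 => // l _.
have ll : l.+1%:R - 1 < (l.+1%:R : R) by rewrite gtrBl.
have [H1 H2] := @mellin_primitives R (frul kap) l.+1 l.+1%:R (frulS0 kap) dfr (@continuous_frul kap) ge00 ll.
have mfr A : measurable_fun A (fun x => (frul kap l x)%:E).
  by apply/measurable_funTS/measurable_EFinP; exact: continuous_measurable_fun (@continuous_frul kap l).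
rewrite (@mellin_primitive_inv _ l.+1%:R lam (frul kap l))//; last 3 first.
- exact: continuous_measurable_fun (@continuous_frul kap l).
- by move=> t; exact: H1.
- move=> r r0; rewrite integral_itv_bndo_bndc// integral_itv_obnd_cbnd//.
  have -> := @FTC_itv _ (frul kap l.+1) (frul kap l) 0 r (ltW r0)
    (fun x _ => dfr l x) (fun x _ => @continuous_frul kap l x).
  by rewrite frulS0 subr0.
rewrite H2 subrr sub0r int_frullani// -!EFinM powR_mulrn ?ltW//; congr EFin.
congr (_ * _); rewrite mulrC; congr (_ * _).
rewrite prodfV; congr (_^-1).
rewrite -[RHS]/((l.+1)`!%:R) fact_prod natr_prod big_add1/= big_mkord.
rewrite (reindex_inj rev_ord_inj)/=; apply: eq_bigr => i _.
by rewrite natrB ?ltn_ord// subKr.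
Qed.

End KeyConstant.

Lemma measurable_invr {R : realType} : measurable_fun setT (fun t : R => t^-1).
Proof.
rewrite (_ : (fun t => _) = fun t => t * (`|t| `^ (- 1)) ^+ 2); last first.
  apply/funext => t; rewrite powR_inv1// exprVn real_normK ?num_real//.
  have [->|t0] := eqVneq t 0; first by rewrite invr0 mul0r.
  by field.
apply: measurable_funM => //; apply: measurable_funX.
apply: (measurableT_comp (measurable_powR (-1))); exact: normr_measurable.
Qed.

Section KeyFormula.
Context {R : realType}.
Notation leb := (@lebesgue_measure R).
Notation D := (`]0%R, +oo[%classic : set R).

(** The coefficients have no sign, hence the detour through integrability. *)
Lemma integral_lincomb (I : Type) (r : seq I) (c v : I -> R) (F : I -> R -> R) :
  (forall i, measurable_fun setT (F i)) ->
  (forall i t, 0 < t -> 0 <= F i t) ->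
  (forall i, (\int[leb]_(t in D) (F i t)%:E)%E = (v i)%:E) ->
  (\int[leb]_(t in D) (\sum_(i <- r) c i * F i t)%:E)%E = (\sum_(i <- r) c i * v i)%:E.
Proof.
move=> mF F0 vE.
have iF i : leb.-integrable D (fun t => (F i t)%:E).
  apply/integrableP; split; first by apply/measurable_funTS/measurable_EFinP; exact: mF.
  have -> : (\int[leb]_(t in D) `|(F i t)%:E| = (v i)%:E)%E.
    rewrite -vE; apply: eq_integral => t; rewrite inE/= in_itv/= andbT => t0.
    by rewrite /= ger0_norm// F0.
  exact: ltry.
suff [] : leb.-integrable D (fun t => (\sum_(i <- r) c i * F i t)%:E) /\
  (\int[leb]_(t in D) (\sum_(i <- r) c i * F i t)%:E)%E = (\sum_(i <- r) c i * v i)%:E by [].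
elim: r => [|i r [IH1 IH2]].
  under [X in integrable _ _ X]eq_fun do rewrite big_nil.
  under eq_integral do rewrite big_nil.
  by rewrite big_nil integral0; split => //; exact: integrable0.
under [X in integrable _ _ X]eq_fun do rewrite big_cons EFinD EFinM.
under eq_integral do rewrite big_cons EFinD EFinM.
have icF : leb.-integrable D (fun t => ((c i)%:E * (F i t)%:E)%E) by exact: integrableZl.
split; first exact: integrableD.
by rewrite integralD// integralZl// vE IH2 big_cons EFinD EFinM.
Qed.

Variables (n : nat) (s : R).
Hypotheses (s0 : 0 < s) (sn : s < n%:R).

(** The square of the j-th node of [delta] n. *)
Definition kap (j : nat) : R := (j%:Z - n%:Z)%:~R ^+ 2.

Lemma kap_ge0 j : 0 <= kap j. Proof. exact: sqr_ge0. Qed.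

(** Averaging [dsym] n against a Gaussian leaves the multiplier with the waves of
frequency k replaced by exp (- k^2 x). *)
Definition heat (x : R) := \sum_(0 <= j < (2 * n).+1) dcoef n j * expR (- (kap j * x)).

(** The Taylor polynomials contribute moments of order below n, which vanish. *)
Lemma heat_rho K x : (K <= n)%N ->
  heat x = \sum_(0 <= j < (2 * n).+1) ((-1) ^+ K * dcoef n j) * rho K (kap j * x).
Proof.
move=> Kn; rewrite /heat.
under eq_bigr do rewrite (expR_rho K) mulrDr.
rewrite big_split/= [X in _ + X](_ : _ = 0) ?addr0; last first.
  under eq_bigr do rewrite mulr_sumr.
  rewrite exchange_big/= big1// => i _.
  rewrite (eq_bigr (fun j => ((- x) ^+ i / i`!%:R) * (dcoef n j * kap j ^+ i))); last first.
    by move=> j _; rewrite -mulrN exprMn; ring.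
  rewrite -mulr_sumr sum_dcoef_monomial ?mulr0//.
  exact: leq_trans (ltn_ord i) Kn.
by apply: eq_bigr => j _; ring.
Qed.

Definition power_sum : R := \sum_(1 <= k < n.+1) (-1) ^+ k * 'C(2 * n, n - k)%:R * k%:R `^ (2 * s).

Definition log_power_sum : R := \sum_(2 <= k < n.+1)
  (-1) ^ (k%:Z - (Num.truncn s)%:Z + 1) * 'C(2 * n, n - k)%:R * k%:R `^ (2 * s) * ln k%:R.

Definition mellin_const : R := if s \is a Num.nat then 4 * log_power_sum / (Num.truncn s)`!%:R else 2 * Gamma (- s) * power_sum.

Let powR_sqr (k : nat) : ((k%:R : R) ^+ 2) `^ s = k%:R `^ (2 * s).
Proof. by rewrite -powR_mulrn// -powRrM. Qed.

Let trunc_lt : (Num.truncn s < n)%N.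
Proof.
by rewrite -(ltr_nat R) (le_lt_trans _ sn)// truncn_le// ltW.
Qed.

Let mcomp (f : R -> R) (lam : R) : continuous f ->
  measurable_fun setT (fun t : R => t `^ (s - 1) * f (lam / t)).
Proof.
move=> cf; apply: measurable_funM; first exact: measurable_powR.
apply: (measurableT_comp (continuous_measurable_fun cf)).
by apply: measurable_funM => //; exact: measurable_invr.
Qed.

Lemma measurable_heat (lam : R) : measurable_fun setT (fun t : R => t `^ (s - 1) * heat (lam / t)).
Proof.
apply: measurable_funM; first exact: measurable_powR.
apply: measurable_sum => j; apply: measurable_funM => //.
apply: (measurableT_comp (@measurable_expR R)); apply: measurable_funN.
by do 2 apply: measurable_funM => //; exact: measurable_invr.
Qed.

(** Here every term converges separately and contributes Gamma (- s) k^(2s). *)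
Let int_heat_nonint lam : s \isn't a Num.nat -> 0 <= lam ->
  (\int[leb]_(t in D) (t `^ (s - 1) * heat (lam / t))%:E)%E = (lam `^ s * mellin_const)%:E.
Proof.
move=> sN lam0; rewrite /mellin_const (negbTE sN); set K := (Num.truncn s).+1.
have Ks : K%:R - 1 < s.
  rewrite -natr1 addrK lt_neqAle truncn_le (ltW s0) andbT.
  by apply: contra sN => /eqP <-; exact: natr_nat.
have sK : s < K%:R by exact: truncnS_gt.
pose F j t := t `^ (s - 1) * rho K (kap j * lam / t).
transitivity (\int[leb]_(t in D) (\sum_(0 <= j < (2 * n).+1) ((-1) ^+ K * dcoef n j) * F j t)%:E)%E.
  apply: eq_integral => t _; rewrite (heat_rho _ trunc_lt) mulr_sumr; congr EFin.
  by apply: eq_bigr => j _; rewrite /F -(mulrA (kap j)) -/K; ring.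
rewrite (@integral_lincomb _ _ _ (fun j => (kap j * lam) `^ s * rho_const K s)); last 3 first.
- by move=> j; apply: mcomp; exact: continuous_rho.
- move=> j t t0; rewrite mulr_ge0 ?powR_ge0//.
  have := kap_ge0 j; rewrite le_eqVlt => /predU1P[<-|k0].
    by rewrite !mul0r rhoS0.
  move: lam0; rewrite le_eqVlt => /predU1P[<-|lam0]; first by rewrite mulr0 mul0r rhoS0.
  by apply: rho_ge0; rewrite divr_gt0// mulr_gt0.
- by move=> j; apply: int_rho => //; rewrite mulr_ge0 ?kap_ge0.
congr EFin; rewrite (GammaN_rho s0 sN) -/K.
rewrite (eq_bigr (fun j => (lam `^ s * ((-1) ^+ K * rho_const K s)) * (dcoef n j * kap j `^ s))); last first.
  by move=> j _; rewrite powRM ?kap_ge0//; ring.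
rewrite -mulr_sumr (@sum_dcoef_sym _ n (fun x => x `^ s)) ?powR0 ?gt_eqF//.
rewrite (eq_bigr (fun k : nat => (-1) ^+ k * 'C(2 * n, n - k)%:R * k%:R `^ (2 * s))); last first.
  by move=> k _; rewrite powR_sqr.
by rewrite -/power_sum; ring.
Qed.

Let kap_ge1 j : kap j != 0 -> 1 <= kap j.
Proof.
rewrite /kap sqrf_eq0 intr_eq0 => h; rewrite -rmorphXn/= -[1]/(1%:~R) ler_int.
by rewrite -gtz0_ge1 exprn_even_gt0.
Qed.

(** Here the terms diverge one by one. The moment of order s vanishes too, so a common
multiple of it may be subtracted, which turns the terms into [frul] and produces
logarithms. *)
Let int_heat_int lam : s \is a Num.nat -> 0 <= lam ->
  (\int[leb]_(t in D) (t `^ (s - 1) * heat (lam / t))%:E)%E = (lam `^ s * mellin_const)%:E.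
Proof.
move=> sN lam0; rewrite /mellin_const sN; set l := Num.truncn s.
have sl : s = l%:R by rewrite /l truncnK.
have l0 : (0 < l)%N by rewrite -(ltr_nat R) -sl.
have ln' : (l < n)%N by exact: trunc_lt.
have z0 : 0 ^+ l = 0 :> R by rewrite expr0n gtn_eqF.
have r0 : rho l 0 = 0 :> R by case: (l) l0 => // l' _; exact: rhoS0.
have sg : (-1) ^+ l * (-1) ^+ l = 1 :> R by rewrite -expr2 sqrr_sign.
(* The central node would give the dilation 0; its coefficient cc is 0, so any other
   dilation does. *)
pose kap' j := if kap j == 0 then 1 else kap j.
have kap'1 j : 1 <= kap' j by rewrite /kap'; case: ifPn => // /kap_ge1.
pose F j t := t `^ (s - 1) * frul (kap' j) l (lam / t).
pose cc j := - ((-1) ^+ l) * (dcoef n j * kap j ^+ l) : R.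
transitivity (\int[leb]_(t in D) (\sum_(0 <= j < (2 * n).+1) cc j * F j t)%:E)%E.
  apply: eq_integral => t _; rewrite (heat_rho _ (ltnW ln')); congr EFin.
  transitivity (t `^ (s - 1) * (\sum_(0 <= j < (2 * n).+1) (-1) ^+ l * dcoef n j * rho l (kap j * (lam / t)) -
     (-1) ^+ l * rho l (lam / t) * \sum_(0 <= j < (2 * n).+1) dcoef n j * kap j ^+ l)).
    by rewrite sum_dcoef_monomial// mulr0 subr0.
  set cs := (-1) ^+ l * rho l (lam / t).
  have -> : cs * \sum_(0 <= j < (2 * n).+1) dcoef n j * kap j ^+ l =
    \sum_(0 <= j < (2 * n).+1) cs * (dcoef n j * kap j ^+ l) by rewrite mulr_sumr.
  rewrite -sumrB mulr_sumr /cs; apply: eq_bigr => j _.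
  rewrite /cc /F /frul /kap'; case: eqVneq => [->|k0].
    by rewrite mul0r r0 z0; ring.
  rewrite exprVn; have kl0 : kap j ^+ l != 0 by rewrite expf_neq0.
  by field.
rewrite (@integral_lincomb _ _ _ (fun j => lam ^+ l * (ln (kap' j) / l`!%:R))); last 3 first.
- by move=> j; apply: mcomp; exact: continuous_frul.
- move=> j t t0; rewrite mulr_ge0 ?powR_ge0//.
  move: lam0; rewrite le_eqVlt => /predU1P[<-|lam0].
    by rewrite mul0r /frul mulr0 r0 mulr0 subrr.
  have dfr i (x : R) : is_derive x 1 (frul (kap' j) i.+1) (frul (kap' j) i x).
    by apply: frul_prim; rewrite gt_eqF// (lt_le_trans ltr01).
  have ge00 u : 0 < u -> 0 <= frul (kap' j) 0 u by exact: frul0_ge0.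
  have ll : l%:R - 1 < (l%:R : R) by rewrite gtrBl.
  have [H1 _] := @mellin_primitives R (frul (kap' j)) l l%:R (frulS0 _) dfr (@continuous_frul _ (kap' j)) ge00 ll.
  by apply: H1; rewrite divr_gt0.
- by move=> j; rewrite /F sl; exact: int_frul.
congr EFin; rewrite {1}sl powR_mulrn//.
rewrite (eq_bigr (fun j => (lam ^+ l * (- (-1) ^+ l / l`!%:R)) * (dcoef n j * (kap j ^+ l * ln (kap j))))); last first.
  move=> j _; rewrite /cc /kap'; case: eqVneq => [->|_]; last by ring.
  by rewrite z0; ring.
rewrite -mulr_sumr (@sum_dcoef_sym _ n (fun x => x ^+ l * ln x)); last by rewrite expr0n gtn_eqF// mul0r.
have -> : \sum_(1 <= k < n.+1) (-1) ^+ k * 'C(2 * n, n - k)%:R * ((k%:R ^+ 2) ^+ l * ln (k%:R ^+ 2 : R)) =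
   - (-1) ^+ l * (2 * log_power_sum).
  have n0 : (0 < n)%N by exact: leq_ltn_trans ln'.
  rewrite big_ltn// expr1n ln1 !mulr0 add0r mulr_sumr mulr_sumr.
  apply: eq_big_nat => k /andP[k2 _]; have k0 : 0 < (k%:R : R) by rewrite ltr0n (leq_trans _ k2).
  rewrite -/l sl -natrM powR_mulrn ?ltW// exprM expr2 lnM ?posrE//.
  rewrite expfzDr ?oppr_eq0 ?oner_eq0// expfzDr ?oppr_eq0 ?oner_eq0// -exprnP -exprnN expr1z.
  rewrite -exprVn invrN invr1 -signr_odd.
  move: sg; move: ((-1) ^+ l) ((-1) ^+ odd k) (ln _) => e f L sg.
  by rewrite -[LHS]mulr1 -[X in _ * X = _]sg; ring.
have sg2 : (- (-1) ^+ l) * (- (-1) ^+ l) = 1 :> R by rewrite mulrNN -expr2 sqrr_sign.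
rewrite -/l; transitivity (lam ^+ l * (4 * log_power_sum / l`!%:R) * ((- (-1) ^+ l) * (- (-1) ^+ l))); last by rewrite sg2 mulr1.
by ring.
Qed.

Lemma int_heat lam : 0 <= lam ->
  (\int[leb]_(t in D) (t `^ (s - 1) * heat (lam / t))%:E)%E = (lam `^ s * mellin_const)%:E.
Proof.
by move=> l0; case: (boolP (s \is a Num.nat)) => h; [exact: int_heat_int|exact: int_heat_nonint].
Qed.

End KeyFormula.

(** * The normalising constant *)

Section RadialIntegral.
Context {R : realType}.
Notation leb := (@lebesgue_measure R).
Notation D := (`]0%R, +oo[%classic : set R).

Lemma tonelli_halfline d (T : measurableType d) (mu : {sigma_finite_measure set T -> \bar R})
    (f : T * R -> R) : measurable_fun setT f -> (forall x t, 0 < t -> 0 <= f (x, t)) ->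
  (\int[mu]_x \int[leb]_(t in D) (f (x, t))%:E =
   \int[leb]_(t in D) \int[mu]_x (f (x, t))%:E)%E.
Proof.
move=> mf f0; pose g (z : T * R) := (f z * \1_D z.2)%:E.
have mg : measurable_fun setT g.
  apply/measurable_EFinP; apply: measurable_funM => //.
  by apply: measurableT_comp => //; apply: measurable_indic; exact: measurable_itv.
have g0 z : (0 <= g z)%E.
  rewrite lee_fin indicE; have [|_] := boolP (z.2 \in D); last by rewrite mulr0.
  by rewrite inE/= in_itv/= andbT mulr1; case: z => x t /= /f0.
have := @fubini_tonelli _ _ _ _ _ mu leb g mg g0.
have -> : (\int[mu]_x \int[leb]_y g (x, y) = \int[mu]_x \int[leb]_(t in D) (f (x, t))%:E)%E.
  apply: eq_integral => x _; rewrite [RHS]integral_mkcond; apply: eq_integral => t _.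
  by rewrite patchE /g/= indicE; case: ifPn => _; rewrite ?mulr1 ?mulr0.
move=> ->; rewrite [RHS]integral_mkcond; apply: eq_integral => t _; rewrite patchE.
case: ifPn => tD.
  by apply: eq_integral => x _; rewrite /g/= indicE tD mulr1.
by apply: integral0_eq => x _; rewrite /g/= indicE (negbTE tD) mulr0.
Qed.

Lemma sqrt_pi_div_powR (N : nat) (t : R) : 0 < t ->
  Num.sqrt (pi / t) ^+ N = pi `^ (N%:R / 2) * t `^ (- (N%:R / 2)).
Proof.
move=> t0; rewrite -powR_mulrn ?sqrtr_ge0// -powR12_sqrt; last by rewrite divr_ge0 ?pi_ge0 ?ltW.
have -> : t `^ (- (N%:R / 2)) = t^-1 `^ (N%:R / 2).
  by rewrite -(powR_inv1 (ltW t0)) -powRrM mulN1r.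
by rewrite -powRrM (mulrC _ N%:R) powRM ?pi_ge0 ?invr_ge0 ?ltW.
Qed.

Lemma enorm_powR (N : nat) (y : 'rV[R]_N) (p : R) : enorm y `^ (2 * p) = sqn y `^ p.
Proof. by rewrite powRrM powR_mulrn ?enorm_ge0// enorm_sqr. Qed.

Lemma enorm_eq0 (N : nat) (y : 'rV[R]_N) : sqn y = 0 -> y = 0.
Proof.
move/eqP; rewrite psumr_eq0 => [/allP h|i _]; last exact: sqr_ge0.
apply/rowP => i; have := h i; rewrite mem_index_enum => /(_ erefl).
by rewrite sqrf_eq0 mxE => /eqP.
Qed.

Lemma measurable_enormX (N : nat) (p : R) :
  measurable_fun setT (fun y : 'rV[R]_N => enorm y `^ p).
Proof. by apply: (measurableT_comp (measurable_powR _)); exact: measurable_enorm. Qed.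

Lemma measurable_enormX_inv (N : nat) (p : R) :
  measurable_fun setT (fun y : 'rV[R]_N => (enorm y `^ p)^-1).
Proof. by apply: (measurableT_comp (@measurable_invr R)); exact: measurable_enormX. Qed.

Lemma measurable_dsym (n : nat) : measurable_fun setT (@dsym R n).
Proof.
apply: measurable_funX; apply: measurable_funB => //.
apply: measurable_funM => //; exact: (continuous_measurable_fun (@continuous_cos R)).
Qed.

Lemma dsym0 n : (0 < n)%N -> dsym n 0 = 0 :> R.
Proof. by move=> n0; rewrite /dsym cos0 mulr1 subrr expr0n gtn_eqF. Qed.

Lemma dsym_dotrv_Int (N n : nat) (t : R) (xi : 'rV[R]_N) : 0 < t ->
  Int (lebRV R N) (fun y => dsym n (dotrv xi y) * expR (- (t * sqn y))).
Proof.
move=> t0; apply: (le_Int (g := fun y => 4 ^+ n * expR (- (t * sqn y)))).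
- apply: measurable_funM; last exact: measurable_gaussN.
  by apply: measurableT_comp; [exact: measurable_dsym|exact: measurable_dotrv].
- move=> y; rewrite !normrM ler_wpM2r// ger0_norm ?dsym_ge0// ger0_norm ?exprn_ge0//.
  rewrite /dsym lerXn2r ?nnegrE//.
    by have := cos_geN1 (dotrv xi y); lra.
- by apply: IntZ; exact: gaussN_Int.
Qed.

Lemma dsym_gauss (N n : nat) (t : R) (xi : 'rV[R]_N) : 0 < t ->
  (\int[lebRV R N]_y (dsym n (dotrv xi y) * expR (- (t * sqn y)))%:E)%E =
  (Num.sqrt (pi / t) ^+ N * heat n (sqn xi / 4 / t))%:E.
Proof.
move=> t0; rewrite -RintegralE; last exact: dsym_dotrv_Int.
congr EFin; pose z (j : nat) : R := (j%:Z - n%:Z)%:~R.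
have dotZ j y : dotrv (z j *: xi) y = z j * dotrv xi y.
  by rewrite /dotrv mulr_sumr; apply: eq_bigr => i _; rewrite mxE mulrA.
transitivity (\int[lebRV R N]_y (\sum_(0 <= j < (2 * n).+1)
   dcoef n j * (expR (- (t * sqn y)) * cos (dotrv (z j *: xi) y + 0)))).
  apply: eq_Rintegral => y _; rewrite -[dsym n _]mulr1 -{1}(@cos0 R) -sum_dcoef_cos mulr_suml.
  by apply: eq_bigr => j _; rewrite dotZ; ring.
rewrite Rint_sum; last by move=> j; apply: IntZ; exact: gaussN_cos_Int.
rewrite /heat mulr_sumr; apply: eq_bigr => j _.
rewrite RintZ; last exact: gaussN_cos_Int.
rewrite gaussN_cos// cos0 mulr1 mulrCA; congr (_ * (_ * expR (- _))).
have -> : sqn (z j *: xi) = kap n j * sqn xi.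
  by rewrite /sqn mulr_sumr; apply: eq_bigr => i _; rewrite mxE exprMn.
by rewrite invfM; ring.
Qed.

Variables (N n : nat) (s : R).
Hypotheses (s0 : 0 < s) (sn : s < n%:R).

Let x := N%:R / 2 + s.

Let x0 : 0 < x. Proof. by rewrite ltr_wpDl// divr_ge0. Qed.

Let n0 : (0 < n)%N. Proof. by rewrite -(ltr_nat R) (lt_trans s0). Qed.

Definition radial_const : R := pi `^ (N%:R / 2) / Gamma_pos x * mellin_const n s / 4 `^ s.

(** The power of |y| is a superposition of Gaussians exp (- t |y|^2) with density
t^(x - 1) / Gamma (x). The integral over y is then a Gaussian average of waves, and
the one over t, after inversion, the Mellin transform of [heat]. *)
Lemma int_dsym_radial (xi : 'rV[R]_N) :
  (\int[lebRV R N]_y (dsym n (dotrv xi y) / enorm y `^ (N%:R + 2 * s))%:E)%E =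
  (radial_const * enorm xi `^ (2 * s))%:E.
Proof.
have G0 := Gamma_pos_gt0 x0.
pose f (z : 'rV[R]_N * R) := (Gamma_pos x)^-1 * (z.2 `^ (x - 1) * (dsym n (dotrv xi z.1) * expR (- (z.2 * sqn z.1)))).
have mf : measurable_fun setT f.
  apply: measurable_funM => //; apply: measurable_funM.
    by apply: (measurableT_comp (measurable_powR (x - 1))); exact: measurable_snd.
  apply: measurable_funM.
    apply: (measurableT_comp (measurable_dsym n)).
    by apply: (measurableT_comp (measurable_dotrv xi)); exact: measurable_fst.
  apply: (measurableT_comp (@measurable_expR R)); apply: measurable_funN.
  apply: measurable_funM; first exact: measurable_snd.
  by apply: (measurableT_comp (@measurable_sqn R N)); exact: measurable_fst.
have f0 y t : 0 < t -> 0 <= f (y, t).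
  by move=> t0; rewrite /f !mulr_ge0 ?dsym_ge0 ?expR_ge0 ?powR_ge0 ?invr_ge0 ?ltW.
transitivity (\int[lebRV R N]_y \int[leb]_(t in D) (f (y, t))%:E)%E.
  apply: eq_integral => y _; have [yz|yz] := eqVneq (sqn y) 0.
    rewrite (enorm_eq0 yz); have -> : dotrv xi 0 = 0.
      by rewrite /dotrv big1// => i _; rewrite mxE mulr0.
    rewrite dsym0// mul0r; apply/esym/integral0_eq => t _; rewrite /f/=.
    have -> : dotrv xi 0 = 0 by rewrite /dotrv big1// => i _; rewrite mxE mulr0.
    by rewrite dsym0// mul0r !mulr0.
  have y0 : 0 < sqn y by rewrite lt_neqAle eq_sym yz sqn_ge0.
  transitivity ((dsym n (dotrv xi y) / Gamma_pos x)%:E *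
    \int[leb]_(t in D) (t `^ (x - 1) * expR (- (sqn y * t)))%:E)%E.
    rewrite eGamma_scale// -EFinM; congr EFin.
    rewrite (_ : N%:R + 2 * s = 2 * x); last by rewrite /x; field.
    by rewrite enorm_powR mulrA divfK// gt_eqF.
  rewrite -ge0_integralZl//; last 3 first.
  - apply/measurable_funTS/measurable_EFinP/measurable_funM; first exact: measurable_powR.
    by apply: measurableT_comp => //; apply: measurable_funN; exact: measurable_funM.
  - by move=> t _; rewrite lee_fin mulr_ge0 ?powR_ge0 ?expR_ge0.
  - by rewrite lee_fin divr_ge0 ?dsym_ge0 ?ltW.
  by apply: eq_integral => t _; rewrite -EFinM /f/= (mulrC t); congr EFin; ring.
rewrite tonelli_halfline//.
have cE : 0 <= pi `^ (N%:R / 2) / Gamma_pos x :> R.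
  by rewrite divr_ge0 ?powR_ge0 ?ltW.
have lam0 : 0 <= sqn xi / 4 by rewrite divr_ge0 ?sqn_ge0.
have hE t : 0 < t -> (\int[lebRV R N]_y (f (y, t))%:E)%E =
   ((pi `^ (N%:R / 2) / Gamma_pos x) * (t `^ (s - 1) * heat n (sqn xi / 4 / t)))%:E.
  move=> t0.
  transitivity (((Gamma_pos x)^-1 * t `^ (x - 1))%:E *
     \int[lebRV R N]_y (dsym n (dotrv xi y) * expR (- (t * sqn y)))%:E)%E.
    rewrite -ge0_integralZl//; last 3 first.
    - apply/measurable_EFinP; exact: Int_measurable (dsym_dotrv_Int _ _ t0).
    - by move=> y _; rewrite lee_fin mulr_ge0 ?dsym_ge0 ?expR_ge0.
    - by rewrite lee_fin mulr_ge0 ?powR_ge0 ?invr_ge0 ?ltW.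
    by apply: eq_integral => y _; rewrite -EFinM -mulrA.
  rewrite dsym_gauss// -EFinM; congr EFin.
  rewrite (sqrt_pi_div_powR N t0).
  rewrite (_ : s - 1 = (x - 1) - N%:R / 2); last by rewrite /x; ring.
  rewrite [in RHS]powRD; first by ring.
  by rewrite (gt_eqF t0) implybT.
transitivity (\int[leb]_(t in D) ((pi `^ (N%:R / 2) / Gamma_pos x)%:E * (t `^ (s - 1) * heat n (sqn xi / 4 / t))%:E))%E.
  apply: eq_integral => t; rewrite inE/= in_itv/= andbT => t0.
  by rewrite hE// EFinM.
have c0 : 0 < pi `^ (N%:R / 2) / Gamma_pos x by rewrite divr_gt0// powR_gt0// pi_gt0.
rewrite ge0_integralZl//; last 2 first.
- by apply/measurable_funTS/measurable_EFinP; exact: measurable_heat.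
- move=> t; rewrite /= in_itv/= andbT => t0; rewrite lee_fin -(pmulr_rge0 _ c0) -lee_fin -hE//.
  by apply: integral_ge0 => y _; rewrite lee_fin f0.
rewrite int_heat// -EFinM; congr EFin.
rewrite enorm_powR powRM ?sqn_ge0 ?invr_ge0// -(@powR_inv1 _ 4)// -powRrM mulN1r powRN.
by rewrite /radial_const; ring.
Qed.

(** The integrand is positive on the unit cube, so the constant cannot vanish. *)
Lemma radial_const_neq0 : (0 < N)%N -> radial_const != 0.
Proof.
move=> N0; apply/eqP => c0; pose xi : 'rV[R]_N := delta_mx 0 (Ordinal N0).
pose f (y : 'rV[R]_N) := (dsym n (dotrv xi y) / enorm y `^ (N%:R + 2 * s))%:E.
have := int_dsym_radial xi; rewrite c0 mul0r -/f => f0.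
have mf : measurable_fun setT f.
  apply/measurable_EFinP; apply: measurable_funM.
    by apply: (measurableT_comp (measurable_dsym n)); exact: measurable_dotrv.
  exact: measurable_enormX_inv.
have : (\int[lebRV R N]_y `|f y| = 0)%E.
  rewrite -[RHS]f0; apply: eq_integral => y _; rewrite gee0_abs//.
  by rewrite lee_fin divr_ge0 ?dsym_ge0 ?powR_ge0.
move/(ae_eq_integral_abs _ measurableT mf) => -[A [mA A0 subA]].
pose B := box (0 : 'rV[R]_N) (const_mx 1).
suff BA : B `<=` A.
  have : (lebesgue_rV R N B <= 0)%E.
    rewrite -A0; apply: (@le_measure _ _ _ (lebesgue_rV R N)); rewrite ?inE//.
    exact: measurable_box.
  rewrite box_measure lee_fin; apply/negP; rewrite -ltNge.
  by apply: prodr_gt0 => i _; rewrite !mxE subr0 lt_max ltr01 orbT.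
move=> y By; apply: subA => /= /(_ I); rewrite /f => /eqP.
have dE : dotrv xi y = y 0 (Ordinal N0).
  rewrite /dotrv (bigD1 (Ordinal N0))//= big1 ?addr0 ?mxE ?eqxx ?mul1r//.
  by move=> i ii; rewrite mxE eqxx/= (negbTE ii) mul0r.
have yB : 0 < y 0 (Ordinal N0) < 1.
  by have := By (Ordinal N0); rewrite !mxE => -[-> ->].
rewrite eqe mulf_eq0 invr_eq0 powR_eq0 => /orP[|/andP[]].
- rewrite expf_eq0 => /andP[_]; rewrite subr_eq0 dE.
  move/eqP => c1; have c2 : cos (y 0 (Ordinal N0)) = cos 0 by rewrite cos0; lra.
  have pi2 := pi_ge2 R; move/andP: yB => [y0 y1].
  have : y 0 (Ordinal N0) = 0.
    by apply: cos_inj c2; rewrite in_itv/= ?lexx ?pi_ge0// ltW//=; lra.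
  by move=> yz; move: y0; rewrite yz ltxx.
- rewrite -sqrf_eq0 enorm_sqr => /eqP/enorm_eq0 y0.
  by move: yB; rewrite y0 mxE ltxx.
Qed.

(** The two constants are built from the same factors. None of these vanishes, since
their product [radial_const] does not. *)
Lemma cNms_radial_const : (0 < N)%N -> cNms N n s / 2 * radial_const = 1.
Proof.
move=> N0; have := radial_const_neq0 N0.
have G0 := Gamma_pos_gt0 x0.
have p0 : 0 < pi `^ (N%:R / 2) :> R by rewrite powR_gt0// pi_gt0.
have f0 : 0 < 4 `^ s :> R by rewrite powR_gt0.
rewrite /radial_const /cNms /mellin_const -/x (Gamma_gt0E x0).
rewrite -/(power_sum n s) -/(log_power_sum n s).
case: ifPn => sN cn.
- have h : log_power_sum n s != 0.
    by apply: contraNneq cn => ->; rewrite mulr0 mul0r mulr0 mul0r.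
  have l0 : (Num.truncn s)`!%:R != 0 :> R by rewrite pnatr_eq0 -lt0n fact_gt0.
  by field; rewrite (gt_eqF G0) (gt_eqF p0) (gt_eqF f0) h l0.
- have h : power_sum n s != 0 by apply: contraNneq cn => ->; rewrite !mulr0 mul0r.
  have l0 : Gamma (- s) != 0 by apply: contraNneq cn => ->; rewrite mulr0 mul0r mulr0 mul0r.
  by field; rewrite (gt_eqF G0) (gt_eqF p0) (gt_eqF f0) h l0.
Qed.

End RadialIntegral.

(** * Fubini for real-valued integrals *)

Section Fubini.
Context {d1 d2} {T1 : measurableType d1} {T2 : measurableType d2} {R : realType}.
Variable m1 : {sigma_finite_measure set T1 -> \bar R}.
Variable m2 : {sigma_finite_measure set T2 -> \bar R}.
Variable f : T1 * T2 -> R.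
Hypothesis mf : measurable_fun setT f.

Lemma measurable_integral_param : measurable_fun setT (fun x => \int[m2]_y (f (x, y))%:E)%E.
Proof.
have mEf : measurable_fun setT (EFin \o f) by exact/measurable_EFinP.
have -> : (fun x => \int[m2]_y (f (x, y))%:E)%E =
    (fubini_F m2 (EFin \o f)^\+ \- fubini_F m2 (EFin \o f)^\-)%E.
  apply/funext => x; rewrite [LHS]integralE /=.
  by congr (_ - _)%E; apply: eq_integral => y _; rewrite ?funeposE ?funenegE.
apply: emeasurable_funB; apply: measurable_fun_fubini_tonelli_F => //.
- exact: measurable_funepos.
- exact: measurable_funeneg.
Qed.

Lemma measurable_Rint_param : measurable_fun setT (fun x => \int[m2]_y f (x, y)).
Proof. exact: measurableT_comp measurable_integral_param. Qed.

Lemma Rfubini_half : (\int[m1]_x \int[m2]_y `|f (x, y)|%:E < +oo)%E ->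
  [/\ Int m1 (fun x => \int[m2]_y f (x, y)),
      {ae m1, forall x, Int m2 (fun y => f (x, y))} &
      (\int[m1]_x \int[m2]_y f (x, y))%:E = (\int[m1 \x m2]_z (f z)%:E)%E].
Proof.
move=> fi; have mEf : measurable_fun setT (EFin \o f) by exact/measurable_EFinP.
have ff : (m1 \x m2)%E.-integrable setT (EFin \o f).
  apply: (@integrable12ltyP _ _ _ _ _ m1 m2 _ mEf).2.
  by under eq_integral do under eq_integral do rewrite abse_EFin.
have iF := integrable_fubini_F ff.
have ae1 : {ae m1, forall x, (\int[m2]_y f (x, y))%:E = (\int[m2]_y (f (x, y))%:E)%E}.
  have := integrable_ae measurableT iF; apply: filterS => x /= /(_ I) h.
  by rewrite /Rintegral fineK.
have mR : measurable_fun setT (fun x => (\int[m2]_y f (x, y))%:E).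
  by apply/measurable_EFinP; exact: measurable_Rint_param.
have I1 : Int m1 (fun x => \int[m2]_y f (x, y)).
  apply: (le_integrable measurableT mR _ iF) => x _.
  rewrite /Rintegral -/(fubini_F m2 (EFin \o f) x).
  by case: (fubini_F _ _ _) => [r||]//=; rewrite normr0 leey.
split => //; first exact: ae_integrable1 ff.
rewrite RintegralE// -(integral12_prod_meas1 ff); apply: ae_eq_integral => //.
- exact: measurable_integral_param.
- by apply: filterS ae1 => x -> _.
Qed.

End Fubini.

Section FubiniSwap.
Context {d1 d2} {T1 : measurableType d1} {T2 : measurableType d2} {R : realType}.
Variable m1 : {sigma_finite_measure set T1 -> \bar R}.
Variable m2 : {sigma_finite_measure set T2 -> \bar R}.

Lemma measurable_swap_pair (f : T1 * T2 -> R) : measurable_fun setT f ->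
  measurable_fun setT (fun z : T2 * T1 => f (z.2, z.1)).
Proof.
move=> mf; apply: (measurableT_comp mf).
by apply/measurable_fun_pairP; split; [exact: measurable_snd|exact: measurable_fst].
Qed.

Lemma tonelli_abs (f : T1 * T2 -> R) : measurable_fun setT f ->
  (\int[m1]_x \int[m2]_y `|f (x, y)|%:E = \int[m2]_y \int[m1]_x `|f (x, y)|%:E)%E.
Proof.
move=> mf; apply: (@fubini_tonelli _ _ _ _ _ m1 m2 (fun z => `|f z|%:E)) => //.
  by apply/measurable_EFinP; exact: measurableT_comp.
Qed.

Lemma Rfubini (f : T1 * T2 -> R) : measurable_fun setT f ->
  (\int[m1]_x \int[m2]_y `|f (x, y)|%:E < +oo)%E ->
  [/\ Int m1 (fun x => \int[m2]_y f (x, y)),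
      Int m2 (fun y => \int[m1]_x f (x, y)) &
      \int[m1]_x \int[m2]_y f (x, y) = \int[m2]_y \int[m1]_x f (x, y)].
Proof.
move=> mf fi; have [I1 _ E1] := Rfubini_half mf fi.
have mf' := measurable_swap_pair mf.
have fi' : (\int[m2]_y \int[m1]_x `|f (x, y)|%:E < +oo)%E by rewrite -tonelli_abs.
have [I2 _ E2] := @Rfubini_half _ _ _ _ _ m2 m1 _ mf' fi'.
split => //; apply: EFin_inj; rewrite E1 RintegralE//.
have mEf : measurable_fun setT (EFin \o f) by exact/measurable_EFinP.
have ff : (m1 \x m2)%E.-integrable setT (EFin \o f).
  apply: (@integrable12ltyP _ _ _ _ _ m1 m2 _ mEf).2.
  by under eq_integral do under eq_integral do rewrite abse_EFin.
rewrite -(integral21_prod_meas1 ff); apply: ae_eq_integral => //.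
- exact: measurable_fubini_G ff.
- by apply/measurable_EFinP; exact: Int_measurable I2.
- apply: filterS (ae_integrable2 ff) => y /= h _.
  by rewrite /Rintegral fineK//; exact: integrable_fin_num.
Qed.

End FubiniSwap.

Section PairMeasurability.
Context {d1 d2 d3} {T1 : measurableType d1} {T2 : measurableType d2} {T3 : measurableType d3}.

Lemma measurable_comp_fst (f : T1 -> T3) : measurable_fun setT f ->
  measurable_fun setT (fun z : T1 * T2 => f z.1).
Proof. by move=> mf; apply: (measurableT_comp mf); exact: measurable_fst. Qed.

Lemma measurable_comp_snd (f : T2 -> T3) : measurable_fun setT f ->
  measurable_fun setT (fun z : T1 * T2 => f z.2).
Proof. by move=> mf; apply: (measurableT_comp mf); exact: measurable_snd. Qed.

End PairMeasurability.

Section FubiniDomination.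
Context {d1 d2} {T1 : measurableType d1} {T2 : measurableType d2} {R : realType}.
Variable m1 : {sigma_finite_measure set T1 -> \bar R}.
Variable m2 : {sigma_finite_measure set T2 -> \bar R}.

Lemma fubini_dom (F : T1 * T2 -> R) (g : T1 -> R) : measurable_fun setT F ->
  (forall x, \int[m2]_y `|F (x, y)|%:E <= (g x)%:E)%E -> Int m1 g ->
  (\int[m1]_x \int[m2]_y `|F (x, y)|%:E < +oo)%E.
Proof.
move=> mF Fg Ig; have mg := Int_measurable Ig.
have g0 x : 0 <= g x.
  by rewrite -lee_fin; apply: le_trans (Fg x); apply: integral_ge0 => y _; rewrite lee_fin.
apply: (@le_lt_trans _ _ (\int[m1]_x (g x)%:E)%E); last exact: ((ge0_IntP _ g0).1 Ig).2.
apply: ge0_le_integral.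
- exact: measurableT.
- by move=> x _; apply: integral_ge0 => y _; rewrite lee_fin.
- have mF' : measurable_fun setT (fun z => `|F z|) by exact: measurableT_comp.
  exact: (measurable_integral_param m2 mF').
- exact/measurable_EFinP.
- by move=> x _; exact: Fg.
Qed.

Lemma fubini_prod_dom (F : T1 * T2 -> R) (a : T1 -> R) (b : T2 -> R) :
  measurable_fun setT F -> (forall x y, `|F (x, y)| <= `|a x| * `|b y|) ->
  Int m1 a -> Int m2 b -> (\int[m1]_x \int[m2]_y `|F (x, y)|%:E < +oo)%E.
Proof.
move=> mF Fab Ia Ib; have Ia' := Int_abs Ia; have Ib' := Int_abs Ib.
apply: (fubini_dom (g := fun x => (\int[m2]_y `|b y|) * `|a x|)) => //; last exact: IntZ.
move=> x; rewrite mulrC EFinM RintegralE// -ge0_integralZl//; last first.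
  exact: measurable_int Ib'.
apply: ge0_le_integral.
- exact: measurableT.
- by move=> y _; rewrite lee_fin.
- apply/measurable_EFinP; apply: measurableT_comp => //.
  exact: (measurableT_comp mF (pair1_measurable x)).
- by apply: emeasurable_funM; [exact: measurable_cst|exact: measurable_int Ib'].
- by move=> y _; rewrite -EFinM lee_fin.
Qed.

End FubiniDomination.

(** * Density of smooth bumps *)

Section Density.
Import HBNNSimple.
Context {R : realType} {N : nat}.
Notation mu := (lebRV R N).

Lemma dynkin_boxes (P : set (set 'rV[R]_N)) :
  P setT -> (forall c d, P (box c d)) ->
  (forall A, measurable A -> P A -> P (~` A)) ->
  (forall F : (set 'rV[R]_N)^nat, (forall k, measurable (F k)) ->
     trivIset setT F -> (forall k, P (F k)) -> P (\bigcup_k F k)) ->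
  forall A, measurable A -> P A.
Proof.
move=> PT Pbox PC PU A; rewrite measurable_boxes.
apply: (dynkin_induction measurable_boxes boxes_setI_closed PT) => //.
by move=> _ [c [d ->]].
Qed.

Lemma cube_lty (M : R) : (mu (cube M) < +oo)%E.
Proof. exact: box_measure_lty. Qed.

Lemma measurable_cube (M : R) : measurable (cube M : set 'rV[R]_N).
Proof. exact: measurable_box. Qed.

Lemma L2_indic (A : set 'rV[R]_N) : measurable A -> (mu A < +oo)%E -> L2 mu (\1_A).
Proof.
move=> mA Aoo; split; first exact: measurable_indic.
rewrite (eq_integral (fun x => (\1_A x)%:E)); last first.
  by move=> x _; rewrite indicE; case: (x \in A); rewrite ?expr1n ?expr0n.
by rewrite integral_indic// setIT.
Qed.

Lemma L2_indicI (A : set 'rV[R]_N) M : measurable A -> L2 mu (\1_(A `&` cube M)).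
Proof.
move=> mA; have mAC : measurable (A `&` cube M) by exact: measurableI (measurable_cube M).
apply: L2_indic => //; apply: le_lt_trans (cube_lty M).
by apply: le_measure; rewrite ?inE//; exact: measurable_cube.
Qed.

Lemma indic_bigsetU_recr (F : (set 'rV[R]_N)^nat) B k x : trivIset setT F ->
  \1_((\big[setU/set0]_(i < k.+1) F i) `&` B) x =
  \1_((\big[setU/set0]_(i < k) F i) `&` B) x + \1_(F k `&` B) x :> R.
Proof.
move=> tF; rewrite big_ord_recr/= !indicE !in_setI in_setU.
have [xk|] := boolP (x \in F k); last by rewrite orbF addr0.
rewrite orbT; suff -> : (x \in \big[setU/set0]_(i < k) F i) = false by rewrite add0r.
apply/negbTE/negP; rewrite inE -bigcup_mkord => -[i /= ik xi].
have := tF i k I I; rewrite inE in xk => /(_ (ex_intro _ x (conj xi xk))) e.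
by rewrite e ltnn in ik.
Qed.

Lemma indic_bigcup_cvg (F : (set 'rV[R]_N)^nat) B x :
  \1_((\big[setU/set0]_(i < k) F i) `&` B) x @[k --> \oo] --> (\1_(\bigcup_k F k `&` B) x : R).
Proof.
apply: cvg_near_cst; have [|xF] := pselect ((\bigcup_k F k) x).
  move=> [i _ xi]; exists i.+1 => // k /= ik; rewrite !indicE !in_setI.
  congr ((_ && _)%:R); apply/idP/idP; rewrite !inE.
    by move=> _; exists i.
  by move=> _; rewrite -bigcup_mkord; exists i.
apply: nearW => k; rewrite !indicE !in_setI; congr ((_ && _)%:R).
apply/idP/idP; rewrite !inE//; rewrite -bigcup_mkord => -[i _ xi].
by exfalso; apply: xF; exists i.
Qed.

Variable V : set ('rV[R]_N -> R).
Hypothesis VD : forall f g k, L2 mu f -> L2 mu g -> V f -> V g -> V (fun x => f x + k * g x).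
Hypothesis Vlim : forall F f, (forall k : nat, L2 mu (F k)) -> L2 mu f ->
  (forall k, V (F k)) -> L2cvg mu F f -> V f.
Hypothesis Vbox : forall c d, V (\1_(box c d)).

Let V0 : V (fun=> 0).
Proof.
pose b : 'rV[R]_N -> R := \1_(box 0 0).
have b2 : L2 mu b by apply: L2_indic; [exact: measurable_box|exact: box_measure_lty].
have := VD (-1) b2 b2 (Vbox 0 0) (Vbox 0 0).
by congr V; apply/funext => x; rewrite mulN1r subrr.
Qed.

Let Vsum (I : Type) (r : seq I) (c : I -> R) (F : I -> 'rV[R]_N -> R) :
  (forall i, L2 mu (F i)) -> (forall i, V (F i)) -> V (fun x => \sum_(i <- r) c i * F i x).
Proof.
move=> F2 VF; elim: r => [|i r IH].
  by under eq_fun do rewrite big_nil.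
under eq_fun do rewrite big_cons addrC; apply: VD => //.
by apply: L2_sum => j; exact: L2Z.
Qed.

Let Vindic (A : set 'rV[R]_N) M : measurable A -> V (\1_(A `&` cube M)).
Proof.
move: A; apply: dynkin_boxes => [|c d|A mA VA|F mF tF VF].
- by rewrite setTI; exact: Vbox.
- by rewrite /cube boxI; exact: Vbox.
- have := VD (-1) (L2_indic (measurable_cube M) (cube_lty M)) (L2_indicI M mA) (Vbox _ _) VA.
  congr V; apply/funext => x; rewrite !indicE !in_setI in_setC.
  by case: (x \in A); case: (x \in cube M); rewrite /=; ring.
- pose G k := \1_((\big[setU/set0]_(i < k) F i) `&` cube M) : 'rV[R]_N -> R.
  have mU k : measurable (\big[setU/set0]_(i < k) F i) by exact: bigsetU_measurable.
  have mC : measurable (\bigcup_k F k) by exact: bigcupT_measurable.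
  have VG k : V (G k).
    elim: k => [|k IH].
      by rewrite /G big_ord0 set0I indic0.
    have := VD 1 (L2_indicI M (mU k)) (L2_indicI M (mF k)) IH (VF k).
    by congr V; apply/funext => x; rewrite /G mul1r indic_bigsetU_recr.
  have [||||G2 _ Gc] := @L2_dominated _ _ _ mu G (\1_(\bigcup_k F k `&` cube M)) (\1_(cube M)).
  - by move=> k; apply: measurable_indic; apply: measurableI => //; exact: measurable_cube.
  - by apply: L2_indic; [exact: measurable_cube|exact: cube_lty].
  - by move=> x; exact: indic_bigcup_cvg.
  - move=> k x; rewrite /G !indicE in_setI ger0_norm//.
    by rewrite ler_nat; case: (x \in cube M); rewrite ?andbF// andbT leq_b1.
  by apply: Vlim VG Gc => //; exact: L2_indicI.
Qed.

Let Vpos f : (forall x, 0 <= f x) -> L2 mu f -> V f.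
Proof.
move=> f0 f2; have mf : measurable_fun setT (EFin \o f).
  by apply/measurable_EFinP; exact: L2_measurable f2.
have Ef0 x : setT x -> (0 <= (EFin \o f) x)%E by move=> _; rewrite lee_fin.
pose g := nnsfun_approx measurableT mf.
pose F k x := g k x * \1_(cube k%:R) x.
have gf k x : g k x <= f x by rewrite -lee_fin nnsfun_approxE; exact: le_approx.
have mcube k : measurable_fun setT (\1_(cube k%:R) : 'rV[R]_N -> R).
  by apply: measurable_indic; exact: measurable_cube.
have [||||F2 _ Fc] := @L2_dominated _ _ _ mu F f f.
- by move=> k; apply: measurable_funM.
- exact: f2.
- move=> x; have gx := @cvg_nnsfun_approx _ _ _ _ measurableT _ mf Ef0 x I.
  rewrite -[X in _ --> X]mulr1; apply: cvgM.
    by move/fine_cvg: gx.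
  apply: cvg_near_cst; have [k kx] := coord_bounded x.
  exists k => // j /= kj; rewrite indicE mem_set//.
  by apply: subset_cube kx; rewrite ler_nat.
- move=> k x; rewrite /F ger0_norm ?mulr_ge0//.
  apply: le_trans (gf k x); rewrite ler_piMr// indicE lern1; exact: leq_b1.
apply: Vlim F2 f2 _ Fc => k.
pose r : seq R := finmap.enum_fset (fset_set (range (g k))).
have -> : F k = (fun x => \sum_(y <- r) y * \1_((g k @^-1` [set y]) `&` cube k%:R) x).
  apply/funext => x; rewrite /F fimfunE fsbig_finite//= mulr_suml.
  apply: eq_bigr => y _; rewrite -mulrA; congr (_ * _).
  by rewrite !indicE in_setI -natrM mulnb.
have mgy y : measurable (g k @^-1` [set y]) by [].
apply: (@Vsum _ _ id (fun y => \1_((g k @^-1` [set y]) `&` cube k%:R))) => y.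
  exact: L2_indicI.
exact: Vindic.
Qed.

(** A closed subspace containing the indicators of boxes contains those of bounded
measurable sets by the pi-lambda theorem, hence the nonnegative functions as limits
of simple ones. *)
Lemma L2_box_induction f : L2 mu f -> V f.
Proof.
move=> f2; pose p x := Num.max (f x) 0; pose q x := Num.max (- f x) 0.
have mf := L2_measurable f2.
have p2 : L2 mu p.
  apply: (le_L2 _ _ f2); first exact: measurable_maxr.
  by move=> x; rewrite /p; case: (lerP (f x) 0) => _; rewrite ?normr0.
have q2 : L2 mu q.
  apply: (le_L2 _ _ f2); first by apply: measurable_maxr => //; exact: measurable_funN.
  by move=> x; rewrite /q; case: (lerP (- f x) 0) => _; rewrite ?normr0// normrN.
have Vp : V p by apply: Vpos => // x; rewrite le_max lexx orbT.
have Vq : V q by apply: Vpos => // x; rewrite le_max lexx orbT.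
have := VD (-1) p2 q2 Vp Vq; congr V; apply/funext => x; rewrite /p /q.
by case: (lerP (f x) 0); case: (lerP (- f x) 0) => ? ?; lra.
Qed.

End Density.

Section FlatFunctions.
Context {R : realType}.

Lemma is_derive_cvg (V : normedModType R) (f : V -> R) (x v : V) (df : R) :
  (fun h => h^-1 *: (f (h *: v + x) - f x)) @ 0^' --> df -> is_derive x v f df.
Proof. by move=> H; apply: DeriveDef; [exact: cvgP H|exact: cvg_lim H]. Qed.

Lemma is_derive_line (V : normedModType R) (f : V -> R) (x v : V) (df : R) :
  is_derive (0 : R) 1 (fun t => f (t *: v + x)) df -> is_derive x v f df.
Proof.
move=> [d1 d2]; apply: is_derive_cvg; rewrite -d2.
move: d1; rewrite /derivable /derive.
rewrite (_ : (fun h : R => h^-1 *: (((fun t : R => f (t *: v + x)) \o shift 0) (h *: 1) - f (0 *: v + x)))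
  = (fun h => h^-1 *: (f (h *: v + x) - f x))); first by move=> /cvg_ex[l Hl]; rewrite (cvg_lim _ Hl).
by apply/funext => h /=; rewrite addr0 scale0r add0r /GRing.scale/= mulr1.
Qed.

(** The functions x^-k exp(-1/x) on x > 0, extended by zero: their derivatives
are again combinations of such functions. *)
Definition flat (k : nat) (x : R) : R := if 0 < x then x^-1 ^+ k * expR (- x^-1) else 0.

Lemma flat_ge0 k x : 0 <= flat k x.
Proof.
by rewrite /flat; case: ltP => // x0; rewrite mulr_ge0 ?expR_ge0// exprn_ge0// invr_ge0 ltW.
Qed.

(** The bound that gives differentiability at 0, with derivative 0. *)
Lemma flat_le_sqr k x : flat k x <= (k.+2)`!%:R * x ^+ 2.
Proof.
rewrite /flat; case: ltP => [x0|_]; last by rewrite mulr_ge0 ?sqr_ge0.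
have y0 : 0 < x^-1 by rewrite invr_gt0.
have := expR_ge1Dxn k.+1 (ltW y0).
have f0 : 0 < (k.+2)`!%:R :> R by rewrite ltr0n fact_gt0.
rewrite -lerBrDl ler_pdivrMr// => h.
have -> : x ^+ 2 = (x^-1 ^+ 2)^-1 by rewrite exprVn invrK.
rewrite expRN ler_pdivlMr ?exprn_gt0// mulrAC -exprD addn2 ler_pdivrMr ?expR_gt0//.
apply: le_trans h _; rewrite mulrC ler_pM2l//; lra.
Qed.

Lemma is_derive_flat k (x : R) : is_derive x 1 (flat k) (flat k.+2 x - k%:R * flat k.+1 x).
Proof.
have [x0|x0|<-] := ltgtP 0 x.
- pose V (y : R) := y^-1; pose E (y : R) := expR (- y^-1).
  have dV : is_derive x 1 V (- x ^- 2).
    have h : (@id R) x != 0 by rewrite /= gt_eqF.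
    by apply: is_derive_eq (is_deriveV h (is_derive_id x 1)) _; rewrite /GRing.scale/= mulr1.
  have dE : is_derive x 1 E (x ^- 2 * E x).
    have hE : is_derive ((- V) x) 1 expR (expR (- V x)) by exact: is_derive_expR.
    have := is_derive1_comp hE (is_deriveN dV).
    by rewrite opprK (_ : expR \o - V = E)// mulrC.
  have dF : is_derive x 1 (fun y => V y ^+ k * E y) (V x ^+ k.+2 * E x - k%:R * (V x ^+ k.+1 * E x)).
    elim: k => [|k IH].
      rewrite (_ : (fun y => _) = E); last by apply/funext => y; rewrite expr0 mul1r.
      by apply: is_derive_eq dE _; rewrite mul0r subr0 /V exprVn.
    rewrite (_ : (fun y => _) = V * (fun y => V y ^+ k * E y)); last first.
      by apply/funext => y; rewrite exprS mulrA.
    apply: is_derive_eq (is_deriveM dV IH) _; rewrite /GRing.scale/= -exprVn -/(V x) !exprS -(natr1 k).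
    ring.
  have -> : flat k.+2 x - k%:R * flat k.+1 x = V x ^+ k.+2 * E x - k%:R * (V x ^+ k.+1 * E x).
    by rewrite /flat x0.
  apply: near_eq_is_derive dF.
  near=> y; have y0 : 0 < y by near: y; apply: open_nbhs_nbhs; split; [exact: open_gt|].
  by rewrite /flat y0.
- have -> : flat k.+2 x - k%:R * flat k.+1 x = 0.
    by rewrite /flat ltNge (ltW x0)/= mulr0 subrr.
  apply: near_eq_is_derive (is_derive_cst (0 : R) x 1).
  near=> y; have y0 : y < 0 by near: y; apply: open_nbhs_nbhs; split; [exact: open_lt|].
  by rewrite /flat ltNge (ltW y0).
- have -> : flat k.+2 0 - k%:R * flat k.+1 0 = 0 :> R by rewrite /flat ltxx mulr0 subrr.
  apply: is_derive_cvg; apply/cvgrPdist_lt => e e0.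
  have C0 : 0 < (k.+2)`!%:R :> R by rewrite ltr0n fact_gt0.
  exists (e / (k.+2)`!%:R) => /=; first by rewrite divr_gt0.
  move=> h /=.
  rewrite sub0r normrN => he h0.
  rewrite sub0r normrN /flat ltxx subr0 -/(flat k _) addr0 /GRing.scale/= mulr1.
  rewrite normrM normfV ger0_norm ?flat_ge0// mulrC ltr_pdivrMr ?normr_gt0//.
  apply: le_lt_trans (flat_le_sqr k h) _.
  rewrite -[h ^+ 2]real_normK ?num_real// expr2 mulrA ltr_pM2r ?normr_gt0//.
  by rewrite mulrC -ltr_pdivlMr.
Unshelve. all: by end_near.
Qed.

Lemma continuous_flat k : continuous (flat k).
Proof.
move=> x; apply: differentiable_continuous; apply/derivable1_diffP.
by have [] := is_derive_flat k x.
Qed.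

Lemma flat0_cvg (t : R) : flat 0 (k%:R * t) @[k --> \oo] --> (if 0 < t then 1 else 0 : R).
Proof.
have [t0|t0] := ltP 0 t; last first.
  apply: cvg_near_cst; apply: nearW => k.
  by rewrite /flat ltNge (_ : _ <= 0)//= mulr_ge0_le0.
have h0 : - (k%:R * t)^-1 @[k --> \oo] --> - (0 : R).
  have P0 : \forall k \near \oo, 0 < (k%:R : R) by exists 1%N => // k /=; rewrite ltr0n.
  have P := (gtr0_cvgV0 P0).2 (@cvgr_idn R).
  have Q := cvgM (P _) (cvg_cst t^-1 : (fun=> t^-1) @ \oo --> t^-1).
  rewrite mul0r in Q; apply: cvgN.
  rewrite (_ : (fun k : nat => (k%:R * t)^-1) = unstable.inv_fun (GRing.natmul (1 : R)) \* (fun=> t^-1)); first exact: Q.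
  by apply/funext => k; rewrite /= invfM.
have h := continuous_cvg _ (@continuous_expR R (- 0)) h0 _.
rewrite oppr0 expR0 in h.
apply: cvg_trans (h _); apply: near_eq_cvg; exists 1%N => // k /= k0.
by rewrite /flat mulr_gt0 ?ltr0n// expr0 mul1r.
Qed.

Lemma flat0_le1 t : flat 0 t <= 1.
Proof.
rewrite /flat; case: ltP => // t0; rewrite expr0 mul1r -expR0 ler_expR oppr_le0.
by rewrite invr_ge0 ltW.
Qed.

End FlatFunctions.

Section Bumps.
Context {R : realType} {N : nat}.
Implicit Types f g : 'rV[R]_N -> R.

(** This class is stable under partial derivatives, so the smoothness of its
members reduces to continuity and first derivatives. *)
Inductive flat_class : ('rV[R]_N -> R) -> Prop :=
| flat_cst c : flat_class (fun=> c)
| flat_coord k c a i : flat_class (fun x => flat k (c * x 0 i + a))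
| flat_add f g : flat_class f -> flat_class g -> flat_class (f + g)
| flat_mul f g : flat_class f -> flat_class g -> flat_class (f * g).

Lemma flat_class_partial f (j : 'I_N) : flat_class f ->
  exists2 g, flat_class g & forall x, is_derive x (delta_mx 0 j : 'rV[R]_N) f (g x).
Proof.
elim=> [c|k c a i|f1 f2 S1 [g1 T1 d1] S2 [g2 T2 d2]|f1 f2 S1 [g1 T1 d1] S2 [g2 T2 d2]].
- by exists (fun=> 0) => [|x]; [exact: flat_cst|exact: is_derive_cst].
- pose e : R := c * (i == j)%:R.
  exists (fun x : 'rV[R]_N => e * (flat k.+2 (c * x 0 i + a) + - k%:R * flat k.+1 (c * x 0 i + a))).
    exact: (flat_mul (flat_cst e) (flat_add (flat_coord k.+2 c a i)
      (flat_mul (flat_cst (- k%:R)) (flat_coord k.+1 c a i)))).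
  move=> x; apply: is_derive_line.
  pose L (t : R) : R := e * t + (c * x 0 i + a).
  rewrite (_ : (fun t => _) = flat k \o L); last first.
    apply/funext => t /=; congr flat; rewrite /L /e !mxE eqxx/= eq_sym; ring.
  have dL : is_derive (0 : R) 1 L e.
    by apply: is_derive_eq; rewrite /GRing.scale/=; ring.
  have L0 : L 0 = c * x 0 i + a by rewrite /L mulr0 add0r.
  apply: is_derive_eq (is_derive1_comp (is_derive_flat k (L 0)) dL) _.
  by rewrite L0 mulrC mulNr.
- by exists (g1 + g2) => [|x]; [exact: flat_add|exact: is_deriveD].
- exists (f1 * g2 + f2 * g1) => [|x]; last exact: is_deriveM.
  by apply: flat_add; exact: flat_mul.
Qed.

Lemma continuous_coord (i : 'I_N) : continuous (fun x : 'rV[R]_N => x 0 i).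
Proof. by move=> x; exact: coord_continuous. Qed.

Lemma flat_class_continuous f : flat_class f -> continuous f.
Proof.
elim=> [c|k c a i|f1 f2 _ c1 _ c2|f1 f2 _ c1 _ c2] x.
- exact: cst_continuous.
- apply: (@continuous_comp _ _ _ (fun x : 'rV[R]_N => c * x 0 i + a) (flat k)); last exact: continuous_flat.
  apply: continuousD; last exact: cst_continuous.
  by apply: continuousM; [exact: cst_continuous|exact: continuous_coord].
- by apply: continuousD; [exact: c1|exact: c2].
- by apply: continuousM; [exact: c1|exact: c2].
Qed.

Lemma flat_class_smooth f : flat_class f -> smooth f.
Proof.
move=> Sf I; have Sg : flat_class (foldr (@partial R N) f I).
  elim: I => [|i I IH] //=; have [g Sg dg] := flat_class_partial i IH.
  rewrite (_ : partial _ _ = g)//; apply/funext => x; rewrite /partial.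
  by have [_ ->] := dg x.
split; first exact: flat_class_continuous.
by move=> x i; have [g _ dg] := flat_class_partial i Sg; have [] := dg x.
Qed.

Variables c d : 'rV[R]_N.

(** As k grows, the bumps converge to the indicator of the box. *)
Definition box_bump (k : nat) (x : 'rV[R]_N) : R :=
  \prod_i (flat 0 (k%:R * (x 0 i - c 0 i)) * flat 0 (k%:R * (d 0 i - x 0 i))).

Lemma box_bump_ge0 k x : 0 <= box_bump k x.
Proof. by apply: prodr_ge0 => i _; rewrite mulr_ge0 ?flat_ge0. Qed.

Lemma box_bump_out k x : ~ box c d x -> box_bump k x = 0.
Proof.
move=> xB; suff [i h] : exists i : 'I_N, ~ (c 0 i < x 0 i /\ x 0 i < d 0 i).
  rewrite /box_bump (bigD1 i)//= /flat.
  have [h1|h1] := ltP 0 (k%:R * (x 0 i - c 0 i)); last by rewrite !mul0r.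
  have [h2|h2] := ltP 0 (k%:R * (d 0 i - x 0 i)); last by rewrite mulr0 mul0r.
  exfalso; apply: h; have k0 : 0 < (k%:R : R).
    by rewrite ltr0n lt0n; apply: contraL h1 => /eqP ->; rewrite mul0r ltxx.
  by rewrite !pmulr_rgt0// !subr_gt0 in h1 h2.
by apply/existsNP => h; apply: xB.
Qed.

Lemma box_bump_le_indic k x : box_bump k x <= \1_(box c d) x.
Proof.
have [xB|xB] := pselect (box c d x); last first.
  by rewrite box_bump_out// indicE.
rewrite indicE mem_set//; apply: prodr_ile1 => i _.
by rewrite mulr_ge0 ?flat_ge0//= mulr_ile1 ?flat_ge0 ?flat0_le1.
Qed.

Lemma box_bump_cvg x : box_bump k x @[k --> \oo] --> (\1_(box c d) x : R).
Proof.
have [xB|xB] := pselect (box c d x); last first.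
  by apply: cvg_near_cst; apply: nearW => k; rewrite box_bump_out// indicE memNset.
rewrite indicE mem_set// /box_bump; elim: (index_enum _) => [|i r IH].
  by under eq_fun do rewrite big_nil; exact: cvg_cst.
under eq_fun do rewrite big_cons.
have [h1 h2] := xB i.
have A := @flat0_cvg R (x 0 i - c 0 i); rewrite subr_gt0 h1 in A.
have B := @flat0_cvg R (d 0 i - x 0 i); rewrite subr_gt0 h2 in B.
have E := cvgM (cvgM A B) IH; rewrite !mul1r in E.
exact: E.
Qed.

Lemma box_bump_smooth k : smooth (box_bump k).
Proof.
apply: flat_class_smooth; rewrite /box_bump; elim: (index_enum _) => [|i r IH].
  by under eq_fun do rewrite big_nil; exact: flat_cst.
under eq_fun do rewrite big_cons.
apply: (flat_mul _ IH).
rewrite (_ : (fun x : 'rV[R]_N => _) = fun x : 'rV[R]_N => flat 0 (k%:R * x 0 i + - (k%:R * c 0 i)) *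
    flat 0 (- k%:R * x 0 i + k%:R * d 0 i)); last first.
  by apply/funext => x; congr (flat _ _ * flat _ _); ring.
exact: flat_mul (flat_coord _ _ _ _) (flat_coord _ _ _ _).
Qed.

Lemma compact_cube (M : R) : compact [set x : 'rV[R]_N | forall i, x 0 i \in `[- M, M]].
Proof. by apply: (@rV_compact _ _ (fun=> `[- M, M]%classic)) => i; exact: segment_compact. Qed.

Lemma compact_closure_sub (A : set 'rV[R]_N) (M : R) : A `<=` cube M -> compact (closure A).
Proof.
move=> AM; have cK := @compact_cube M.
apply: subclosed_compact (cK) _; first exact: closed_closure.
have clK := compact_closed (@norm_hausdorff _ _) cK.
rewrite ((closure_id _).1 clK); apply: closureS => x /AM h i.
by have := h i; rewrite !mxE in_itv/= => -[/ltW -> /ltW ->].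
Qed.

Lemma box_sub_cube : exists M, box c d `<=` cube M.
Proof.
exists (\sum_i (`|c 0 i| + `|d 0 i|)) => x xB i; rewrite !mxE.
have [h1 h2] := xB i.
have : `|c 0 i| + `|d 0 i| <= \sum_i (`|c 0 i| + `|d 0 i|).
  by rewrite (bigD1 i)//= lerDl sumr_ge0// => j _; rewrite addr_ge0.
have := ler_norm (d 0 i); have := ler_norm (- c 0 i); rewrite normrN.
have := normr_ge0 (d 0 i); have := normr_ge0 (c 0 i).
by move=> *; split; lra.
Qed.

Lemma box_bump_Cc_infty k : Cc_infty (box_bump k).
Proof.
split; first exact: box_bump_smooth.
have [M h] := box_sub_cube.
apply: (@compact_closure_sub _ M); apply: subset_trans h => x /=.
by apply: contra_neqP => xB; rewrite box_bump_out.
Qed.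

End Bumps.

Section Limits.
Context {R : realType}.
Implicit Types F G : nat -> R.

Lemma cvg0_mul (c : R) F : F k @[k --> \oo] --> 0 -> c * F k @[k --> \oo] --> 0.
Proof. by move=> F0; rewrite -(mulr0 c); apply: cvgM => //; exact: cvg_cst. Qed.

Lemma cvg0_add F G : F k @[k --> \oo] --> 0 -> G k @[k --> \oo] --> 0 ->
  F k + G k @[k --> \oo] --> 0.
Proof. by move=> F0 G0; rewrite -(addr0 (0 : R)); exact: cvgD. Qed.

Lemma cvg_eq_cst F (a b : R) : F k @[k --> \oo] --> a -> (forall k, F k = b) -> a = b.
Proof.
move=> Fa Fb; rewrite -(cvg_lim (@norm_hausdorff _ _) Fa).
by under eq_fun do rewrite Fb; exact: lim_cst.
Qed.

Lemma cvg_rV N (F : nat -> 'rV[R]_N) (x : 'rV[R]_N) :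
  (forall i, F k 0 i @[k --> \oo] --> x 0 i) -> F k @[k --> \oo] --> x.
Proof.
move=> H; apply/cvg_mx_entourageP => A entA.
apply: filter_forall => i; apply: filter_forall => j; rewrite (ord1 i).
have /cvg_entourageP/(_ A entA) := H j.
by move=> [K _ HK]; exists K => // k /= Kk; rewrite inE; exact: HK.
Qed.

End Limits.

Section BumpInduction.
Context {R : realType} {N : nat}.
Notation mu := (lebRV R N).

Lemma Cc_infty_continuous (f : 'rV[R]_N -> R) : Cc_infty f -> continuous f.
Proof. by move=> [/(_ [::])[]]. Qed.

Lemma Cc_infty_measurable (f : 'rV[R]_N -> R) : Cc_infty f -> measurable_fun setT f.
Proof. by move=> /Cc_infty_continuous; exact: continuous_measurable_rV. Qed.

Lemma measurable_box_bump (c d : 'rV[R]_N) k : measurable_fun setT (box_bump c d k).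
Proof. exact: Cc_infty_measurable (box_bump_Cc_infty c d k). Qed.

Lemma L2_indic_box (c d : 'rV[R]_N) : L2 mu (\1_(box c d)).
Proof. by apply: L2_indic; [exact: measurable_box|exact: box_measure_lty]. Qed.

Lemma box_bump_L2 (c d : 'rV[R]_N) :
  [/\ forall k, L2 mu (box_bump c d k), L2 mu (\1_(box c d)) & L2cvg mu (box_bump c d) (\1_(box c d))].
Proof.
apply: (L2_dominated _ (L2_indic_box c d)).
- exact: measurable_box_bump.
- exact: box_bump_cvg.
- by move=> k x; rewrite ger0_norm ?box_bump_ge0//; exact: box_bump_le_indic.
Qed.

Lemma L2_bump_induction (V : set ('rV[R]_N -> R)) :
  (forall f g k, L2 mu f -> L2 mu g -> V f -> V g -> V (fun x => f x + k * g x)) ->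
  (forall F f, (forall k : nat, L2 mu (F k)) -> L2 mu f ->
    (forall k, V (F k)) -> L2cvg mu F f -> V f) ->
  (forall c d k, V (box_bump c d k)) -> forall f, L2 mu f -> V f.
Proof.
move=> VD Vlim Vbump; apply: L2_box_induction (VD) (Vlim) _ => c d.
by have [b2 i2 bc] := box_bump_L2 c d; exact: Vlim b2 i2 (Vbump c d) bc.
Qed.

Lemma Rint_translate (f : 'rV[R]_N -> R) (b : 'rV[R]_N) : measurable_fun setT f ->
  \int[mu]_x f (x + b) = \int[mu]_x f x.
Proof.
move=> mf; rewrite /Rintegral (@integral_translate _ _ (fun x => (f x)%:E))//.
exact/measurable_EFinP.
Qed.

Lemma measurable_translate (f : 'rV[R]_N -> R) (b : 'rV[R]_N) : measurable_fun setT f ->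
  measurable_fun setT (fun x : 'rV[R]_N => f (x + b)).
Proof.
move=> mf; apply: (measurableT_comp mf).
by have := measurable_affine 1 b; under eq_fun do rewrite scale1r.
Qed.

Lemma Int_translate (f : 'rV[R]_N -> R) b : Int mu f -> Int mu (fun x => f (x + b)).
Proof.
move=> /IntP[mf f1]; apply/IntP; split; first exact: measurable_translate.
rewrite (@integral_translate _ _ (fun x => `|f x|%:E))//.
by apply/measurable_EFinP; exact: measurableT_comp.
Qed.

Lemma L2_translate (f : 'rV[R]_N -> R) b : L2 mu f -> L2 mu (fun x => f (x + b)).
Proof.
move=> [mf f2]; split; first exact: measurable_translate.
rewrite (@integral_translate _ _ (fun x => (f x ^+ 2)%:E))//.
by apply/measurable_EFinP; exact: measurable_funX.
Qed.

Lemma nsq_translate (f : 'rV[R]_N -> R) b : measurable_fun setT f ->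
  nsq mu (fun x => f (x + b)) = nsq mu f.
Proof. by move=> mf; apply: (@Rint_translate (fun x => f x * f x)); exact: measurable_funM. Qed.

(** Continuity of translations in mean square: by density it suffices to treat bumps,
where all translates stay in one larger box and dominated convergence applies. *)
Lemma translate_cvg (u : 'rV[R]_N -> R) (h : nat -> 'rV[R]_N) (M : R) : L2 mu u ->
  (forall i, h k 0 i @[k --> \oo] --> 0) -> (forall k i, `|h k 0 i| <= M) ->
  nsq mu (fun x => u (x + h k) - u x) @[k --> \oo] --> 0.
Proof.
move=> u2 h0 hM; move: u u2; apply: L2_bump_induction.
- move=> f g a f2 g2 Vf Vg.
  have bound := cvg0_add (cvg0_mul 2 Vf) (cvg0_mul 2 (cvg0_mul (a ^+ 2) Vg)).
  apply: squeeze_cvgr bound; last exact: cvg_cst.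
  apply: nearW => k; rewrite nsq_ge0/=.
  have D2 : L2 mu (fun x => f (x + h k) - f x) by apply: L2B => //; exact: L2_translate.
  have E2 : L2 mu (fun x => g (x + h k) - g x) by apply: L2B => //; exact: L2_translate.
  rewrite -(nsqZ a E2); apply: le_trans (nsqD_le D2 (L2Z a E2)).
  by rewrite le_eqVlt; apply/orP; left; apply/eqP; apply: eq_Rintegral => x _; congr (_ * _); ring.
- move=> F f F2 f2 VF Ff; apply/cvgrPdist_lt => e e0.
  (* Applying the inequality |a + b|^2 <= 2 |a|^2 + 2 |b|^2 twice costs the factors 4, 4
     and 2, whose sum is below 12. *)
  have e9 : 0 < e / 12 by rewrite divr_gt0.
  have /cvgrPdist_lt/(_ _ e9)[K _ HK] := Ff.
  have /cvgrPdist_lt/(_ _ e9) := VF K; apply: filterS => k.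
  have := HK K (leqnn K); rewrite /= !sub0r !normrN !ger0_norm ?nsq_ge0// => h1 h2.
  have A2 : L2 mu (fun x => F K (x + h k) - F K x) by apply: L2B => //; exact: L2_translate.
  have B2 : L2 mu (fun x => F K x - f x) by exact: L2B.
  have C2 : L2 mu (fun x => F K (x + h k) - f (x + h k)) by exact: L2_translate B2.
  have CE : nsq mu (fun x => F K (x + h k) - f (x + h k)) = nsq mu (fun x => F K x - f x).
    by rewrite (nsq_translate (f := fun x => F K x - f x))//; exact: L2_measurable B2.
  have := nsqD_le (L2D A2 B2) (L2N C2); have := nsqD_le A2 B2.
  have -> : nsq mu (fun x => - (F K (x + h k) - f (x + h k))) = nsq mu (fun x => F K x - f x).
    by rewrite -CE; apply: eq_Rintegral => x _; rewrite mulrNN.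
  have -> : nsq mu (fun x => F K (x + h k) - F K x + (F K x - f x) + - (F K (x + h k) - f (x + h k))) =
    nsq mu (fun x => f (x + h k) - f x).
    by apply: eq_Rintegral => x _; congr (_ * _); ring.
  by move=> h3 h4; lra.
- move=> c d k.
  pose B := \1_(box (c - const_mx M) (d + const_mx M)) : 'rV[R]_N -> R.
  have M0 (i : 'I_N) : 0 <= M by apply: le_trans (hM 0%N i).
  have bB x : `|box_bump c d k x| <= B x.
    rewrite ger0_norm ?box_bump_ge0//; apply: le_trans (box_bump_le_indic c d k x) _.
    rewrite !indicE ler_nat; case: (boolP (x \in box c d)) => //; rewrite inE => xB.
    rewrite mem_set// => i; have [] := xB i; rewrite !mxE.
    by have := M0 i; clear M0; move=> *; split; lra.
  have bhB j x : `|box_bump c d k (x + h j)| <= B x.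
    rewrite ger0_norm ?box_bump_ge0//; apply: le_trans (box_bump_le_indic c d k (x + h j)) _.
    rewrite !indicE ler_nat; case: (boolP (x + h j \in box c d)) => //; rewrite inE => xB.
    rewrite mem_set// => i; have [] := xB i; rewrite !mxE.
    by have := hM j i; rewrite ler_norml => /andP[? ?]; clear M0; move=> *; split; lra.
  have [||||] := @L2_dominated _ _ _ mu (fun j x => box_bump c d k (x + h j)) (box_bump c d k) B.
  + by move=> j; apply: measurable_translate; exact: measurable_box_bump.
  + exact: L2_indic_box.
  + move=> x; apply: (@cvg_comp _ _ _ (fun j => x + h j) (box_bump c d k) _ (nbhs x)); last first.
      exact: (Cc_infty_continuous (box_bump_Cc_infty c d k)).
    apply: cvg_rV => i; under eq_fun do rewrite mxE.
    have E := cvgD (cvg_cst (x 0 i) : (fun=> x 0 i) @ \oo --> x 0 i) (h0 i).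
    by rewrite addr0 in E; exact: E.
  + by move=> j x; exact: bhB.
  by move=> _ _.
Qed.

End BumpInduction.

Section DuBoisReymond.
Context {R : realType} {N : nat}.
Notation mu := (lebRV R N).
Variable h : 'rV[R]_N -> R.
Hypothesis hloc : locally_integrable_rV h.
Hypothesis h0 : forall phi, Cc_infty phi -> \int[mu]_x (h x * phi x) = 0.

Lemma locally_integrable_cube M : Int mu (fun x => h x * \1_(cube M) x).
Proof.
have [mh /(_ _ (@compact_cube _ _ M)) hK] := hloc.
set K := [set x | _] in hK.
have mK : measurable K by exact: measurable_compact (@compact_cube _ _ M).
have : mu.-integrable setT (EFin \o h \_ K).
  by rewrite -restrict_EFin; apply/(integrable_mkcond _ mK).
move=> hR; apply: (le_Int _ _ hR) => [|x].
  by apply: measurable_funM => //; apply: measurable_indic; exact: measurable_cube.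
rewrite patchE indicE; case: (boolP (x \in cube M)) => [|_]; last by rewrite mulr0 normr0.
rewrite mulr1 inE => xM; rewrite mem_set// => i.
by have := xM i; rewrite !mxE in_itv/= => -[/ltW -> /ltW ->].
Qed.

Let IntM (A : set 'rV[R]_N) M : measurable A -> Int mu (fun x => h x * \1_(A `&` cube M) x).
Proof.
move=> mA; apply: (le_Int _ _ (@locally_integrable_cube M)) => [|x].
  apply: measurable_funM; first by have [] := hloc.
  by apply: measurable_indic; apply: measurableI => //; exact: measurable_cube.
rewrite !indicE in_setI; case: (x \in A) => //=; case: (x \in cube M); rewrite ?mulr0 ?normr0//.
Qed.

Let int_box c d : \int[mu]_x (h x * \1_(box c d) x) = 0.
Proof.
have [M bM] := @box_sub_cube R N c d.
have mh : measurable_fun setT h by have [] := hloc.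
have [||||_] := @Rint_dominated _ _ _ mu (fun k x => h x * box_bump c d k x) (fun x => h x * \1_(box c d) x)
  (fun x => `|h x * \1_(cube M) x|).
- by move=> k; apply: measurable_funM => //; exact: measurable_box_bump.
- exact/Int_abs/locally_integrable_cube.
- by move=> x; apply: cvgM; [exact: cvg_cst|exact: box_bump_cvg].
- move=> k x; rewrite !normrM ler_wpM2l// !ger0_norm ?box_bump_ge0//.
  apply: le_trans (box_bump_le_indic c d k x) _; rewrite !indicE ler_nat.
  by case: (boolP (x \in box c d)) => //; rewrite inE => /bM xM; rewrite mem_set.
move=> H; apply: (cvg_eq_cst H) => k; apply: h0; exact: box_bump_Cc_infty.
Qed.

Let int_meas M (A : set 'rV[R]_N) : measurable A -> \int[mu]_x (h x * \1_(A `&` cube M) x) = 0.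
Proof.
move: A; apply: dynkin_boxes => [|c d|A mA IA|F mF tF IF].
- by rewrite setTI; exact: int_box.
- by rewrite /cube boxI; exact: int_box.
- transitivity (\int[mu]_x (h x * \1_(cube M) x - h x * \1_(A `&` cube M) x)).
    apply: eq_Rintegral => x _; rewrite !indicE !in_setI in_setC.
    by case: (x \in A); case: (x \in cube M); rewrite /=; ring.
  by rewrite RintB ?IA ?int_box ?subrr//; [exact: locally_integrable_cube|exact: IntM].
- pose G k x := h x * \1_((\big[setU/set0]_(i < k) F i) `&` cube M) x.
  have mU k : measurable (\big[setU/set0]_(i < k) F i) by exact: bigsetU_measurable.
  have G0 k : \int[mu]_x G k x = 0.
    elim: k => [|k IH].
      rewrite -[RHS](Rint_cst0 mu); apply: eq_Rintegral => x _.
      by rewrite /G big_ord0 set0I indic0 mulr0.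
    transitivity (\int[mu]_x (G k x + h x * \1_(F k `&` cube M) x)).
      by apply: eq_Rintegral => x _; rewrite /G -mulrDr indic_bigsetU_recr.
    by rewrite RintD ?IH ?IF ?addr0//; exact: IntM.
  have [||||_] := @Rint_dominated _ _ _ mu G (fun x => h x * \1_(\bigcup_k F k `&` cube M) x)
    (fun x => `|h x * \1_(cube M) x|).
  - by move=> k; exact: Int_measurable (IntM _ (mU k)).
  - exact/Int_abs/locally_integrable_cube.
  - by move=> x; apply: cvgM; [exact: cvg_cst|exact: indic_bigcup_cvg].
  - move=> k x; rewrite /G !normrM ler_wpM2l// !indicE in_setI !ger0_norm// ler_nat.
    by case: (x \in cube M); rewrite ?andbF// andbT leq_b1.
  by move=> H; exact: cvg_eq_cst H G0.
Qed.

(** The du Bois-Reymond lemma. As limits of bumps, the indicators of boxes are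
orthogonal to h, hence so are those of bounded measurable sets, such as the part of a
cube where h has a given sign. *)
Lemma locally_integrable_eq0 : {ae mu, forall x, h x = 0}.
Proof.
have mh : measurable_fun setT h by have [] := hloc.
have half (sg : bool) M : {ae mu, forall x, cube M x -> (-1) ^+ sg * h x <= 0}.
  pose A := [set x | 0 < (-1) ^+ sg * h x].
  have mA : measurable A.
    rewrite (_ : A = (fun x => (-1) ^+ sg * h x) @^-1` `]0, +oo[%classic); last first.
      by apply/seteqP; split => x; rewrite /A/= in_itv/= andbT.
    rewrite -[X in measurable X]setTI; apply: (measurable_funM _ mh) => //.
  have g0 x : 0 <= (-1) ^+ sg * (h x * \1_(A `&` cube M) x).
    rewrite indicE in_setI mulrA; case: (boolP (x \in A)) => [|_]; last by rewrite mulr0.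
    by rewrite inE => /ltW xA; rewrite mulr_ge0.
  have gI : Int mu (fun x => (-1) ^+ sg * (h x * \1_(A `&` cube M) x)) by apply: IntZ; exact: IntM.
  have : (\int[mu]_x `|((-1) ^+ sg * (h x * \1_(A `&` cube M) x))%:E| = 0)%E.
    under eq_integral do rewrite abse_EFin ger0_norm//.
    by rewrite -RintegralE// RintZ ?int_meas ?mulr0//; exact: IntM.
  move/(ae_eq_integral_abs _ measurableT (measurable_int _ gI)).
  apply: filterS => x /= /(_ I) [gx] xM; rewrite leNgt; apply/negP => xA.
  move: gx; rewrite indicE mem_set//= mulr1 => gx.
  by move: xA; rewrite gx ltxx.
have all (sg : bool) : {ae mu, forall x, (-1) ^+ sg * h x <= 0}.
  have := ae_foralln (fun k => half sg k%:R); apply: filterS => x H.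
  by have [k kx] := coord_bounded x; exact: H kx.
move: (all true) (all false); apply: filterS2 => x.
by rewrite expr0 expr1 mul1r mulN1r oppr_le0 => h1 h2; apply/eqP; rewrite eq_le h1 h2.
Qed.

End DuBoisReymond.

(** * Plancherel's theorem *)

Section TrigTransform.
Context {R : realType} {N : nat}.
Notation mu := (lebRV R N).
Implicit Types u v : 'rV[R]_N -> R.

Definition fconst : R := (2 * pi) `^ (- (N%:R / 2)).

(** The real and imaginary parts of the Fourier transform are the cases a = 0
and a = pi / 2. *)
Definition trig (a : R) u (xi : 'rV[R]_N) : R :=
  fconst * \int[mu]_x (cos (dotrv x xi + a) * u x).

Lemma dotrvC (x y : 'rV[R]_N) : dotrv x y = dotrv y x.
Proof. by apply: eq_bigr => i _; rewrite mulrC. Qed.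

Lemma dotrvDl (x y z : 'rV[R]_N) : dotrv (x + y) z = dotrv x z + dotrv y z.
Proof. by rewrite /dotrv -big_split; apply: eq_bigr => i _; rewrite mxE mulrDl. Qed.

Lemma dotrvZl (a : R) (x y : 'rV[R]_N) : dotrv (a *: x) y = a * dotrv x y.
Proof. by rewrite /dotrv mulr_sumr; apply: eq_bigr => i _; rewrite mxE mulrA. Qed.

Lemma dotrvNl (x y : 'rV[R]_N) : dotrv (- x) y = - dotrv x y.
Proof. by rewrite -scaleN1r dotrvZl mulN1r. Qed.

Lemma dotrv0l (y : 'rV[R]_N) : dotrv 0 y = 0.
Proof. by rewrite /dotrv big1// => i _; rewrite mxE mul0r. Qed.

Lemma measurable_dotrv2 : measurable_fun setT (fun z : 'rV[R]_N * 'rV[R]_N => dotrv z.1 z.2).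
Proof.
apply: measurable_sum => i; apply: measurable_funM.
  by apply: (measurableT_comp (measurable_coord i)); exact: measurable_fst.
by apply: (measurableT_comp (measurable_coord i)); exact: measurable_snd.
Qed.

Lemma measurable_cosR : measurable_fun setT (@cos R).
Proof. exact: continuous_measurable_fun (@continuous_cos R). Qed.

Lemma measurable_cos2 (a : R) :
  measurable_fun setT (fun z : 'rV[R]_N * 'rV[R]_N => cos (dotrv z.1 z.2 + a)).
Proof.
apply: (measurableT_comp measurable_cosR).
by apply: measurable_funD => //; exact: measurable_dotrv2.
Qed.

Lemma measurable_cos_l (a : R) (xi : 'rV[R]_N) :
  measurable_fun setT (fun x : 'rV[R]_N => cos (dotrv x xi + a)).
Proof. by under eq_fun do rewrite dotrvC; exact: measurable_cos_dotrv. Qed.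

Lemma cos_abs_le1 (t : R) : `|cos t| <= 1.
Proof. by rewrite ler_norml cos_le1 cos_geN1. Qed.

Lemma cos_Int (a : R) u xi : Int mu u -> Int mu (fun x => cos (dotrv x xi + a) * u x).
Proof.
move=> Iu; apply: (le_Int _ _ Iu).
  by apply: measurable_funM; [exact: measurable_cos_l|exact: Int_measurable Iu].
by move=> x; rewrite normrM ler_piMl// cos_abs_le1.
Qed.

Lemma measurable_add_rV :
  measurable_fun setT (fun z : 'rV[R]_N * 'rV[R]_N => z.1 + z.2).
Proof.
apply: measurable_fun_rVP => i.
rewrite (_ : _ \o _ = fun z : 'rV[R]_N * 'rV[R]_N => z.1 0 i + z.2 0 i); last first.
  by apply/funext => z; rewrite /= /rV_coord mxE.
apply: measurable_funD.
  by apply: (measurableT_comp (measurable_coord i)); exact: measurable_fst.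
by apply: (measurableT_comp (measurable_coord i)); exact: measurable_snd.
Qed.

Lemma measurable_trig a u : measurable_fun setT u -> measurable_fun setT (trig a u).
Proof.
move=> mf; apply: measurable_funM => //.
apply: (@measurable_Rint_param _ _ _ _ _ mu (fun z : 'rV[R]_N * 'rV[R]_N => cos (dotrv z.2 z.1 + a) * u z.2)).
apply: measurable_funM; last by apply: (measurableT_comp mf); exact: measurable_snd.
by under eq_fun do rewrite dotrvC; exact: measurable_cos2.
Qed.

Lemma trigD a u v : Int mu u -> Int mu v ->
  trig a (fun x => u x + v x) = (fun xi => trig a u xi + trig a v xi).
Proof.
move=> Iu Iv; apply/funext => xi; rewrite /trig -mulrDr -RintD; try exact: cos_Int.
by congr (_ * _); apply: eq_Rintegral => x _; rewrite mulrDr.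
Qed.

Lemma trigZ a k u : Int mu u -> trig a (fun x => k * u x) = (fun xi => k * trig a u xi).
Proof.
move=> Iu; apply/funext => xi; rewrite /trig (mulrCA k); congr (_ * _).
rewrite -RintZ; last exact: cos_Int.
by apply: eq_Rintegral => x _; rewrite mulrCA.
Qed.

Lemma trig_translate a u h xi : Int mu u ->
  trig a (fun x => u (x + h)) xi = cos (dotrv h xi) * trig a u xi - sin (dotrv h xi) * trig (a + pi / 2) u xi.
Proof.
move=> Iu; rewrite /trig !(mulrCA _ fconst) -mulrBr; congr (_ * _).
have Ic b : Int mu (fun x => cos (dotrv x xi + b) * u x) by exact: cos_Int.
rewrite -!RintZ// -RintB; try exact: IntZ.
rewrite -(@Rint_translate _ _ (fun x => cos (dotrv x xi + a) * u (x + h)) (- h)); last first.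
  apply: measurable_funM; first exact: measurable_cos_l.
  by apply: measurable_translate; exact: Int_measurable Iu.
apply: eq_Rintegral => x _; rewrite subrK !mulrA -mulrBl; congr (_ * _).
rewrite addrA cosDpihalf mulrN opprK -cosB -cosN; congr cos.
by rewrite dotrvDl dotrvNl; ring.
Qed.

Lemma trig_opp a u xi : trig a u (- xi) = trig (- a) u xi.
Proof.
rewrite /trig; congr (_ * _); apply: eq_Rintegral => x _; congr (_ * _).
by rewrite dotrvC dotrvNl -cosN opprD opprK dotrvC.
Qed.

Lemma fconst_sqr : fconst ^+ 2 * (2 * pi) ^+ N = 1.
Proof.
have p0 : 0 < 2 * pi :> R by rewrite mulr_gt0// pi_gt0.
have -> : (2 * pi : R) ^+ N = ((2 * pi) `^ (N%:R / 2)) ^+ 2.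
  by rewrite -!powR_mulrn ?powR_ge0 ?ltW// -powRrM divfK.
by rewrite -exprMn /fconst powRN mulVf ?expr1n// gt_eqF// powR_gt0.
Qed.

End TrigTransform.
Arguments fconst {R} N.

Section Plancherel.
Context {R : realType} {N : nat}.
Notation mu := (lebRV R N).
Variable u : 'rV[R]_N -> R.
Hypotheses (u1 : Int mu u) (u2 : L2 mu u).

Let mu_u : measurable_fun setT u. Proof. exact: Int_measurable u1. Qed.

(** The autocorrelation of u, whose transform is the power spectrum. *)
Let phi (z : 'rV[R]_N) : R := \int[mu]_y (u y * u (z + y)).

Let spec (xi : 'rV[R]_N) : R := trig 0 u xi ^+ 2 + trig (pi / 2) u xi ^+ 2.

Let mpair : measurable_fun setT (fun z : 'rV[R]_N * 'rV[R]_N => u z.1 * u (z.2 + z.1)).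
Proof.
apply: measurable_funM; first by apply: (measurableT_comp mu_u); exact: measurable_fst.
apply: (measurableT_comp mu_u); under eq_fun do rewrite addrC.
exact: measurable_add_rV.
Qed.

Let corr_fubini xi :
  [/\ Int mu (fun z => \int[mu]_y (cos (dotrv z xi) * (u y * u (z + y)))) &
   \int[mu]_y \int[mu]_z (cos (dotrv z xi) * (u y * u (z + y))) =
   \int[mu]_z \int[mu]_y (cos (dotrv z xi) * (u y * u (z + y)))].
Proof.
pose F (p : 'rV[R]_N * 'rV[R]_N) := cos (dotrv p.2 xi) * (u p.1 * u (p.2 + p.1)).
have mF : measurable_fun setT F.
  apply: measurable_funM => //.
  apply: (measurableT_comp measurable_cosR).
  under eq_fun do rewrite dotrvC.
  by apply: (measurableT_comp (measurable_dotrv xi)); exact: measurable_snd.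
have [|I1 I2 E] := @Rfubini _ _ _ _ _ mu mu F mF; last by split.
have Iabs := Int_abs u1.
apply: (fubini_dom (g := fun y => (\int[mu]_x `|u x|) * `|u y|)) => //; last exact: IntZ.
move=> y; rewrite mulrC EFinM RintegralE// -(@integral_translate _ _ (fun x => `|u x|%:E) y); last first.
  exact: measurable_int Iabs.
have mt : measurable_fun setT (fun z : 'rV[R]_N => `|u (z + y)|%:E).
  by apply/measurable_EFinP; apply: measurableT_comp => //; exact: measurable_translate.
rewrite -ge0_integralZl//; apply: ge0_le_integral.
- exact: measurableT.
- by move=> z _; rewrite lee_fin.
- apply/measurable_EFinP; apply: measurableT_comp => //.
  exact: (measurableT_comp mF (pair1_measurable y)).
- by apply: emeasurable_funM; [exact: measurable_cst|exact: mt].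
- by move=> z _; rewrite -EFinM lee_fin /F/= !normrM ler_piMl ?mulr_ge0// cos_abs_le1.
Qed.

Let phi_Int : Int mu phi.
Proof.
have [H _] := corr_fubini 0; apply: (le_Int _ _ H) => [|z].
  apply: (@measurable_Rint_param _ _ _ _ _ mu (fun p : 'rV[R]_N * 'rV[R]_N => u p.2 * u (p.1 + p.2))).
  exact: (measurable_swap_pair mpair).
rewrite /phi le_eqVlt; apply/orP; left; apply/eqP; congr `|_|.
by apply: eq_Rintegral => y _; rewrite dotrvC dotrv0l cos0 mul1r.
Qed.

Let spec_phi xi : spec xi = fconst N ^+ 2 * \int[mu]_z (cos (dotrv z xi) * phi z).
Proof.
have [_ E] := corr_fubini xi.
have Ic b : Int mu (fun x => cos (dotrv x xi + b) * u x) by exact: cos_Int.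
pose C b := \int[mu]_x (cos (dotrv x xi + b) * u x).
have -> : spec xi = fconst N ^+ 2 * (C 0 * C 0 + C (pi / 2) * C (pi / 2)).
  by rewrite /spec /trig -/(C 0) -/(C (pi / 2)); ring.
congr (_ * _).
have U y z : Int mu (fun z => u y * u (z + y)) by apply: IntZ; exact: Int_translate.
transitivity (\int[mu]_y \int[mu]_z (cos (dotrv z xi) * (u y * u (z + y)))).
  rewrite -(RintZ (C 0) (Ic 0)) -(RintZ (C (pi / 2)) (Ic (pi / 2))).
  rewrite -RintD; [|exact: IntZ (Ic 0)|exact: IntZ (Ic (pi / 2))].
  apply: eq_Rintegral => y _.
  transitivity (\int[mu]_x (u y * (cos (dotrv (x - y) xi) * u x))).
    rewrite RintZ; last first.
      have := Int_translate (- y) (cos_Int 0 xi (Int_translate y u1)).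
      by congr Int; apply/funext => x; rewrite addr0 subrK.
    transitivity (u y * (cos (dotrv y xi + 0) * C 0 + cos (dotrv y xi + pi / 2) * C (pi / 2))).
      by ring.
    congr (_ * _); rewrite -(RintZ _ (Ic 0)) -(RintZ _ (Ic (pi / 2))).
    rewrite -RintD; [|exact: IntZ (Ic 0)|exact: IntZ (Ic (pi / 2))].
    apply: eq_Rintegral => x _; rewrite !addr0 !cosDpihalf dotrvDl dotrvNl cosB; ring.
  rewrite -(@Rint_translate _ _ _ y); last first.
    apply: measurable_funM; first exact: measurable_cst.
    apply: measurable_funM; last exact: mu_u.
    have := measurable_translate (- y) (measurable_cos_l 0 xi).
    by under eq_fun do rewrite addr0.
  by apply: eq_Rintegral => z _; rewrite addrK; ring.
rewrite E; apply: eq_Rintegral => z _; rewrite /phi.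
have [c0|c0] := eqVneq (cos (dotrv z xi)) 0.
  rewrite c0 mul0r; under eq_Rintegral do rewrite mul0r.
  exact: Rint_cst0.
rewrite RintZ; first by [].
apply: L2M; first exact: u2.
by under [X in L2 _ X]eq_fun do rewrite addrC; exact: L2_translate.
Qed.

(** Its continuity at 0 is measured by the squared modulus of continuity of u. *)
Let D (z : 'rV[R]_N) : R := nsq mu (fun y => u (y + z) - u y).

Let phiE z : phi z = nsq mu u - D z / 2.
Proof.
have t2 := L2_translate z u2.
rewrite /D nsqB// nsq_translate//.
have -> : phi z = ip mu (fun y => u (y + z)) u.
  by apply: eq_Rintegral => y _; rewrite mulrC addrC.
lra.
Qed.

Let D_le z : D z <= 4 * nsq mu u.
Proof.
have := @nsqD_le _ _ _ mu _ _ (L2_translate z u2) (L2N u2).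
rewrite nsq_translate// -/(D z).
have -> : nsq mu (fun x => - u x) = nsq mu u by apply: eq_Rintegral => x _; rewrite mulrNN.
by move=> h; lra.
Qed.

Let mD : measurable_fun setT D.
Proof.
have -> : D = (fun z => 2 * (nsq mu u - phi z)) by apply/funext => z; rewrite phiE; lra.
apply: measurable_funM => //; apply: measurable_funB => //.
exact: Int_measurable phi_Int.
Qed.

(** Fubini moves the Gaussian factor from the spectrum to the autocorrelation, where
it becomes an approximate identity as e tends to 0. *)
Let gauss_spec (e : R) : 0 < e ->
  Int mu (fun xi => expR (- (e * sqn xi)) * spec xi) /\
  \int[mu]_xi (expR (- (e * sqn xi)) * spec xi) =
  fconst N ^+ 2 * \int[mu]_z (Num.sqrt (pi / e) ^+ N * (expR (- (sqn z / (4 * e))) * phi z)).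
Proof.
move=> e0.
pose F (p : 'rV[R]_N * 'rV[R]_N) := phi p.2 * (expR (- (e * sqn p.1)) * cos (dotrv p.2 p.1 + 0)).
have mphi := Int_measurable phi_Int.
have mF : measurable_fun setT F.
  apply: measurable_funM; first exact: (measurable_comp_snd mphi).
  apply: measurable_funM; first exact: (measurable_comp_fst (measurable_gaussN e (N := N))).
  by under eq_fun do rewrite dotrvC; exact: measurable_cos2.
have gI := gaussN_Int e0 N.
have FI : (\int[mu]_xi \int[mu]_z `|F (xi, z)|%:E < +oo)%E.
  apply: (fubini_prod_dom (a := fun xi => expR (- (e * sqn xi))) (b := phi)); [exact: mF| |exact: gI|exact: phi_Int].
  move=> xi z; rewrite /F [(xi, z).1]/= [(xi, z).2]/= !normrM mulrC ler_wpM2r ?normr_ge0//.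
  by rewrite ler_piMr ?normr_ge0// cos_abs_le1.
have [I1 I2 E] := @Rfubini _ _ _ _ _ mu mu F mF FI.
have sE xi : expR (- (e * sqn xi)) * spec xi = fconst N ^+ 2 * \int[mu]_z F (xi, z).
  rewrite spec_phi mulrCA; congr (_ * _); rewrite -RintZ; last first.
    have := cos_Int 0 xi phi_Int; by under [X in Int _ X]eq_fun do rewrite addr0.
  by apply: eq_Rintegral => z _; rewrite /F/= addr0; ring.
split; first by rewrite (funext sE); exact: IntZ I1.
transitivity (\int[mu]_xi (fconst N ^+ 2 * \int[mu]_z F (xi, z))).
  by apply: eq_Rintegral => xi _; rewrite sE.
rewrite (RintZ _ I1) E; congr (_ * _); apply: eq_Rintegral => z _; rewrite /F/=.
rewrite (RintZ _ (gaussN_cos_Int e0 z 0)) (gaussN_cos e0) cos0 mulr1.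
by rewrite mulrC mulrA.
Qed.

Let scaled_D (k : nat) : R := \int[mu]_w (expR (- (1 * sqn w)) * D (k.+1%:R^-1 *: w)).

Let scaled_D_cvg : scaled_D k @[k --> \oo] --> 0.
Proof.
have gI := gaussN_Int (@ltr01 R) N.
have [||||_] := @Rint_dominated _ _ _ mu (fun (k : nat) w => expR (- (1 * sqn w)) * D (k.+1%:R^-1 *: w))
  (fun=> 0) (fun w => (4 * nsq mu u) * expR (- (1 * sqn w))).
- move=> k; apply: measurable_funM; first exact: measurable_gaussN.
  apply: (measurableT_comp mD).
  by have := measurable_affine k.+1%:R^-1 (0 : 'rV[R]_N); under eq_fun do rewrite addr0.
- exact: IntZ gI.
- move=> w; apply: cvg0_mul.
  apply: (translate_cvg (M := \sum_i `|w 0 i|) u2) => [i|k i].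
    under eq_fun do rewrite mxE mulrC.
    by apply: cvg0_mul; exact: cvg_harmonic.
  rewrite mxE normrM [`|_^-1|]ger0_norm; last by rewrite invr_ge0.
  apply: (@le_trans _ _ `|w 0 i|).
    by rewrite ler_piMl// invf_le1 ?ler1n.
  by rewrite (bigD1 i)//= lerDl sumr_ge0.
- move=> k w; rewrite ger0_norm; last by rewrite mulr_ge0 ?expR_ge0 ?nsq_ge0.
  by rewrite mulrC ler_wpM2r ?expR_ge0.
by rewrite Rint_cst0.
Qed.

(** The choice for which the approximate identity is a dilation of exp (- |z|^2) by
the integer k + 1. *)
Let eps (k : nat) : R := (4 * k.+1%:R ^+ 2)^-1.

Let eps0 k : 0 < eps k.
Proof. by rewrite invr_gt0 mulr_gt0// exprn_gt0// ltr0n. Qed.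

Let gauss_spec_seq k : \int[mu]_xi (expR (- (eps k * sqn xi)) * spec xi) =
  nsq mu u - fconst N ^+ 2 * Num.sqrt (4 * pi) ^+ N / 2 * scaled_D k.
Proof.
have [_ ->] := gauss_spec (eps0 k).
have k0 : 0 < k.+1%:R :> R by rewrite ltr0n.
rewrite /scaled_D /eps; move: (k.+1%:R : R) k0 => K K0 {k}.
have e0 : 0 < (4 * K ^+ 2)^-1 by rewrite invr_gt0 mulr_gt0// exprn_gt0.
have K2 : 0 < K ^+ 2 by rewrite exprn_gt0.
have gI := gaussN_Int K2 N.
pose g (z : 'rV[R]_N) := expR (- (K ^+ 2 * sqn z)).
have mgD : measurable_fun setT (fun z => g z * D z).
  by apply: measurable_funM; [exact: measurable_gaussN|exact: mD].
have gDI : Int mu (fun z => g z * D z).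
  apply: (le_Int (g := fun z => 4 * nsq mu u * g z) mgD); last exact: IntZ gI.
  move=> z; rewrite ger0_norm; last by rewrite mulr_ge0 ?expR_ge0 ?nsq_ge0.
  rewrite ger0_norm; last by rewrite !mulr_ge0 ?expR_ge0 ?nsq_ge0.
  by rewrite mulrC ler_wpM2r ?expR_ge0.
have gphi z : expR (- (sqn z / (4 * (4 * K ^+ 2)^-1))) * phi z = nsq mu u * g z - 2^-1 * (g z * D z).
  have -> : sqn z / (4 / (4 * K ^+ 2)) = K ^+ 2 * sqn z by field; rewrite gt_eqF.
  by rewrite phiE /g; ring.
pose c := Num.sqrt (pi / (4 * K ^+ 2)^-1) ^+ N.
have I1 := IntZ (nsq mu u) gI; have I2 := IntZ 2^-1 gDI.
transitivity (fconst N ^+ 2 * (c * (nsq mu u * \int[mu]_z g z - 2^-1 * \int[mu]_z (g z * D z)))).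
  congr (_ * _); rewrite -(RintZ _ gI) -(RintZ _ gDI) -(RintB I1 I2) -(RintZ _ (IntB I1 I2)).
  by apply: eq_Rintegral => z _; rewrite gphi.
have G1 : \int[mu]_z g z = Num.sqrt (pi / K ^+ 2) ^+ N.
  by apply: EFin_inj; rewrite (RintegralE gI) (gaussN_ge0 K2).
have sK (w : 'rV[R]_N) : g (K^-1 *: w) = expR (- (1 * sqn w)).
  rewrite /g /sqn !mulr_sumr; congr (expR (- _)); apply: eq_bigr => i _.
  by rewrite mxE; field; rewrite gt_eqF.
have G2 : \int[mu]_z (g z * D z) =
    K^-1 ^+ N * \int[mu]_w (expR (- (1 * sqn w)) * D (K^-1 *: w)).
  rewrite /Rintegral -(@ge0_integral_scale _ _ (fun z => (g z * D z)%:E) K^-1); last 3 first.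
  - by rewrite invr_gt0.
  - exact/measurable_EFinP.
  - by move=> z; rewrite lee_fin mulr_ge0 ?expR_ge0 ?nsq_ge0.
  have -> : (\int[mu]_w (g (K^-1 *: w) * D (K^-1 *: w))%:E)%E =
     (\int[mu]_w (expR (- (1 * sqn w)) * D (K^-1 *: w))%:E)%E.
    by apply: eq_integral => w _; rewrite sK.
  have sDI : Int mu (fun w => expR (- (1 * sqn w)) * D (K^-1 *: w)).
    apply: (le_Int (g := fun z => 4 * nsq mu u * expR (- (1 * sqn z)))); last exact: IntZ (gaussN_Int (@ltr01 R) N).
      apply: measurable_funM; first exact: measurable_gaussN.
      apply: (measurableT_comp mD).
      by have := measurable_affine K^-1 (0 : 'rV[R]_N); under eq_fun do rewrite addr0.
    move=> w; rewrite ger0_norm; last by rewrite mulr_ge0 ?expR_ge0 ?nsq_ge0.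
    rewrite ger0_norm; last by rewrite !mulr_ge0 ?expR_ge0 ?nsq_ge0.
    by rewrite mulrC ler_wpM2r ?expR_ge0.
  by rewrite -(RintegralE sDI).
rewrite G1 G2.
have p0 : 0 <= pi :> R := pi_ge0 R.
have s4 : Num.sqrt (4 * pi) = 2 * Num.sqrt pi :> R.
  by rewrite sqrtrM// (_ : 4 = 2 ^+ 2 :> R) ?sqrtr_sqr ?ger0_norm//; ring.
have cE : c = (Num.sqrt (4 * pi) * K) ^+ N.
  rewrite /c invrK mulrA (mulrC pi) sqrtrM ?mulr_ge0// sqrtr_sqr ger0_norm// ltW//.
have dE : Num.sqrt (pi / K ^+ 2) = Num.sqrt pi / K.
  by rewrite -exprVn sqrtrM// sqrtr_sqr ger0_norm// invr_ge0 ltW.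
have one : fconst N ^+ 2 * (c * Num.sqrt (pi / K ^+ 2) ^+ N) = 1.
  rewrite -[RHS](@fconst_sqr R N) cE dE -exprMn; congr (_ * _ ^+ _).
  have sq : Num.sqrt pi ^+ 2 = pi :> R by rewrite sqr_sqrtr.
  by rewrite s4 -[in RHS]sq; field; rewrite gt_eqF.
have two : c * K^-1 ^+ N = Num.sqrt (4 * pi) ^+ N.
  by rewrite cE -exprMn mulfK// gt_eqF.
rewrite mulrBr mulrBr; congr (_ - _).
  rewrite -[RHS]mulr1 -[in RHS]one; move: (fconst N ^+ 2) (nsq mu u) => *; ring.
by rewrite -two; ring.
Qed.

(** The Gaussian regularisations of the integral of the power spectrum converge to the
autocorrelation at 0, which is the squared norm of u, and monotone convergence removes
the regularisation. *)
Lemma plancherel_L1 :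
  [/\ L2 mu (trig 0 u), L2 mu (trig (pi / 2) u) &
      nsq mu (trig 0 u) + nsq mu (trig (pi / 2) u) = nsq mu u].
Proof.
have spec0 xi : 0 <= spec xi by rewrite addr_ge0 ?sqr_ge0.
have mspec : measurable_fun setT spec.
  by apply: measurable_funD; apply: measurable_funX; exact: measurable_trig.
have eps_cvg : eps k @[k --> \oo] --> 0.
  rewrite (_ : eps = fun k => (4^-1 * k.+1%:R^-1) * k.+1%:R^-1); last first.
    by apply/funext => k; rewrite /eps invfM expr2 invfM mulrA.
  by rewrite -(mulr0 (0 : R)); apply: cvgM; [apply: cvg0_mul|]; exact: cvg_harmonic.
have mspec_k k : measurable_fun setT (fun xi => (expR (- (eps k * sqn xi)) * spec xi)%:E).
  by apply/measurable_EFinP; apply: measurable_funM => //; exact: measurable_gaussN.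
have spec_int : (\int[mu]_xi (spec xi)%:E = (nsq mu u)%:E)%E.
  have lim_spec xi : (expR (- (eps k * sqn xi)) * spec xi)%:E @[k --> \oo] --> (spec xi)%:E.
    apply: EFin_cvg; rewrite -[X in _ --> X]mul1r; apply: cvgM; last exact: cvg_cst.
    rewrite -expR0; apply: continuous_cvg; first exact: continuous_expR.
    by rewrite -oppr0; apply: cvgN; under eq_fun do rewrite mulrC; exact: cvg0_mul.
  have H : (\int[mu]_xi (expR (- (eps k * sqn xi)) * spec xi)%:E)%E @[k --> \oo] -->
      (\int[mu]_xi (spec xi)%:E)%E.
    rewrite (eq_integral (fun xi => limn (fun k => (expR (- (eps k * sqn xi)) * spec xi)%:E))); last first.
      by move=> xi _; rewrite (cvg_lim _ (lim_spec xi)).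
    apply: (@cvg_monotone_convergence _ _ _ mu setT measurableT
      (fun k xi => (expR (- (eps k * sqn xi)) * spec xi)%:E)).
    - exact: mspec_k.
    - by move=> k xi _; rewrite lee_fin mulr_ge0 ?expR_ge0.
    - move=> xi _ k l kl; rewrite lee_fin ler_wpM2r// ler_expR lerN2 ler_wpM2r ?sqn_ge0//.
      rewrite /eps lef_pV2 ?posrE ?mulr_gt0 ?exprn_gt0 ?ltr0n//.
      by rewrite ler_pM2l// lerXn2r ?nnegrE// ler_nat.
  apply: (cvg_unique _ H); first exact: ereal_hausdorff.
  rewrite (_ : (fun k => _) = fun k => (nsq mu u - fconst N ^+ 2 * Num.sqrt (4 * pi) ^+ N / 2 * scaled_D k)%:E); last first.
    apply/funext => k; rewrite -gauss_spec_seq RintegralE//.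
    by have [] := gauss_spec (eps0 k).
  apply: EFin_cvg; rewrite -[X in _ --> X]subr0; apply: cvgB; first exact: cvg_cst.
  exact: cvg0_mul.
have specI : Int mu spec by apply/(ge0_IntP _ spec0); split => //; rewrite spec_int ltry.
have l2 a : (forall xi, trig a u xi ^+ 2 <= spec xi) -> L2 mu (trig a u).
  move=> h; apply/L2_sqr; split; first exact: measurable_trig.
  apply: (le_Int _ _ specI); first by apply: measurable_funX; exact: measurable_trig.
  by move=> xi; rewrite !ger0_norm ?sqr_ge0.
have t1 : L2 mu (trig 0 u) by apply: l2 => xi; rewrite lerDl sqr_ge0.
have t2 : L2 mu (trig (pi / 2) u) by apply: l2 => xi; rewrite lerDr sqr_ge0.
split => //; apply: EFin_inj; rewrite -spec_int -(RintegralE specI).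
rewrite /nsq /ip -RintD; [|exact: L2M|exact: L2M].
by congr EFin; apply: eq_Rintegral => xi _; rewrite /spec !expr2.
Qed.

End Plancherel.

(** * The Fourier transform of square-integrable functions *)

Lemma le_cvg0 (R : realType) (a : R) (b : nat -> R) :
  (forall j, a <= b j) -> b j @[j --> \oo] --> 0 -> a <= 0.
Proof.
move=> ab b0; rewrite -(cvg_lim (@norm_hausdorff _ _) b0); apply: limr_ge; first exact: cvgP b0.
exact: nearW.
Qed.

Section MeanSquare.
Context {d} {T : measurableType d} {R : realType} (mu : {measure set T -> \bar R}).
Implicit Types f g : T -> R.

Lemma nsq_lin_le f g k : L2 mu f -> L2 mu g ->
  nsq mu (fun x => f x + k * g x) <= 2 * nsq mu f + 2 * k ^+ 2 * nsq mu g.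
Proof.
move=> f2 g2; have := nsqD_le f2 (L2Z k g2); rewrite (nsqZ k g2).
by move=> h; rewrite -mulrA.
Qed.

Lemma L2cvg_lin F G f g k : (forall j, L2 mu (F j)) -> (forall j, L2 mu (G j)) ->
  L2 mu f -> L2 mu g -> L2cvg mu F f -> L2cvg mu G g ->
  L2cvg mu (fun j x => F j x + k * G j x) (fun x => f x + k * g x).
Proof.
move=> F2 G2 f2 g2 Ff Gg.
have bound := cvg0_add (cvg0_mul 2 Ff) (cvg0_mul (2 * k ^+ 2) Gg).
apply: squeeze_cvgr bound; last exact: cvg_cst.
apply: nearW => j; rewrite nsq_ge0/=.
have := nsq_lin_le k (L2B (F2 j) f2) (L2B (G2 j) g2).
apply: le_trans; rewrite le_eqVlt; apply/orP; left; apply/eqP.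
by apply: eq_Rintegral => x _; congr (_ * _); ring.
Qed.

Lemma L2cvg_le (F : nat -> T -> R) f (b : nat -> R) :
  (forall j, nsq mu (fun x => F j x - f x) <= b j) -> b j @[j --> \oo] --> 0 -> L2cvg mu F f.
Proof.
move=> Fb b0; apply: squeeze_cvgr b0; last exact: cvg_cst.
by apply: nearW => j; rewrite nsq_ge0 Fb.
Qed.

Lemma L2cvg_unique F f g : (forall j, L2 mu (F j)) -> L2 mu f -> L2 mu g ->
  L2cvg mu F f -> L2cvg mu F g -> {ae mu, forall x, f x = g x}.
Proof.
move=> F2 f2 g2 Ff Fg.
have D2 : L2 mu (fun x => f x - g x) by exact: L2B.
have : nsq mu (fun x => f x - g x) = 0.
  apply/eqP; rewrite eq_le nsq_ge0 andbT.
  apply: (le_cvg0 _ (cvg0_add (cvg0_mul 2 Ff) (cvg0_mul 2 Fg))) => j.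
  by have := nsqB_tri f2 g2 (F2 j); rewrite (nsqBC mu f (F j)).
move=> /(nsq_eq0 D2); apply: filterS => x /eqP.
by rewrite subr_eq0 => /eqP.
Qed.

Lemma nsq_mul_le (c : T -> R) f : measurable_fun setT c -> (forall x, `|c x| <= 1) ->
  L2 mu f -> L2 mu (fun x => c x * f x) /\ nsq mu (fun x => c x * f x) <= nsq mu f.
Proof.
move=> mc c1 f2; have le x : `|c x * f x| <= `|f x| by rewrite normrM ler_piMl.
have cf2 : L2 mu (fun x => c x * f x).
  by apply: (le_L2 _ le f2); apply: measurable_funM; [exact: mc|exact: L2_measurable f2].
by split; [exact: cf2|exact: le_nsq].
Qed.

End MeanSquare.

Section FourierRelation.
Context {R : realType} {N : nat}.
Notation mu := (lebRV R N).
Implicit Types u v P Q : 'rV[R]_N -> R.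

(** The transform of u is P + i Q, as a relation: it holds for every representative,
and closure properties are proved without choosing one. *)
Definition FT u P Q : Prop :=
  [/\ L2 mu u, L2 mu P, L2 mu Q & exists w : nat -> 'rV[R]_N -> R,
   [/\ forall k, Int mu (w k) /\ L2 mu (w k), L2cvg mu w u,
       L2cvg mu (fun k => trig 0 (w k)) P & L2cvg mu (fun k => trig (pi / 2) (w k)) Q]].

Lemma trig_L2 u : Int mu u -> L2 mu u -> L2 mu (trig 0 u) /\ L2 mu (trig (pi / 2) u).
Proof. by move=> u1 u2; have [] := plancherel_L1 u1 u2. Qed.

Lemma trig_lin a u v k : Int mu u -> Int mu v ->
  trig a (fun x => u x + k * v x) = (fun xi => trig a u xi + k * trig a v xi).
Proof. by move=> Iu Iv; rewrite (trigD a Iu (IntZ k Iv)) (trigZ a k Iv). Qed.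

Lemma trig_nsq_le u : Int mu u -> L2 mu u ->
  nsq mu (trig 0 u) <= nsq mu u /\ nsq mu (trig (pi / 2) u) <= nsq mu u.
Proof.
move=> u1 u2; have [_ _ <-] := plancherel_L1 u1 u2.
by split; [rewrite lerDl; exact: nsq_ge0|rewrite lerDr; exact: nsq_ge0].
Qed.

(** Truncations to cubes are integrable, and their transforms form a Cauchy sequence
by Plancherel. *)
Lemma FT_exists u : L2 mu u -> exists P, exists Q, FT u P Q.
Proof.
move=> u2; pose w (k : nat) x := u x * \1_(cube k%:R) x.
have mu_ := L2_measurable u2.
have w1 k : Int mu (w k) by exact: L2M u2 (L2_indic_box _ _).
have mw k : measurable_fun setT (w k) by exact: Int_measurable (w1 k).
have [||||w2 _ wc] := @L2_dominated _ _ _ mu w u (fun x => `|u x|).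
- exact: mw.
- by apply: (le_L2 _ _ u2) => [|x]; [exact: measurableT_comp|rewrite normr_id].
- move=> x; apply: cvg_near_cst; have [k kx] := coord_bounded x.
  exists k => // j /= kj; rewrite /w indicE mem_set ?mulr1//.
  by apply: subset_cube kx; rewrite ler_nat.
- by move=> k x; rewrite normrM ler_piMr// indicE; case: (_ \in _); rewrite ?normr1// normr0.
have t2 k := trig_L2 (w1 k) (w2 k).
have cauchy e : 0 < e -> exists K, forall k l, (K <= k)%N -> (K <= l)%N ->
    nsq mu (fun x => w k x - w l x) <= e by exact: (L2cvg_cauchy w2 u2 wc).
have bound k l : nsq mu (fun x => trig 0 (w k) x - trig 0 (w l) x) <= nsq mu (fun x => w k x - w l x) /\
    nsq mu (fun x => trig (pi / 2) (w k) x - trig (pi / 2) (w l) x) <= nsq mu (fun x => w k x - w l x).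
  have := trig_nsq_le (IntB (w1 k) (w1 l)) (L2B (w2 k) (w2 l)).
  have E a : trig a (fun x => w k x - w l x) = fun x => trig a (w k) x - trig a (w l) x.
    rewrite -[RHS](_ : (fun x => trig a (w k) x + -1 * trig a (w l) x) = _); last first.
      by apply/funext => x; rewrite mulN1r.
    by rewrite -trig_lin//; congr trig; apply/funext => x; rewrite mulN1r.
  by rewrite !E.
have [||P P2 Pc] := @L2_complete _ _ _ mu (fun k => trig 0 (w k)).
- by move=> k; have [] := t2 k.
- move=> e /cauchy[K HK]; exists K => k l kK lK.
  by apply: le_trans (HK k l kK lK); have [] := bound k l.
have [||Q Q2 Qc] := @L2_complete _ _ _ mu (fun k => trig (pi / 2) (w k)).
- by move=> k; have [] := t2 k.
- move=> e /cauchy[K HK]; exists K => k l kK lK.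
  by apply: le_trans (HK k l kK lK); have [] := bound k l.
by exists P, Q; split => //; exists w; split.
Qed.

Lemma FT_lin u v P Q P' Q' k : FT u P Q -> FT v P' Q' ->
  FT (fun x => u x + k * v x) (fun x => P x + k * P' x) (fun x => Q x + k * Q' x).
Proof.
move=> [u2 P2 Q2 [w [w12 wu wP wQ]]] [v2 P'2 Q'2 [z [z12 zv zP zQ]]].
have w1 j := (w12 j).1; have w2 j := (w12 j).2.
have z1 j := (z12 j).1; have z2 j := (z12 j).2.
have tw j := trig_L2 (w1 j) (w2 j); have tz j := trig_L2 (z1 j) (z2 j).
split; [exact: L2D u2 (L2Z k v2)|exact: L2D P2 (L2Z k P'2)|exact: L2D Q2 (L2Z k Q'2)|].
exists (fun j x => w j x + k * z j x); split.
- by move=> j; split; [exact: IntD (w1 j) (IntZ k (z1 j))|exact: L2D (w2 j) (L2Z k (z2 j))].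
- exact: (L2cvg_lin k w2 z2 u2 v2 wu zv).
- rewrite (_ : (fun j => _) = fun j x => trig 0 (w j) x + k * trig 0 (z j) x); last first.
    by apply/funext => j; rewrite trig_lin.
  exact: (L2cvg_lin k (fun j => (tw j).1) (fun j => (tz j).1) P2 P'2 wP zP).
- rewrite (_ : (fun j => _) = fun j x => trig (pi / 2) (w j) x + k * trig (pi / 2) (z j) x); last first.
    by apply/funext => j; rewrite trig_lin.
  exact: (L2cvg_lin k (fun j => (tw j).2) (fun j => (tz j).2) Q2 Q'2 wQ zQ).
Qed.

Lemma FT_isometry u P Q : FT u P Q -> nsq mu P + nsq mu Q = nsq mu u.
Proof.
move=> [u2 P2 Q2 [w [w12 wu wP wQ]]].
have w1 j := (w12 j).1; have w2 j := (w12 j).2.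
have tw j := trig_L2 (w1 j) (w2 j).
have cu := nsq_cvg w2 u2 wu.
have cP := nsq_cvg (fun j => (tw j).1) P2 wP; have cQ := nsq_cvg (fun j => (tw j).2) Q2 wQ.
have cPQ := cvgD cP cQ.
apply: (cvg_unique _ (cPQ _)); first exact: norm_hausdorff.
rewrite (_ : _ + _ = fun k => nsq mu (w k))//; apply/funext => k.
by have [_ _ <-] := plancherel_L1 (w1 k) (w2 k).
Qed.

(** Polarisation of [FT_isometry]. *)
Lemma FT_ip u v P Q P' Q' : FT u P Q -> FT v P' Q' ->
  ip mu P P' + ip mu Q Q' = ip mu u v.
Proof.
move=> U V; have := FT_isometry (FT_lin 1 U V); have := FT_isometry U; have := FT_isometry V.
have [u2 P2 Q2 _] := U; have [v2 P'2 Q'2 _] := V.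
have E f g : L2 mu f -> L2 mu g -> nsq mu (fun x => f x + 1 * g x) = nsq mu f + 2 * ip mu f g + nsq mu g.
  move=> f2 g2; rewrite -nsqD//; apply: eq_Rintegral => x _; by rewrite mul1r.
by rewrite !E// => *; lra.
Qed.

Lemma FT_unique u P Q P' Q' : FT u P Q -> FT u P' Q' ->
  {ae mu, forall x, P x = P' x} /\ {ae mu, forall x, Q x = Q' x}.
Proof.
move=> U V; have := FT_isometry (FT_lin (-1) U V).
have [u2 P2 Q2 _] := U; have [v2 P'2 Q'2 _] := V.
have -> : nsq mu (fun x => u x + -1 * u x) = 0.
  rewrite -[RHS](Rint_cst0 mu); apply: eq_Rintegral => x _.
  by rewrite mulN1r subrr mul0r.
move=> /eqP; rewrite paddr_eq0 ?nsq_ge0// => /andP[/eqP h1 /eqP h2].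
have D1 : L2 mu (fun x => P x + -1 * P' x) by apply: L2D => //; exact: L2Z.
have D2 : L2 mu (fun x => Q x + -1 * Q' x) by apply: L2D => //; exact: L2Z.
split.
  have := nsq_eq0 D1 h1; apply: filterS => x; rewrite mulN1r => /eqP.
  by rewrite subr_eq0 => /eqP.
have := nsq_eq0 D2 h2; apply: filterS => x; rewrite mulN1r => /eqP.
by rewrite subr_eq0 => /eqP.
Qed.

Lemma L2cvg_ae (F : nat -> 'rV[R]_N -> R) f g : (forall k, L2 mu (F k)) -> L2 mu f ->
  measurable_fun setT g -> {ae mu, forall x, g x = f x} -> L2cvg mu F f -> L2cvg mu F g.
Proof.
move=> F2 f2 mg gf; rewrite /L2cvg.
suff -> : (fun k => nsq mu (fun x => F k x - f x)) = (fun k => nsq mu (fun x => F k x - g x)) by [].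
apply/funext => k; have mF := L2_measurable (F2 k); have mf := L2_measurable f2.
apply: ae_eq_nsq; [exact: measurable_funB|exact: measurable_funB|].
by apply: filterS gf => x ->.
Qed.

Lemma FT_ae u P Q u' P' Q' : FT u P Q ->
  measurable_fun setT u' -> measurable_fun setT P' -> measurable_fun setT Q' ->
  {ae mu, forall x, u' x = u x} -> {ae mu, forall x, P' x = P x} ->
  {ae mu, forall x, Q' x = Q x} -> FT u' P' Q'.
Proof.
move=> [u2 P2 Q2 [w [w12 wu wP wQ]]] mu' mP' mQ' uu' PP' QQ'.
have w1 j := (w12 j).1; have w2 j := (w12 j).2.
have tw j := trig_L2 (w1 j) (w2 j).
split; try by [exact: ae_eq_L2 uu' u2|exact: ae_eq_L2 PP' P2|exact: ae_eq_L2 QQ' Q2].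
exists w; split => //.
- exact: L2cvg_ae w2 u2 mu' uu' wu.
- exact: L2cvg_ae (fun j => (tw j).1) P2 mP' PP' wP.
- exact: L2cvg_ae (fun j => (tw j).2) Q2 mQ' QQ' wQ.
Qed.

(** The transforms also converge to some transform of u, by isometry, and limits in
mean square agree almost everywhere. *)
Lemma FT_closed (U P_ Q_ : nat -> 'rV[R]_N -> R) u P Q : (forall k : nat, FT (U k) (P_ k) (Q_ k)) ->
  L2 mu u -> L2 mu P -> L2 mu Q ->
  L2cvg mu U u -> L2cvg mu P_ P -> L2cvg mu Q_ Q -> FT u P Q.
Proof.
move=> UFT u2 P2 Q2 Uu PP QQ; have [P' [Q' uFT]] := FT_exists u2.
have [_ P'2 Q'2 _] := uFT.
have Pk2 k : L2 mu (P_ k) by have [] := UFT k.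
have Qk2 k : L2 mu (Q_ k) by have [] := UFT k.
have E k := FT_isometry (FT_lin (-1) (UFT k) uFT).
have nE (f g : 'rV[R]_N -> R) : nsq mu (fun x => f x + -1 * g x) = nsq mu (fun x => f x - g x).
  by apply: eq_Rintegral => x _; rewrite mulN1r.
have cP : L2cvg mu P_ P'.
  by apply: (L2cvg_le _ Uu) => k; rewrite -!nE -E lerDl nsq_ge0.
have cQ : L2cvg mu Q_ Q'.
  by apply: (L2cvg_le _ Uu) => k; rewrite -!nE -E lerDr nsq_ge0.
apply: (FT_ae uFT (L2_measurable u2) (L2_measurable P2) (L2_measurable Q2)).
- exact: aeW.
- exact: L2cvg_unique Pk2 P2 P'2 PP cP.
- exact: L2cvg_unique Qk2 Q2 Q'2 QQ cQ.
Qed.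

Lemma measurable_cos_dot (h : 'rV[R]_N) : measurable_fun setT (fun xi => cos (dotrv h xi)).
Proof. by have := measurable_cos_dotrv h 0; under eq_fun do rewrite addr0. Qed.

Lemma measurable_sin_dot (h : 'rV[R]_N) : measurable_fun setT (fun xi => sin (dotrv h xi)).
Proof.
have := measurable_funN (measurable_cos_dotrv h (pi / 2)).
by congr measurable_fun; apply/funext => xi; rewrite /= cosDpihalf opprK.
Qed.

Lemma sin_abs_le1 (t : R) : `|sin t| <= 1.
Proof. by rewrite ler_norml sin_le1 sin_geN1. Qed.

Lemma L2cvg_rotate (F G : nat -> 'rV[R]_N -> R) f g (c s : 'rV[R]_N -> R) :
  measurable_fun setT c -> measurable_fun setT s ->
  (forall x, `|c x| <= 1) -> (forall x, `|s x| <= 1) ->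
  (forall j, L2 mu (F j)) -> (forall j, L2 mu (G j)) -> L2 mu f -> L2 mu g ->
  L2cvg mu F f -> L2cvg mu G g ->
  L2cvg mu (fun j x => c x * F j x + s x * G j x) (fun x => c x * f x + s x * g x).
Proof.
move=> mc ms c1 s1 F2 G2 f2 g2 Ff Gg.
apply: (L2cvg_le _ (cvg0_add (cvg0_mul 2 Ff) (cvg0_mul 2 Gg))) => j.
have [A1 A2] := nsq_mul_le mc c1 (L2B (F2 j) f2).
have [B1 B2] := nsq_mul_le ms s1 (L2B (G2 j) g2).
apply: (@le_trans _ _ (2 * nsq mu (fun x => c x * (F j x - f x)) + 2 * nsq mu (fun x => s x * (G j x - g x)))); last first.
  by apply: lerD; rewrite ler_pM2l.
apply: le_trans (nsqD_le A1 B1); rewrite le_eqVlt; apply/orP; left; apply/eqP.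
by apply: eq_Rintegral => x _; congr (_ * _); ring.
Qed.

Lemma L2_rotate f g (c s : 'rV[R]_N -> R) : measurable_fun setT c -> measurable_fun setT s ->
  (forall x, `|c x| <= 1) -> (forall x, `|s x| <= 1) -> L2 mu f -> L2 mu g ->
  L2 mu (fun x => c x * f x + s x * g x).
Proof.
move=> mc ms c1 s1 f2 g2; apply: L2D.
  by have [] := nsq_mul_le mc c1 f2.
by have [] := nsq_mul_le ms s1 g2.
Qed.

(** The rotation by the angle h . xi is multiplication by exp (i h . xi). *)
Lemma FT_translate u P Q h : FT u P Q -> FT (fun x => u (x + h))
  (fun xi => cos (dotrv h xi) * P xi + - sin (dotrv h xi) * Q xi)
  (fun xi => sin (dotrv h xi) * P xi + cos (dotrv h xi) * Q xi).
Proof.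
move=> [u2 P2 Q2 [w [w12 wu wP wQ]]].
have w1 j := (w12 j).1; have w2 j := (w12 j).2.
have tw j := trig_L2 (w1 j) (w2 j).
have mc := measurable_cos_dot h; have ms := measurable_sin_dot h.
have msN : measurable_fun setT (fun xi => - sin (dotrv h xi)) by exact: measurable_funN.
have c1 xi : `|cos (dotrv h xi)| <= 1 by exact: cos_abs_le1.
have s1 xi : `|sin (dotrv h xi)| <= 1 by exact: sin_abs_le1.
have sN1 xi : `|- sin (dotrv h xi)| <= 1 by rewrite normrN.
split; [exact: L2_translate|exact: L2_rotate mc msN c1 sN1 P2 Q2|exact: L2_rotate ms mc s1 c1 P2 Q2|].
exists (fun j x => w j (x + h)); split.
- by move=> j; split; [exact: Int_translate|exact: L2_translate].
- rewrite /L2cvg (_ : (fun k => _) = fun k => nsq mu (fun x => w k x - u x))//.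
  apply/funext => k; rewrite -(nsq_translate (f := fun x => w k x - u x) h)//.
  by apply: L2_measurable; exact: L2B.
- rewrite (_ : (fun j => _) = fun j xi => cos (dotrv h xi) * trig 0 (w j) xi + - sin (dotrv h xi) * trig (pi / 2) (w j) xi); last first.
    by apply/funext => j; apply/funext => xi; rewrite trig_translate// add0r mulNr.
  exact: (L2cvg_rotate mc msN c1 sN1 (fun j => (tw j).1) (fun j => (tw j).2) P2 Q2 wP wQ).
- rewrite (_ : (fun j => _) = fun j xi => sin (dotrv h xi) * trig 0 (w j) xi + cos (dotrv h xi) * trig (pi / 2) (w j) xi); last first.
    apply/funext => j; apply/funext => xi; rewrite trig_translate// addrC; congr (_ + _).
    rewrite -mulrN; congr (_ * _); rewrite /trig -mulrN -RintN; last exact: cos_Int.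
    congr (_ * _); apply: eq_Rintegral => x _.
    by rewrite addr0 addrA !cosDpihalf sinDpihalf mulNr opprK.
  exact: (L2cvg_rotate ms mc s1 c1 (fun j => (tw j).1) (fun j => (tw j).2) P2 Q2 wP wQ).
Qed.

Lemma nsq_opp f : measurable_fun setT f -> nsq mu (fun x => f (- x)) = nsq mu f.
Proof.
move=> mf; rewrite /nsq /ip /Rintegral (@integral_oppRV _ _ (fun x => (f x * f x)%:E))//.
by apply/measurable_EFinP; exact: measurable_funM.
Qed.

Lemma measurable_opp f : measurable_fun setT f -> measurable_fun setT (fun x : 'rV[R]_N => f (- x) : R).
Proof. by move=> mf; apply: (measurableT_comp mf); exact: measurable_oppRV. Qed.

Lemma L2_opp f : L2 mu f -> L2 mu (fun x => f (- x)).
Proof.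
move=> [mf f2]; split; first exact: measurable_opp.
rewrite (@integral_oppRV _ _ (fun x => (f x ^+ 2)%:E))//.
by apply/measurable_EFinP; exact: measurable_funX.
Qed.

Lemma L2cvg_opp (F : nat -> 'rV[R]_N -> R) f : (forall j, L2 mu (F j)) -> L2 mu f ->
  L2cvg mu F f -> L2cvg mu (fun j x => F j (- x)) (fun x => f (- x)).
Proof.
move=> F2 f2; rewrite /L2cvg.
suff -> : (fun k => nsq mu (fun x => F k x - f x)) = (fun k => nsq mu (fun x => F k (- x) - f (- x))) by [].
apply/funext => k; rewrite -(nsq_opp (f := fun x => F k x - f x))//.
by apply: L2_measurable; exact: L2B.
Qed.

(** For integrable functions this is the parity of cosine and sine; reflection
preserves limits in mean square, and transforms are unique. *)
Lemma FT_hermitian u P Q : FT u P Q ->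
  {ae mu, forall xi, P (- xi) = P xi} /\ {ae mu, forall xi, Q (- xi) = - Q xi}.
Proof.
move=> U; have [u2 P2 Q2 [w [w12 wu wP wQ]]] := U.
have w1 j := (w12 j).1; have w2 j := (w12 j).2.
have tw j := trig_L2 (w1 j) (w2 j).
suff V : FT u (fun xi => P (- xi)) (fun xi => -1 * Q (- xi)).
  have [h1 h2] := FT_unique V U; split => //.
  by apply: filterS h2 => xi <-; rewrite mulN1r opprK.
have Po2 := L2_opp P2; have Qo2 := L2_opp Q2.
split => //; first exact: L2Z.
exists w; split => //.
- have H := L2cvg_opp (fun j => (tw j).1) P2 wP.
  apply: (L2cvg_le _ H) => j; rewrite le_eqVlt; apply/orP; left; apply/eqP.
  by apply: eq_Rintegral => xi _; rewrite trig_opp oppr0.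
- have H := L2cvg_opp (fun j => (tw j).2) Q2 wQ.
  apply: (L2cvg_le _ H) => j; rewrite le_eqVlt; apply/orP; left; apply/eqP.
  apply: eq_Rintegral => xi _.
  have -> : trig (pi / 2) (w j) xi = - trig (pi / 2) (w j) (- xi); last by ring.
  rewrite trig_opp /trig -mulrN -RintN; last exact: cos_Int.
  congr (_ * _); apply: eq_Rintegral => x _.
  by rewrite -mulNr cosDpihalf cosBpihalf.
Qed.

End FourierRelation.

(** * Difference operators on the Fourier side *)

Section FourierTransform.
Context {R : realType} {N : nat}.
Notation mu := (lebRV R N).
Implicit Types u v P Q : 'rV[R]_N -> R.
Local Open Scope complex_scope.

Lemma fourierL1E u xi : fourierL1 u xi = trig 0 u xi +i* trig (pi / 2) u xi.
Proof.
rewrite /fourierL1 /cintegral; apply/eqP; rewrite eq_complex /= mul0r subr0 mul0r addr0.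
rewrite /trig /fconst; apply/andP; split; apply/eqP; congr (_ * _); apply: eq_Rintegral => x _.
  by rewrite mulr0 subr0 cosN addr0.
by rewrite mulr0 add0r sinN cosDpihalf.
Qed.

Lemma is_fourierL2P u (U : 'rV[R]_N -> R[i]) : L2 mu u ->
  is_fourierL2 u U <-> FT u (fun xi => complex.Re (U xi)) (fun xi => complex.Im (U xi)).
Proof.
move=> u2; set P := fun xi => complex.Re _; set Q := fun xi => complex.Im _.
have sqE w xi : sqrnormc (fourierL1 w xi - U xi) = (trig 0 w xi - P xi) ^+ 2 + (trig (pi / 2) w xi - Q xi) ^+ 2.
  by rewrite fourierL1E /sqrnormc /P /Q; case: (U xi).
split.
- move=> [mP mQ [w [w12 wu wU]]].
  have w1 k : Int mu (w k).
    have [/Lfun1_integrable h _] := w12 k; exact: h.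
  have w2 k : L2 mu (w k) by have [_ /L2P] := w12 k.
  have tw k := trig_L2 (w1 k) (w2 k).
  have m1 k : measurable_fun setT (fun xi => (trig 0 (w k) xi - P xi) ^+ 2).
    by apply: measurable_funX; apply: measurable_funB => //; have [/L2_measurable] := tw k.
  have m2 k : measurable_fun setT (fun xi => (trig (pi / 2) (w k) xi - Q xi) ^+ 2).
    by apply: measurable_funX; apply: measurable_funB => //; have [_ /L2_measurable] := tw k.
  have wU' : (\int[mu]_xi ((trig 0 (w k) xi - P xi) ^+ 2 + (trig (pi / 2) (w k) xi - Q xi) ^+ 2)%:E)%E
      @[k --> \oo] --> 0%E.
    have E k : (\int[mu]_xi ((trig 0 (w k) xi - P xi) ^+ 2 + (trig (pi / 2) (w k) xi - Q xi) ^+ 2)%:E =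
        \int[mu]_xi (sqrnormc (fourierL1 (w k) xi - U xi))%:E)%E.
      by apply: eq_integral => xi _; rewrite sqE.
    by rewrite (funext E); exact: wU.
  have near_fin : \forall k \near \oo, (\int[mu]_xi ((trig 0 (w k) xi - P xi) ^+ 2 + (trig (pi / 2) (w k) xi - Q xi) ^+ 2)%:E < +oo)%E.
    have [h _] := (fine_cvgP _ _).1 wU'; apply: filterS h => k.
    by rewrite fin_numElt => /andP[].
  have [K _ HK] := near_fin.
  have D2 k : (K <= k)%N -> L2 mu (fun xi => trig 0 (w k) xi - P xi) /\ L2 mu (fun xi => trig (pi / 2) (w k) xi - Q xi).
    move=> /HK lt; split; (split; last first).
    - apply: le_lt_trans lt; apply: ge0_le_integral => //.
      + by move=> x _; rewrite lee_fin sqr_ge0.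
      + exact/measurable_EFinP.
      + by apply/measurable_EFinP; exact: measurable_funD.
      + by move=> x _; rewrite lee_fin lerDl sqr_ge0.
    - by apply: measurable_funB => //; have [/L2_measurable] := tw k.
    - apply: le_lt_trans lt; apply: ge0_le_integral => //.
      + by move=> x _; rewrite lee_fin sqr_ge0.
      + exact/measurable_EFinP.
      + by apply/measurable_EFinP; exact: measurable_funD.
      + by move=> x _; rewrite lee_fin lerDr sqr_ge0.
    - by apply: measurable_funB => //; have [_ /L2_measurable] := tw k.
  have P2 : L2 mu P.
    have := L2B (tw K).1 (D2 K (leqnn K)).1; congr L2; apply/funext => x; ring.
  have Q2 : L2 mu Q.
    have := L2B (tw K).2 (D2 K (leqnn K)).2; congr L2; apply/funext => x; ring.
  have sumE k : (\int[mu]_xi ((trig 0 (w k) xi - P xi) ^+ 2 + (trig (pi / 2) (w k) xi - Q xi) ^+ 2)%:E)%E =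
     (nsq mu (fun xi => trig 0 (w k) xi - P xi) + nsq mu (fun xi => trig (pi / 2) (w k) xi - Q xi))%:E.
    have A := L2B (tw k).1 P2; have B := L2B (tw k).2 Q2.
    rewrite -RintegralE; last by apply: IntD; [exact: ((L2_sqr mu _).1 A).2|exact: ((L2_sqr mu _).1 B).2].
    congr EFin; rewrite RintD; [|exact: ((L2_sqr mu _).1 A).2|exact: ((L2_sqr mu _).1 B).2].
    by congr (_ + _); apply: eq_Rintegral => xi _; rewrite expr2.
  have c0 : nsq mu (fun xi => trig 0 (w k) xi - P xi) + nsq mu (fun xi => trig (pi / 2) (w k) xi - Q xi) @[k --> \oo] --> 0.
    by move: wU'; rewrite (funext sumE); move/fine_cvg.
  split => //; exists w; split.
  + by move=> k; split.
  + move: wu; rewrite (_ : (fun k => _) = fun k => (nsq mu (fun x => w k x - u x))%:E); last first.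
      by apply/funext => k; rewrite -nsqE//; exact: L2B.
    by move/fine_cvg.
  + by apply: (L2cvg_le _ c0) => k; rewrite lerDl nsq_ge0.
  + by apply: (L2cvg_le _ c0) => k; rewrite lerDr nsq_ge0.
- move=> [_ P2 Q2 [w [w12 wu wP wQ]]].
  have w1 k := (w12 k).1; have w2 k := (w12 k).2.
  have tw k := trig_L2 (w1 k) (w2 k).
  split; [exact: L2_measurable P2|exact: L2_measurable Q2|exists w; split].
  + by move=> k; split; [exact: (Lfun1_integrable (lebesgue_rV R N) (w k)).2 (w1 k)|exact: (L2P (lebesgue_rV R N) (w k)).2 (w2 k)].
  + rewrite (_ : (fun k => _) = fun k => (nsq mu (fun x => w k x - u x))%:E); last first.
      by apply/funext => k; rewrite -nsqE//; exact: L2B.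
    exact: EFin_cvg.
  + rewrite (_ : (fun k => _) = fun k => (nsq mu (fun xi => trig 0 (w k) xi - P xi) + nsq mu (fun xi => trig (pi / 2) (w k) xi - Q xi))%:E).
      by apply: EFin_cvg; exact: cvg0_add.
    apply/funext => k; have A := L2B (tw k).1 P2; have B := L2B (tw k).2 Q2.
    transitivity ((\int[mu]_xi ((trig 0 (w k) xi - P xi) ^+ 2 + (trig (pi / 2) (w k) xi - Q xi) ^+ 2)%:E)%E).
      by apply: eq_integral => xi _; rewrite sqE.
    rewrite -RintegralE; last by apply: IntD; [exact: ((L2_sqr mu _).1 A).2|exact: ((L2_sqr mu _).1 B).2].
    congr EFin; rewrite RintD; [|exact: ((L2_sqr mu _).1 A).2|exact: ((L2_sqr mu _).1 B).2].
    by congr (_ + _); apply: eq_Rintegral => xi _; rewrite expr2.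
Qed.

Lemma fourier_FT u : L2 mu u ->
  FT u (fun xi => complex.Re (fourier u xi)) (fun xi => complex.Im (fourier u xi)).
Proof.
move=> u2; apply/is_fourierL2P => //; apply: (xgetPex (fun=> 0) (P := [set U | is_fourierL2 u U])).
have [P [Q uFT]] := FT_exists u2; exists (fun xi => P xi +i* Q xi) => /=.
exact/is_fourierL2P.
Qed.

End FourierTransform.

Section SymmetricDifferences.
Context {R : realType} {N : nat}.
Notation mu := (lebRV R N).
Implicit Types u v P Q : 'rV[R]_N -> R.

Lemma FT_zero : FT (fun=> 0 : R) (fun=> 0) (fun=> 0 : R) (N := N).
Proof.
have [P [Q U]] := FT_exists (L2_0 mu); have := FT_lin (-1) U U.
have E f : (fun x : 'rV[R]_N => f x + -1 * f x) = fun=> 0 :> R.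
  by apply/funext => x; rewrite mulN1r subrr.
by rewrite !E.
Qed.

Lemma FT_sum (I : Type) (r : seq I) (c : I -> R) (u P Q : I -> 'rV[R]_N -> R) :
  (forall i, FT (u i) (P i) (Q i)) ->
  FT (fun x => \sum_(i <- r) c i * u i x) (fun x => \sum_(i <- r) c i * P i x)
     (fun x => \sum_(i <- r) c i * Q i x).
Proof.
move=> H; elim: r => [|i r IH].
  have E (f : I -> 'rV[R]_N -> R) : (fun x => \sum_(i <- [::]) c i * f i x) = fun=> 0.
    by apply/funext => x; rewrite big_nil.
  by rewrite !E; exact: FT_zero.
have := FT_lin (c i) IH (H i).
have E (f : I -> 'rV[R]_N -> R) : (fun x => \sum_(i <- i :: r) c i * f i x) =
    fun x => \sum_(i <- r) c i * f i x + c i * f i x.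
  by apply/funext => x; rewrite big_cons addrC.
by rewrite !E.
Qed.

(** The multiplier is the sum of the weights times waves of frequencies - m, ..., m;
its imaginary part vanishes by symmetry. *)
Lemma FT_delta u P Q (m : nat) (y : 'rV[R]_N) : FT u P Q ->
  FT (fun x => delta m u x y) (fun xi => dsym m (dotrv y xi) * P xi)
     (fun xi => dsym m (dotrv y xi) * Q xi).
Proof.
move=> U; pose z (j : nat) : R := (j%:Z - m%:Z)%:~R.
have := FT_sum (index_iota 0 (2 * m).+1) (dcoef m) (fun j => FT_translate (z j *: y) U).
have c0 xi : \sum_(0 <= j < (2 * m).+1) dcoef m j * cos (z j * dotrv y xi) = dsym m (dotrv y xi).
  have := sum_dcoef_cos m (dotrv y xi) 0; rewrite cos0 mulr1 => <-.
  by apply: eq_bigr => j _; rewrite addr0.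
have s0 xi : \sum_(0 <= j < (2 * m).+1) dcoef m j * sin (z j * dotrv y xi) = 0.
  have := sum_dcoef_cos m (dotrv y xi) (pi / 2); rewrite cos_pihalf mulr0.
  under eq_bigr do rewrite cosDpihalf mulrN.
  by rewrite sumrN => /eqP; rewrite oppr_eq0 => /eqP.
congr FT; apply/funext => xi.
- apply: eq_bigr => j _; rewrite /dcoef; congr (_ * u (_ + _)).
  by rewrite /z scaler_int.
- transitivity ((\sum_(0 <= j < (2 * m).+1) dcoef m j * cos (z j * dotrv y xi)) * P xi -
    (\sum_(0 <= j < (2 * m).+1) dcoef m j * sin (z j * dotrv y xi)) * Q xi).
    by rewrite !mulr_suml -sumrB; apply: eq_bigr => j _; rewrite dotrvZl; ring.
  by rewrite c0 s0 mul0r subr0.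
- transitivity ((\sum_(0 <= j < (2 * m).+1) dcoef m j * sin (z j * dotrv y xi)) * P xi +
    (\sum_(0 <= j < (2 * m).+1) dcoef m j * cos (z j * dotrv y xi)) * Q xi).
    by rewrite !mulr_suml -big_split; apply: eq_bigr => j _; rewrite dotrvZl/=; ring.
  by rewrite c0 s0 mul0r add0r.
Qed.

Lemma dsym_le m (t : R) : dsym m t <= 4 ^+ m.
Proof.
have h1 := cos_geN1 t; have h2 := cos_le1 t.
by rewrite /dsym lerXn2r ?nnegrE//; lra.
Qed.

Lemma dsymW_Int m (y : 'rV[R]_N) W : Int mu W -> Int mu (fun xi => dsym m (dotrv y xi) * W xi).
Proof.
move=> IW; apply: (le_Int (g := fun xi => 4 ^+ m * W xi)); last exact: IntZ.
  apply: measurable_funM; last exact: Int_measurable IW.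
  by apply: (measurableT_comp (measurable_dsym m)); exact: measurable_dotrv.
move=> xi; rewrite !normrM ler_wpM2r// !ger0_norm ?dsym_ge0 ?exprn_ge0//.
exact: dsym_le.
Qed.

(** The real part of (P + i Q) times the conjugate of P' + i Q'. *)
Definition cross P Q P' Q' (xi : 'rV[R]_N) : R := P xi * P' xi + Q xi * Q' xi.

Lemma cross_Int P Q P' Q' : L2 mu P -> L2 mu Q -> L2 mu P' -> L2 mu Q' ->
  Int mu (cross P Q P' Q').
Proof. by move=> *; apply: IntD; exact: L2M. Qed.

Lemma ip_delta u v P Q P' Q' (m k : nat) (y : 'rV[R]_N) : FT u P Q -> FT v P' Q' ->
  \int[mu]_x (delta m u x y * delta k v x y) =
  \int[mu]_xi (dsym (m + k) (dotrv y xi) * cross P Q P' Q' xi).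
Proof.
move=> U V; have Ud := FT_delta m y U; have Vd := FT_delta k y V.
have := FT_ip Ud Vd; rewrite /ip => <-.
have [_ u1 u2 _] := Ud; have [_ v1 v2 _] := Vd.
rewrite -RintD; [|exact: L2M|exact: L2M].
by apply: eq_Rintegral => xi _; rewrite -dsymM /cross; ring.
Qed.

End SymmetricDifferences.

Section SpectralForm.
Context {R : realType} {N : nat}.
Notation mu := (lebRV R N).
Variables (n : nat) (s : R).
Hypotheses (N0 : (0 < N)%N) (s0 : 0 < s) (sn : s < n%:R).

Let p : R := N%:R + 2 * s.

Let kernel_Int (xi : 'rV[R]_N) : Int mu (fun y => dsym n (dotrv xi y) / enorm y `^ p).
Proof.
apply/ge0_IntP => [y|]; first by rewrite divr_ge0 ?dsym_ge0 ?powR_ge0.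
split; last by rewrite int_dsym_radial// ltry.
apply: measurable_funM.
  by apply: (measurableT_comp (measurable_dsym n)); exact: measurable_dotrv.
exact: measurable_enormX_inv.
Qed.

(** After Fubini the inner integral is the one that defines the normalising constant.
The same computation for the absolute value of W justifies the exchange. *)
Lemma spectral_form (W : 'rV[R]_N -> R) : Int mu W -> Int mu (fun xi => enorm xi `^ (2 * s) * W xi) ->
  Int mu (fun y => (\int[mu]_xi (dsym n (dotrv y xi) * W xi)) / enorm y `^ p) /\
  cNms N n s / 2 * \int[mu]_y ((\int[mu]_xi (dsym n (dotrv y xi) * W xi)) / enorm y `^ p) =
  \int[mu]_xi (enorm xi `^ (2 * s) * W xi).
Proof.
move=> IW IsW; have mW := Int_measurable IW.
pose F (z : 'rV[R]_N * 'rV[R]_N) := W z.1 * (dsym n (dotrv z.1 z.2) / enorm z.2 `^ p).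
have mk := @measurable_enormX_inv R N p.
have mF : measurable_fun setT F.
  apply: measurable_funM; first exact: (measurable_comp_fst mW).
  apply: measurable_funM; last exact: (measurable_comp_snd mk).
  by apply: (measurableT_comp (measurable_dsym n)); exact: measurable_dotrv2.
have kE xi : \int[mu]_y (dsym n (dotrv xi y) / enorm y `^ p) = radial_const N n s * enorm xi `^ (2 * s).
  by apply: EFin_inj; rewrite (RintegralE (kernel_Int xi)) int_dsym_radial.
have c0 : 0 <= radial_const N n s.
  pose e : 'rV[R]_N := delta_mx 0 (Ordinal N0).
  have e1 : sqn e = 1.
    rewrite /sqn (bigD1 (Ordinal N0))//= big1 => [|i ii]; rewrite !mxE !eqxx/= ?expr1n ?addr0//.
    by rewrite (negbTE ii) expr0n.
  have := kE e; rewrite enorm_powR e1 powR1 mulr1 => <-.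
  by apply: Rint_ge0 => y; rewrite divr_ge0 ?dsym_ge0 ?powR_ge0.
have [|I1 I2 E] := @Rfubini _ _ _ _ _ mu mu F mF.
  apply: (fubini_dom (g := fun xi => radial_const N n s * `|enorm xi `^ (2 * s) * W xi|)) => //; last first.
    by apply: IntZ; exact: Int_abs.
  move=> xi; rewrite normrM (ger0_norm (powR_ge0 _ _)) mulrA -kE mulrC EFinM (RintegralE (kernel_Int xi)).
  rewrite -ge0_integralZl//; last 2 first.
  - exact: measurable_int (kernel_Int xi).
  - by move=> y _; rewrite lee_fin divr_ge0 ?dsym_ge0 ?powR_ge0.
  apply: ge0_le_integral.
  - exact: measurableT.
  - by move=> y _; rewrite lee_fin.
  - apply/measurable_EFinP; apply: measurableT_comp => //.
    exact: (measurableT_comp mF (pair1_measurable xi)).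
  - by apply: emeasurable_funM; [exact: measurable_cst|exact: measurable_int (kernel_Int xi)].
  - move=> y _; rewrite -EFinM lee_fin /F/= normrM [X in _ * X]ger0_norm//.
    by rewrite divr_ge0 ?dsym_ge0 ?powR_ge0.
have innerE y : \int[mu]_xi F (xi, y) = (\int[mu]_xi (dsym n (dotrv y xi) * W xi)) / enorm y `^ p.
  rewrite mulrC -RintZ; last exact: dsymW_Int.
  by apply: eq_Rintegral => xi _; rewrite /F/= dotrvC; ring.
rewrite -(funext innerE); split; first exact: I2.
rewrite -E; transitivity (cNms N n s / 2 * \int[mu]_xi (radial_const N n s * (enorm xi `^ (2 * s) * W xi))).
  congr (_ * _); apply: eq_Rintegral => xi _.
  by rewrite /F/= (RintZ _ (kernel_Int xi)) kE; ring.
by rewrite (RintZ _ IsW) mulrA (cNms_radial_const s0 sn N0) mul1r.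
Qed.

End SpectralForm.

(** * The energies on the Fourier side *)

Section SpectralForms.
Context {R : realType} {N : nat}.
Notation mu := (lebRV R N).
Implicit Types u v P Q : 'rV[R]_N -> R.
Hypothesis N0 : (0 < N)%N.

(** The common value of the bilinear forms of order s. *)
Definition sform (s : R) P Q P' Q' : R := \int[mu]_xi (enorm xi `^ (2 * s) * cross P Q P' Q' xi).

Definition finite_energy (s : R) P Q : Prop :=
  Int mu (fun xi => enorm xi `^ (2 * s) * (P xi ^+ 2 + Q xi ^+ 2)).

Lemma cross_le P Q P' Q' xi :
  `|cross P Q P' Q' xi| <= (P xi ^+ 2 + Q xi ^+ 2) + (P' xi ^+ 2 + Q' xi ^+ 2).
Proof.
rewrite /cross; move: (P xi) (Q xi) (P' xi) (Q' xi) => a b c d.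
have h1 := sqr_ge0 (a - c); have h2 := sqr_ge0 (b - d).
have h3 := sqr_ge0 (a + c); have h4 := sqr_ge0 (b + d).
by rewrite ler_norml; apply/andP; split; nra.
Qed.

Lemma sform_Int s P Q P' Q' : L2 mu P -> L2 mu Q -> L2 mu P' -> L2 mu Q' ->
  finite_energy s P Q -> finite_energy s P' Q' ->
  Int mu (fun xi => enorm xi `^ (2 * s) * cross P Q P' Q' xi).
Proof.
move=> P2 Q2 P'2 Q'2 H H'; apply: (le_Int _ _ (IntD H H')).
  apply: measurable_funM; first exact: measurable_enormX.
  exact: Int_measurable (cross_Int P2 Q2 P'2 Q'2).
move=> xi; rewrite -mulrDr !normrM ler_wpM2l//.
apply: le_trans (cross_le _ _ _ _ _) _.
by rewrite [leRHS]ger0_norm// !addr_ge0 ?sqr_ge0.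
Qed.

Lemma delta_L2 m u y : L2 mu u -> L2 mu (fun x => delta m u x y).
Proof.
move=> u2; have [P [Q U]] := FT_exists u2.
by have [] := FT_delta m y U.
Qed.

(** Both arguments are differenced m times, so the multiplier is that of order 2m,
which is what the constant c_{N,2m,s} normalises. *)
Lemma E2ms_sform m s u v P Q P' Q' : 0 < s -> s < (2 * m)%:R ->
  FT u P Q -> FT v P' Q' -> finite_energy s P Q -> finite_energy s P' Q' ->
  E2ms m s u v = sform s P Q P' Q'.
Proof.
move=> s0 sm U V HU HV; have [u2 P2 Q2 _] := U; have [v2 P'2 Q'2 _] := V.
have IW := cross_Int P2 Q2 P'2 Q'2; have IsW := sform_Int P2 Q2 P'2 Q'2 HU HV.
have [_ E] := spectral_form N0 s0 sm IW IsW; rewrite /sform -E /E2ms.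
congr (_ * _); apply: eq_Rintegral => y _.
have I1 : Int mu (fun x => delta m u x y * delta m v x y) by apply: L2M; exact: delta_L2.
have -> : (2 * m)%N = (m + m)%N by rewrite mul2n addnn.
rewrite -(ip_delta m m y U V) [RHS]mulrC -(RintZ _ I1).
by apply: eq_Rintegral => x _; rewrite mulrC.
Qed.

Lemma FT_diff u P Q h : FT u P Q -> FT (fun x => u (x + h) - u x)
  (fun xi => (cos (dotrv h xi) - 1) * P xi - sin (dotrv h xi) * Q xi)
  (fun xi => sin (dotrv h xi) * P xi + (cos (dotrv h xi) - 1) * Q xi).
Proof.
move=> U; have := FT_lin (-1) (FT_translate h U) U.
by congr FT; apply/funext => x; ring.
Qed.

Lemma ip_diff u v P Q P' Q' h : FT u P Q -> FT v P' Q' ->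
  \int[mu]_x ((u (x + h) - u x) * (v (x + h) - v x)) =
  \int[mu]_xi (dsym 1 (dotrv h xi) * cross P Q P' Q' xi).
Proof.
move=> U V; have Ud := FT_diff h U; have Vd := FT_diff h V.
have := FT_ip Ud Vd; rewrite /ip => <-.
have [_ u1 u2 _] := Ud; have [_ v1 v2 _] := Vd.
rewrite -RintD; [|exact: L2M|exact: L2M].
apply: eq_Rintegral => xi _; rewrite /dsym /cross expr1.
have cs := cos2Dsin2 (dotrv h xi); move: (cos _) (sin _) cs => c s cs.
transitivity (((c ^+ 2 + s ^+ 2) + 1 - 2 * c) * (P xi * P' xi + Q xi * Q' xi)); first by ring.
by rewrite cs; ring.
Qed.

Lemma measurable_diff2 u : measurable_fun setT u ->
  measurable_fun setT (fun z : 'rV[R]_N * 'rV[R]_N => u (z.2 + z.1) - u z.2).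
Proof.
move=> mu_; apply: measurable_funB; last exact: (measurable_comp_snd mu_).
by apply: (measurableT_comp mu_); under eq_fun do rewrite addrC; exact: measurable_add_rV.
Qed.

(** With x = y + h the kernel depends on h only, and the multiplier of u (y + h) - u y
has squared modulus 2 - 2 cos (h . xi): this is the case m = 1 of the constant. *)
Lemma Esigma_sform s u v P Q P' Q' : 0 < s -> s < 1 ->
  FT u P Q -> FT v P' Q' -> finite_energy s P Q -> finite_energy s P' Q' ->
  Esigma s u v = sform s P Q P' Q'.
Proof.
move=> s0 s1 U V HU HV; have [u2 P2 Q2 _] := U; have [v2 P'2 Q'2 _] := V.
have IW := cross_Int P2 Q2 P'2 Q'2; have IsW := sform_Int P2 Q2 P'2 Q'2 HU HV.
have s1' : s < 1%:R by [].
have [_ E] := spectral_form N0 s0 s1' IW IsW; rewrite /sform -E /Esigma.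
have mu_ := L2_measurable u2; have mv := L2_measurable v2.
congr (_ * _); set p : R := N%:R + 2 * s.
pose F (z : 'rV[R]_N * 'rV[R]_N) := (u (z.2 + z.1) - u z.2) * (v (z.2 + z.1) - v z.2) / enorm z.1 `^ p.
have mk := @measurable_enormX_inv R N p.
have mF : measurable_fun setT F.
  apply: measurable_funM; last exact: (measurable_comp_fst mk).
  by apply: measurable_funM; exact: measurable_diff2.
have t2 h w : L2 mu w -> L2 mu (fun x => w (x + h) - w x).
  by move=> w2; exact: L2B (L2_translate h w2) w2.
have gI w A B : FT w A B -> finite_energy s A B ->
    Int mu (fun h => nsq mu (fun x => w (x + h) - w x) / enorm h `^ p).
  move=> Wt HW; have [w2 A2 B2 _] := Wt.
  have I0 := cross_Int A2 B2 A2 B2; have I1 := sform_Int A2 B2 A2 B2 HW HW.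
  have [+ _] := spectral_form N0 s0 s1' I0 I1; congr Int; apply/funext => h.
  by rewrite -(ip_diff h Wt Wt).
have bound h : (\int[mu]_x `|F (h, x)|%:E <=
    (nsq mu (fun x => u (x + h) - u x) / enorm h `^ p + nsq mu (fun x => v (x + h) - v x) / enorm h `^ p)%:E)%E.
  have A2 := ((L2_sqr mu _).1 (t2 h _ u2)).2; have B2 := ((L2_sqr mu _).1 (t2 h _ v2)).2.
  have I0 : Int mu (fun x => (enorm h `^ p)^-1 * ((u (x + h) - u x) ^+ 2 + (v (x + h) - v x) ^+ 2)).
    by apply: IntZ; exact: IntD.
  have -> : nsq mu (fun x => u (x + h) - u x) / enorm h `^ p + nsq mu (fun x => v (x + h) - v x) / enorm h `^ p =
      \int[mu]_x ((enorm h `^ p)^-1 * ((u (x + h) - u x) ^+ 2 + (v (x + h) - v x) ^+ 2)).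
    rewrite (RintZ _ (IntD A2 B2)) (RintD A2 B2) -mulrDl mulrC.
    by congr (_ * (_ + _)); apply: eq_Rintegral => x _; rewrite expr2.
  rewrite (RintegralE I0); apply: ge0_le_integral.
  - exact: measurableT.
  - by move=> x _; rewrite lee_fin.
  - apply/measurable_EFinP; apply: measurableT_comp => //.
    exact: (measurableT_comp mF (pair1_measurable h)).
  - exact: measurable_int I0.
  - move=> x _; rewrite lee_fin /F/= normrM mulrC [`|_^-1|]ger0_norm ?invr_ge0 ?powR_ge0//.
    rewrite ler_wpM2l ?invr_ge0 ?powR_ge0//.
    move: (u (x + h) - u x) (v (x + h) - v x) => a b.
    have h1 := sqr_ge0 (a - b); have h2 := sqr_ge0 (a + b).
    by rewrite ler_norml; apply/andP; split; nra.
have [|I1 I2 EF] := @Rfubini _ _ _ _ _ mu mu F mF.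
  by apply: (fubini_dom mF bound); apply: IntD; [exact: gI U HU|exact: gI V HV].
transitivity (\int[mu]_y \int[mu]_h F (h, y)).
  apply: eq_Rintegral => y _.
  pose G x := (u x - u y) * (v x - v y) / enorm (x - y) `^ p.
  have mG : measurable_fun setT G.
    apply: measurable_funM; first by apply: measurable_funM; apply: measurable_funB.
    exact: (measurable_translate (- y) mk).
  rewrite -/G; transitivity (\int[mu]_x G x); first by [].
  rewrite -(Rint_translate y mG); apply: eq_Rintegral => h _.
  by rewrite /G /F/= addrK (addrC h).
rewrite -EF; apply: eq_Rintegral => h _.
rewrite -(ip_diff h U V) mulrC -RintZ; last by apply: L2M; exact: t2.
by apply: eq_Rintegral => x _; rewrite /F/= mulrC.
Qed.

Lemma enormX_le (s : R) (M : nat) (xi : 'rV[R]_N) : 0 <= s -> s <= M%:R ->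
  enorm xi `^ (2 * s) <= (1 + sqn xi) ^+ M.
Proof.
move=> s0 sM; rewrite enorm_powR.
have q0 := sqn_ge0 xi; have h1 : 1 <= 1 + sqn xi by rewrite lerDl.
apply: (@le_trans _ _ ((1 + sqn xi) `^ s)).
  by apply: ge0_ler_powR => //; rewrite ?nnegrE ?addr_ge0// lerDr.
rewrite -powR_mulrn ?addr_ge0//; exact: ler_powR.
Qed.

Lemma sobolev_Int s u : sobolev s u ->
  Int mu (fun xi => (1 + sqn xi) `^ s * (complex.Re (fourier u xi) ^+ 2 + complex.Im (fourier u xi) ^+ 2)).
Proof.
move=> [/L2P u2 H]; have [_ P2 Q2 _] := fourier_FT u2.
apply/ge0_IntP => [xi|]; first by rewrite mulr_ge0 ?powR_ge0 ?addr_ge0 ?sqr_ge0.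
split.
  apply: measurable_funM.
    apply: (measurableT_comp (measurable_powR s)); apply: measurable_funD => //.
    exact: measurable_sqn.
  by apply: measurable_funD; apply: measurable_funX; [exact: L2_measurable P2|exact: L2_measurable Q2].
rewrite (eq_integral (fun xi => ((1 + enorm xi ^+ 2) `^ s * sqrnormc (fourier u xi))%:E))//.
by move=> xi _; rewrite /sqrnormc -enorm_sqr.
Qed.

(** The last clause is the form in which derivatives of order at most s are used: any
multiplier bounded by the Sobolev weight keeps the transform square-integrable. *)
Lemma sobolev_spectrum s u (P := fun xi => complex.Re (fourier u xi))
    (Q := fun xi => complex.Im (fourier u xi)) : 0 <= s -> sobolev s u ->
  [/\ FT u P Q, finite_energy s P Q &
      forall a : 'rV[R]_N -> R, measurable_fun setT a ->
        (forall xi, a xi ^+ 2 <= (1 + sqn xi) `^ s) ->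
        L2 mu (fun xi => a xi * P xi) /\ L2 mu (fun xi => a xi * Q xi)].
Proof.
move=> s0 Hu; have H := sobolev_Int Hu; have [/L2P u2 _] := Hu.
have U := fourier_FT u2; have [_ P2 Q2 _] := U.
have mP := L2_measurable P2; have mQ := L2_measurable Q2.
split => //.
  apply: (le_Int _ _ H).
    apply: measurable_funM; first exact: measurable_enormX.
    by apply: measurable_funD; exact: measurable_funX.
  move=> xi; rewrite !normrM ler_wpM2r// !ger0_norm ?powR_ge0// enorm_powR.
  by apply: ge0_ler_powR => //; rewrite ?nnegrE ?addr_ge0 ?sqn_ge0// lerDr.
move=> a ma a2; have key (A : 'rV[R]_N -> R) : measurable_fun setT A ->
    (forall xi, A xi ^+ 2 <= P xi ^+ 2 + Q xi ^+ 2) -> L2 mu (fun xi => a xi * A xi).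
  move=> mA AB; have mf : measurable_fun setT (fun xi => a xi * A xi) by exact: measurable_funM.
  apply/L2_sqr; split => //; apply: (le_Int _ _ H); first exact: measurable_funX.
  move=> xi; rewrite [leLHS]ger0_norm ?sqr_ge0// [leRHS]ger0_norm; last first.
    by rewrite mulr_ge0 ?powR_ge0 ?addr_ge0 ?sqr_ge0.
  by rewrite exprMn; apply: ler_pM; rewrite ?sqr_ge0.
by split; apply: key => // xi; rewrite ?lerDl ?lerDr sqr_ge0.
Qed.

End SpectralForms.

(** * Weak derivatives *)

Section TrigBounds.
Context {R : realType}.

Lemma MVT_abs (f df : R -> R) (C x : R) : (forall t : R, is_derive t 1 f (df t)) ->
  (forall t, `|df t| <= C) -> `|f x - f 0| <= C * `|x|.
Proof.
move=> fd dC; have cf t : {for t, continuous f}.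
  by apply: differentiable_continuous; apply/derivable1_diffP; have [] := fd t.
have cw A : {within A, continuous f} by apply: continuous_subspaceT => t; exact: cf.
have [x0|x0|->] := ltgtP x 0.
- have [c _ E] := MVT x0 (fun t _ => fd t) (cw _).
  by rewrite distrC E normrM sub0r normrN ler_wpM2r.
- have [c _ E] := MVT x0 (fun t _ => fd t) (cw _).
  by rewrite E normrM subr0 ler_wpM2r.
- by rewrite subrr normr0 mulr_ge0// (le_trans (normr_ge0 (df 0))).
Qed.

Lemma sin_abs_le (x : R) : `|sin x| <= `|x|.
Proof.
have := @MVT_abs sin cos 1 x (fun t => is_derive_sin t) (@cos_abs_le1 R).
by rewrite sin0 subr0 mul1r.
Qed.

Lemma cosB1_abs_le (x : R) : `|cos x - 1| <= `|x|.
Proof.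
have := @MVT_abs cos (fun t => - sin t) 1 x (fun t => is_derive_cos t).
rewrite cos0 mul1r; apply => t; by rewrite normrN sin_abs_le1.
Qed.

Lemma is_derive_seq (f : R -> R) (df : R) (t : nat -> R) : is_derive (0 : R) 1 f df ->
  t k @[k --> \oo] --> 0 -> (forall k, t k != 0) ->
  (t k)^-1 * (f (t k) - f 0) @[k --> \oo] --> df.
Proof.
move=> [fd <-] t0 tn0.
have /cvg_ex[l Hl] := fd; have lE := cvg_lim (@norm_hausdorff _ _) Hl.
rewrite /derive lE.
have ct : t @ \oo --> 0^'.
  move=> A [e /= e0 Ae]; have /cvgrPdist_lt/(_ e e0)[K _ HK] := t0.
  exists K => // k /= /HK h; exact: Ae.
rewrite (_ : (fun k => _) = (fun h => h^-1 *: ((f \o shift 0) (h *: 1) - f 0)) \o t).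
  exact: cvg_comp ct Hl.
by apply/funext => k; rewrite /= addr0 /GRing.scale/= mulr1.
Qed.

End TrigBounds.

Section CcFunctions.
Context {R : realType} {N : nat}.
Notation mu := (lebRV R N).
Implicit Types (u g phi P Q : 'rV[R]_N -> R) (k : 'I_N).
Notation e_ k := (delta_mx 0 k : 'rV[R]_N).

Lemma Cc_infty_partial phi k : Cc_infty phi -> Cc_infty (partial k phi).
Proof.
move=> [sphi cphi]; split.
  by move=> I; have := sphi (rcons I k); rewrite foldr_rcons.
apply: subclosed_compact cphi _; first exact: closed_closure.
set S := [set x | phi x != 0].
rewrite [X in _ `<=` X]((closure_id _).1 (@closed_closure _ S)).
apply: closureS => x /=; move=> dx; apply: contrapT => xS; move/negP: dx; apply; apply/eqP.
rewrite /partial (@near_eq_derive _ _ _ phi (cst 0)) ?derive_cst//.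
have : nbhs x (~` closure S).
  by apply: open_nbhs_nbhs; split => //; exact: closed_openC (@closed_closure _ S).
apply: filterS => y yS; apply/eqP; apply: contrapT => h; apply: yS; apply: subset_closure.
exact/negP.
Qed.

Lemma coord_le_norm (x : 'rV[R]_N) i : `|x 0 i| <= `|x|.
Proof.
rewrite [leRHS]/Num.Def.normr/= mx_normrE.
exact: (le_bigmax _ (fun ij : 'I_1 * 'I_N => `|x ij.1 ij.2|) (0, i)).
Qed.

Lemma Cc_infty_bounded phi : Cc_infty phi ->
  exists C M, 0 <= C /\ (forall x, `|phi x| <= C * \1_(cube M) x).
Proof.
move=> H; have cphi := Cc_infty_continuous H; have [_ K] := H.
set S := closure _ in K.
have [C HC] : exists C, forall x, S x -> `|phi x| <= C.
  have := continuous_compact (continuous_subspaceT cphi) K.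
  move=> /compact_bounded[C [_ HC]]; exists (C + 1) => x xS.
  by apply: (HC (C + 1)); [rewrite ltrDl|exists x].
have [M HM] : exists M, S `<=` cube M.
  have [M [_ HM]] := compact_bounded K; exists (M + 2) => x xS i; rewrite !mxE.
  have h1 : `|x| <= M + 1 by apply: (HM (M + 1)); rewrite ?ltrDl.
  have := le_trans (coord_le_norm x i) h1; rewrite ler_norml => /andP[? ?].
  by split; lra.
exists (Num.max C 0), M; split; first by rewrite le_max lexx orbT.
move=> x; have [xS|xS] := pselect (S x).
  by rewrite indicE mem_set ?mulr1; [rewrite le_max HC|exact: HM].
have -> : phi x = 0 by apply: contra_notP xS => /eqP h; exact: subset_closure.
by rewrite normr0 mulr_ge0// le_max lexx orbT.
Qed.

Lemma Cc_infty_derive phi k x (t : R) : Cc_infty phi ->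
  is_derive t 1 (fun r => phi (r *: e_ k + x)) (partial k phi (t *: e_ k + x)).
Proof.
move=> [sphi _]; have [_ d] := sphi [::].
have /cvg_ex[l Hl] := d (t *: e_ k + x) k.
have -> : partial k phi (t *: e_ k + x) = l by exact: (cvg_lim (@norm_hausdorff _ _) Hl).
apply: is_derive_cvg; move: Hl.
rewrite (_ : (fun h : R => h^-1 *: ((foldr (@partial R N) phi [::] \o shift (t *: e_ k + x)) (h *: e_ k) -
   foldr (@partial R N) phi [::] (t *: e_ k + x))) =
   (fun h : R => h^-1 *: (phi ((h *: 1 + t) *: e_ k + x) - phi (t *: e_ k + x))))//.
apply/funext => h /=; have -> : h *: (1 : R) = h by rewrite /GRing.scale/= mulr1.
by rewrite scalerDl addrA.
Qed.

Lemma Cc_infty_L2 phi : Cc_infty phi -> L2 mu phi.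
Proof.
move=> H; have [C [M [C0 HC]]] := Cc_infty_bounded H.
have I2 : L2 mu (fun x => C * \1_(cube M) x) by apply: L2Z; exact: L2_indic_box.
apply: (le_L2 _ _ I2); first exact: Cc_infty_measurable.
by move=> x; apply: le_trans (HC x) (ler_norm _).
Qed.

Lemma Cc_infty_Int phi : Cc_infty phi -> Int mu phi.
Proof.
move=> H; have [C [M [C0 HC]]] := Cc_infty_bounded H.
apply: (le_Int (g := fun x => C * (\1_(cube M) x * \1_(cube M) x))).
- exact: Cc_infty_measurable.
- move=> x; apply: le_trans (HC x) _; rewrite indicE; case: (x \in cube M); rewrite ?mulr1 ?mulr0 ?normr0//; exact: ler_norm.
- by apply: IntZ; apply: L2M; exact: L2_indic_box.
Qed.

(** The quotients are dominated, because the partial derivative is bounded with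
bounded support. *)
Lemma Cc_infty_quotient phi k (t : nat -> R) : Cc_infty phi ->
  t j @[j --> \oo] --> 0 -> (forall j, t j != 0) -> (forall j, `|t j| <= 1) ->
  L2cvg mu (fun j x => (t j)^-1 * (phi (x + t j *: e_ k) - phi x)) (partial k phi).
Proof.
move=> H t0 tn0 t1; have H' := Cc_infty_partial k H.
have [C [M' [C0 HC]]] := Cc_infty_bounded H'; have [B [M [B0 HB]]] := Cc_infty_bounded H.
have [||||_ _] := @L2_dominated _ _ _ mu (fun j x => (t j)^-1 * (phi (x + t j *: e_ k) - phi x))
  (partial k phi) (fun x => C * \1_(cube (M + 1)) x).
- move=> j; apply: measurable_funM => //; apply: measurable_funB; last exact: Cc_infty_measurable.
  by apply: measurable_translate; exact: Cc_infty_measurable.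
- by apply: L2Z; exact: L2_indic_box.
- move=> x; have := is_derive_seq (Cc_infty_derive k x 0 H) t0 tn0.
  rewrite scale0r add0r.
  rewrite (_ : (fun j => (t j)^-1 * (phi (x + t j *: e_ k) - phi x)) =
    (fun j => (t j)^-1 * (phi (t j *: e_ k + x) - phi x)))//.
  by apply/funext => j; rewrite (addrC x).
- move=> j x; rewrite normrM normfV mulrC ler_pdivrMr ?normr_gt0//.
  have phi0 z : ~ cube M z -> phi z = 0.
    move=> zM; apply/eqP; rewrite -normr_le0; apply: le_trans (HB z) _.
    by rewrite indicE memNset// mulr0.
  have [xM|xM] := pselect (cube (M + 1) x).
    rewrite indicE mem_set// mulr1.
    have := MVT_abs (C := C) (t j) (fun r => Cc_infty_derive k x r H).
    rewrite scale0r add0r (addrC (t j *: _)); apply => r; apply: le_trans (HC _) _.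
    by rewrite ler_piMr// indicE; case: (_ \in _).
  rewrite indicE memNset// mulr0 mul0r !phi0 ?subrr ?normr0//.
    by apply: contra_not xM => h; apply: subset_cube h; rewrite lerDl.
  apply: contra_not xM => h i; have := h i; rewrite !mxE.
  have := t1 j; rewrite ler_norml => /andP[a b].
  by rewrite eqxx/=; case: (i == k); rewrite ?mulr1 ?mulr0 => -[c d]; split; lra.
by [].
Qed.

End CcFunctions.

Section WeakDerivatives.
Context {R : realType} {N : nat}.
Notation mu := (lebRV R N).
Implicit Types (u g phi P Q : 'rV[R]_N -> R) (k : 'I_N).
Notation e_ k := (delta_mx 0 k : 'rV[R]_N).

Let t (j : nat) : R := j.+1%:R^-1.

Let t0 : t j @[j --> \oo] --> 0. Proof. exact: cvg_harmonic. Qed.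
Let tn0 j : t j != 0. Proof. by rewrite invr_neq0. Qed.
Let t1 j : `|t j| <= 1.
Proof. by rewrite ger0_norm ?invr_ge0// invf_le1 ?ler1n. Qed.

Definition quot k (j : nat) u (x : 'rV[R]_N) : R := (t j)^-1 * (u (x + t j *: e_ k) - u x).

Let ca k j (xi : 'rV[R]_N) : R := (t j)^-1 * (cos (t j * xi 0 k) - 1).
Let sa k j (xi : 'rV[R]_N) : R := (t j)^-1 * sin (t j * xi 0 k).

Let dot_e k (a : R) (xi : 'rV[R]_N) : dotrv (a *: e_ k) xi = a * xi 0 k.
Proof.
rewrite dotrvZl /dotrv (bigD1 k)//= big1 => [|i ik]; rewrite !mxE !eqxx/= ?mul1r ?addr0//.
by rewrite (negbTE ik) mul0r.
Qed.

Let FT_quot k j u P Q : FT u P Q -> FT (quot k j u)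
  (fun xi => ca k j xi * P xi - sa k j xi * Q xi) (fun xi => sa k j xi * P xi + ca k j xi * Q xi).
Proof.
move=> U; have := FT_lin (t j)^-1 (@FT_zero R N) (FT_diff (t j *: e_ k) U).
by congr FT; apply/funext => xi; rewrite /quot /ca /sa ?dot_e; ring.
Qed.

Let ca_le k j xi : `|ca k j xi| <= `|xi 0 k|.
Proof.
rewrite /ca normrM normfV mulrC ler_pdivrMr ?normr_gt0// mulrC -normrM.
exact: cosB1_abs_le.
Qed.

Let sa_le k j xi : `|sa k j xi| <= `|xi 0 k|.
Proof.
rewrite /sa normrM normfV mulrC ler_pdivrMr ?normr_gt0// mulrC -normrM.
exact: sin_abs_le.
Qed.

Let ca_cvg k xi : ca k j xi @[j --> \oo] --> 0.
Proof.
have d : is_derive (0 : R) 1 (fun r => cos (r * xi 0 k)) 0.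
  pose L (r : R) := r * xi 0 k.
  have dL : is_derive (0 : R) 1 L (xi 0 k).
    by apply: is_derive_eq; rewrite /GRing.scale/=; ring.
  rewrite (_ : (fun r => _) = cos \o L)//.
  apply: is_derive_eq (is_derive1_comp (is_derive_cos (L 0)) dL) _.
  by rewrite /L mul0r sin0 oppr0 mul0r.
by have := is_derive_seq d t0 tn0; rewrite mul0r cos0.
Qed.

Let sa_cvg k xi : sa k j xi @[j --> \oo] --> xi 0 k.
Proof.
have d : is_derive (0 : R) 1 (fun r => sin (r * xi 0 k)) (xi 0 k).
  pose L (r : R) := r * xi 0 k.
  have dL : is_derive (0 : R) 1 L (xi 0 k).
    by apply: is_derive_eq; rewrite /GRing.scale/=; ring.
  rewrite (_ : (fun r => _) = sin \o L)//.
  apply: is_derive_eq (is_derive1_comp (is_derive_sin (L 0)) dL) _.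
  by rewrite /L mul0r cos0 mul1r.
have := is_derive_seq d t0 tn0; rewrite mul0r sin0.
by under eq_fun do rewrite subr0.
Qed.

(** The quotients of cosine and sine are at most |xi_k| and tend to the multiplier of
the derivative, so dominated convergence applies. *)
Let FT_quot_cvg k u P Q : FT u P Q ->
  L2 mu (fun xi => xi 0 k * P xi) -> L2 mu (fun xi => xi 0 k * Q xi) ->
  L2cvg mu (fun j xi => ca k j xi * P xi - sa k j xi * Q xi) (fun xi => - (xi 0 k * Q xi)) /\
  L2cvg mu (fun j xi => sa k j xi * P xi + ca k j xi * Q xi) (fun xi => xi 0 k * P xi).
Proof.
move=> U kP kQ.
have key (A B : 'rV[R]_N -> R) (F : nat -> 'rV[R]_N -> R) f :
    L2 mu (fun xi => xi 0 k * A xi) -> L2 mu (fun xi => xi 0 k * B xi) ->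
    (forall j, measurable_fun setT (F j)) -> (forall xi, F j xi @[j --> \oo] --> f xi) ->
    (forall j xi, `|F j xi| <= `|xi 0 k * A xi| + `|xi 0 k * B xi|) -> L2cvg mu F f.
  move=> A2 B2 mF Ff Fb.
  have aL (C : 'rV[R]_N -> R) : L2 mu C -> L2 mu (fun xi => `|C xi|).
    move=> C2; apply: (le_L2 _ _ C2) => [|x]; last by rewrite normr_id.
    by apply: measurableT_comp => //; exact: L2_measurable C2.
  by have [] := L2_dominated mF (L2D (aL _ A2) (aL _ B2)) Ff Fb.
have mFT j : measurable_fun setT (fun xi => ca k j xi * P xi - sa k j xi * Q xi) /\
    measurable_fun setT (fun xi => sa k j xi * P xi + ca k j xi * Q xi).
  by have [_ /L2_measurable h1 /L2_measurable h2 _] := FT_quot k j U.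
split.
- apply: (key P Q) => // [j|xi|j xi]; first by have [] := mFT j.
  + have := cvgB (cvgM (@ca_cvg k xi) (cvg_cst (P xi) : (fun=> P xi) @ \oo --> P xi))
      (cvgM (@sa_cvg k xi) (cvg_cst (Q xi) : (fun=> Q xi) @ \oo --> Q xi)).
    by rewrite mul0r sub0r; exact.
  + apply: le_trans (ler_normB _ _) _; rewrite (normrM (ca k j xi)) (normrM (sa k j xi)) !(normrM (xi 0 k)).
    by apply: lerD; rewrite ler_wpM2r.
- apply: (key P Q) => // [j|xi|j xi]; first by have [] := mFT j.
  + have := cvgD (cvgM (@sa_cvg k xi) (cvg_cst (P xi) : (fun=> P xi) @ \oo --> P xi))
      (cvgM (@ca_cvg k xi) (cvg_cst (Q xi) : (fun=> Q xi) @ \oo --> Q xi)).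
    by rewrite mul0r addr0; exact.
  + apply: le_trans (ler_normD _ _) _; rewrite (normrM (sa k j xi)) (normrM (ca k j xi)) !(normrM (xi 0 k)).
    by apply: lerD; rewrite ler_wpM2r.
Qed.

(** By [FT_quot_cvg] and isometry the difference quotients of u form a Cauchy
sequence. *)
Lemma FT_quot_limit k u P Q : FT u P Q ->
  L2 mu (fun xi => xi 0 k * P xi) -> L2 mu (fun xi => xi 0 k * Q xi) ->
  exists g, L2cvg mu (fun j => quot k j u) g /\
    FT g (fun xi => - (xi 0 k * Q xi)) (fun xi => xi 0 k * P xi).
Proof.
move=> U kP kQ; have [cP cQ] := FT_quot_cvg U kP kQ.
have q2 j : L2 mu (quot k j u) by have [] := FT_quot k j U.
have P2 j : L2 mu (fun xi => ca k j xi * P xi - sa k j xi * Q xi) by have [] := FT_quot k j U.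
have Q2 j : L2 mu (fun xi => sa k j xi * P xi + ca k j xi * Q xi) by have [] := FT_quot k j U.
have nE (f h : 'rV[R]_N -> R) : nsq mu (fun x => f x + -1 * h x) = nsq mu (fun x => f x - h x).
  by apply: eq_Rintegral => x _; rewrite mulN1r.
have [|g g2 gc] := @L2_complete _ _ _ mu (fun j => quot k j u) q2.
- move=> e e0; have e2 : 0 < e / 2 by rewrite divr_gt0.
  have [K1 H1] := L2cvg_cauchy P2 (L2N kQ) cP e2.
  have [K2 H2] := L2cvg_cauchy Q2 kP cQ e2.
  exists (maxn K1 K2) => i j; rewrite !geq_max => /andP[i1 i2] /andP[j1 j2].
  have := FT_isometry (FT_lin (-1) (FT_quot k i U) (FT_quot k j U)).
  by rewrite !nE => <-; rewrite [leRHS](splitr e); apply: lerD; [exact: H1|exact: H2].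
exists g; split => //.
exact: (FT_closed (fun j => FT_quot k j U) g2 (L2N kQ) kP gc cP cQ).
Qed.

Lemma locally_integrable_L2 u : L2 mu u -> locally_integrable_rV u.
Proof.
move=> u2; have mu_ := L2_measurable u2; split => // K cK.
have mK := measurable_compact cK.
have [M KM] : exists M, K `<=` cube M.
  have [M [_ HM]] := compact_bounded cK; exists (M + 2) => x xS i; rewrite !mxE.
  have h1 : `|x| <= M + 1 by apply: (HM (M + 1)); rewrite ?ltrDl.
  have := le_trans (coord_le_norm x i) h1; rewrite ler_norml => /andP[? ?].
  by split; lra.
have I1 : Int mu (fun x => u x * \1_(cube M) x) by exact: L2M u2 (L2_indic_box _ _).
have I2 : Int mu (fun x => u x * \1_K x).
  apply: (le_Int _ _ I1) => [|x]; first by apply: measurable_funM => //; exact: measurable_indic.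
  rewrite !normrM ler_wpM2l// !indicE; case: (boolP (x \in K)) => //; last by rewrite normr0.
  by rewrite inE => /KM xM; rewrite mem_set.
apply/(integrable_mkcond _ mK); move: I2; congr (integrable _ _ _); apply/funext => x.
by rewrite patchE indicE; case: (x \in K); rewrite ?mulr1 ?mulr0.
Qed.

(** For difference quotients, integration by parts is the translation invariance of
the integral. *)
Lemma weak_partial_exists k u g : L2 mu u -> L2 mu g ->
  L2cvg mu (fun j => quot k j u) g -> is_weak_partial k u g.
Proof.
move=> u2 g2 ug; split; [exact: locally_integrable_L2|exact: locally_integrable_L2|].
move=> phi H; have phi2 := Cc_infty_L2 H; have dphi2 := Cc_infty_L2 (Cc_infty_partial k H).
have q2 j : L2 mu (quot k j u) by apply: L2Z; exact: L2B (L2_translate _ u2) u2.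
have A := ip_cvg q2 (fun=> phi2) g2 phi2 ug (@L2cvg_cst _ _ _ mu phi).
pose r j := (- t j)^-1; pose d j (x : 'rV[R]_N) := r j * (phi (x + (- t j) *: e_ k) - phi x).
have d2 j : L2 mu (d j) by apply: L2Z; exact: L2B (L2_translate _ phi2) phi2.
have dc : L2cvg mu d (partial k phi).
  apply: Cc_infty_quotient => // [|j|j]; last by rewrite normrN.
    by rewrite -oppr0; exact: cvgN.
  by rewrite oppr_eq0.
have B := ip_cvg (fun=> u2) d2 u2 dphi2 (@L2cvg_cst _ _ _ mu u) dc.
have E j : ip mu (quot k j u) phi = - ip mu u (d j).
  have I0 : Int mu (fun x => u x * phi x) by exact: L2M.
  have I1 : Int mu (fun x => u (x + t j *: e_ k) * phi x) by apply: L2M => //; exact: L2_translate.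
  have I2 : Int mu (fun x => u x * phi (x + (- t j) *: e_ k)) by apply: L2M => //; exact: L2_translate.
  have S : \int[mu]_x (u x * phi (x + (- t j) *: e_ k)) = \int[mu]_x (u (x + t j *: e_ k) * phi x).
    rewrite -(Rint_translate (t j *: e_ k) (Int_measurable I2)); apply: eq_Rintegral => x _.
    by rewrite scaleNr addrK.
  transitivity ((t j)^-1 * (\int[mu]_x (u (x + t j *: e_ k) * phi x) - \int[mu]_x (u x * phi x))).
    rewrite -(RintB I1 I0) -(RintZ _ (IntB I1 I0)).
    by apply: eq_Rintegral => x _; rewrite /quot; ring.
  rewrite -S -(RintB I2 I0) -(RintZ _ (IntB I2 I0)) -RintN; last by exact: L2M.
  by apply: eq_Rintegral => x _; rewrite /d /r invrN; ring.
have B' := cvgN B; rewrite /ip in A B'.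
have EA := cvg_unique (@norm_hausdorff _ _) A.
apply/eqP; rewrite -eqr_oppLR; apply/eqP/esym; apply: EA.
by rewrite (funext E); exact: B'.
Qed.

(** The lemma of du Bois-Reymond, for the difference. *)
Lemma weak_partial_unique k u g g' : is_weak_partial k u g -> is_weak_partial k u g' ->
  {ae mu, forall x, g x = g' x}.
Proof.
move=> [_ gl gE] [_ g'l g'E].
have lI h phi : locally_integrable_rV h -> Cc_infty phi -> Int mu (fun x => h x * phi x).
  move=> hl H; have [C [M [C0 HC]]] := Cc_infty_bounded H.
  apply: (le_Int (g := fun x => C * (h x * \1_(cube M) x))).
  - by apply: measurable_funM; [have [] := hl|exact: Cc_infty_measurable].
  - move=> x; rewrite mulrCA !normrM ler_wpM2l// -normrM; apply: le_trans (HC x) _; exact: ler_norm.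
  - by apply: IntZ; exact: locally_integrable_cube.
have dl : locally_integrable_rV (fun x => g x - g' x).
  split; first by apply: measurable_funB; [have [] := gl|have [] := g'l].
  move=> K cK; have [_ /(_ K cK) h1] := gl; have [_ /(_ K cK) h2] := g'l.
  rewrite (_ : EFin \o _ = (fun x => (EFin \o g) x - (EFin \o g') x)%E)//.
  apply: integrableB => //.
  exact: measurable_compact.
have d0 phi : Cc_infty phi -> \int[mu]_x ((g x - g' x) * phi x) = 0.
  move=> H; have I1 := lI _ _ gl H; have I2 := lI _ _ g'l H.
  transitivity (\int[mu]_x (g x * phi x - g' x * phi x)).
    by apply: eq_Rintegral => x _; rewrite mulrBl.
  rewrite (RintB I1 I2); apply/eqP; rewrite subr_eq0 -eqr_opp; apply/eqP.
  by rewrite -[LHS](gE _ H) -[RHS](g'E _ H).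
have := locally_integrable_eq0 dl d0; apply: filterS => x /eqP.
by rewrite subr_eq0 => /eqP.
Qed.

Lemma FT_weak_partial k u P Q : FT u P Q ->
  L2 mu (fun xi => xi 0 k * P xi) -> L2 mu (fun xi => xi 0 k * Q xi) ->
  FT (weak_partial k u) (fun xi => - (xi 0 k * Q xi)) (fun xi => xi 0 k * P xi).
Proof.
move=> U kP kQ; have [g [ug G]] := FT_quot_limit U kP kQ.
have [u2 _ _ _] := U; have [g2 _ _ _] := G.
have wg := weak_partial_exists u2 g2 ug.
have ww : is_weak_partial k u (weak_partial k u).
  by apply: (xgetPex (fun=> 0) (P := [set g | is_weak_partial k u g])); exists g.
have [_ [mw _] _] := ww.
apply: (FT_ae G) => //.
- exact: L2_measurable (L2N kQ).
- exact: L2_measurable kP.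
- exact: weak_partial_unique ww wg.
- exact: aeW.
- exact: aeW.
Qed.

(** The quotients of phi, hence their transforms, are bounded in mean square; by
Fatou's lemma the transform of phi then has the decay that [FT_quot_cvg] assumes. *)
Lemma FT_Cc_partial k phi P Q : Cc_infty phi -> FT phi P Q ->
  FT (partial k phi) (fun xi => - (xi 0 k * Q xi)) (fun xi => xi 0 k * P xi).
Proof.
move=> H U; have qc := Cc_infty_quotient k H t0 tn0 t1.
have d2 := Cc_infty_L2 (Cc_infty_partial k H).
have q2 j : L2 mu (quot k j phi) by have [] := FT_quot k j U.
have bnd : \forall j \near \oo, nsq mu (quot k j phi) <= nsq mu (partial k phi) + 1.
  have /cvgrPdist_lt/(_ 1 ltr01) := nsq_cvg q2 d2 qc; apply: filterS => j.
  by rewrite ltr_distlC => /andP[_ /ltW].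
have [F1 _] : L2 mu (fun xi => xi 0 k * P xi) /\ nsq mu (fun xi => xi 0 k * P xi) <= nsq mu (partial k phi) + 1.
  apply: (@L2_Fatou _ _ _ mu (fun j xi => sa k j xi * P xi + ca k j xi * Q xi)).
  - by move=> j; have [] := FT_quot k j U.
  - move=> xi; have := cvgD (cvgM (@sa_cvg k xi) (cvg_cst (P xi) : (fun=> P xi) @ \oo --> P xi))
      (cvgM (@ca_cvg k xi) (cvg_cst (Q xi) : (fun=> Q xi) @ \oo --> Q xi)).
    by rewrite mul0r addr0; exact.
  - apply: filterS bnd => j; apply: le_trans.
    by rewrite -(FT_isometry (FT_quot k j U)) lerDr nsq_ge0.
have [F2 _] : L2 mu (fun xi => - (xi 0 k * Q xi)) /\ nsq mu (fun xi => - (xi 0 k * Q xi)) <= nsq mu (partial k phi) + 1.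
  apply: (@L2_Fatou _ _ _ mu (fun j xi => ca k j xi * P xi - sa k j xi * Q xi)).
  - by move=> j; have [] := FT_quot k j U.
  - move=> xi; have := cvgB (cvgM (@ca_cvg k xi) (cvg_cst (P xi) : (fun=> P xi) @ \oo --> P xi))
      (cvgM (@sa_cvg k xi) (cvg_cst (Q xi) : (fun=> Q xi) @ \oo --> Q xi)).
    by rewrite mul0r sub0r; exact.
  - apply: filterS bnd => j; apply: le_trans.
    by rewrite -(FT_isometry (FT_quot k j U)) lerDl nsq_ge0.
have F2' : L2 mu (fun xi => xi 0 k * Q xi).
  by have := L2N F2; congr L2; apply/funext => xi; rewrite opprK.
have [cP cQ] := FT_quot_cvg U F1 F2'.
exact: (FT_closed (fun j => FT_quot k j U) d2 F2 F1 qc cP cQ).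
Qed.

End WeakDerivatives.

(** * The energy of order s *)

Section SobolevDerivatives.
Context {R : realType} {N : nat}.
Notation mu := (lebRV R N).
Implicit Types u v P Q : 'rV[R]_N -> R.

Lemma coord_sqr_le (xi : 'rV[R]_N) k : xi 0 k ^+ 2 <= sqn xi.
Proof. by rewrite /sqn (bigD1 k)//= lerDl sumr_ge0// => i _; exact: sqr_ge0. Qed.

(** The multipliers of the first and second derivatives are at most 1 + |xi|^2, so
all these derivatives exist as soon as |xi|^2 times the transform is
square-integrable. *)
Lemma FT_weak_neg_laplacian u P Q : FT u P Q ->
  L2 mu (fun xi => sqn xi * P xi) -> L2 mu (fun xi => sqn xi * Q xi) ->
  FT (weak_neg_laplacian u) (fun xi => sqn xi * P xi) (fun xi => sqn xi * Q xi).
Proof.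
move=> U sP sQ; have [_ P2 Q2 _] := U.
have dom (a : 'rV[R]_N -> R) A : measurable_fun setT a -> (forall xi, `|a xi| <= 1 + sqn xi) ->
    L2 mu A -> L2 mu (fun xi => sqn xi * A xi) -> L2 mu (fun xi => a xi * A xi).
  move=> ma ab A2 sA; apply: (le_L2 _ _ (L2D A2 sA)).
    by apply: measurable_funM => //; exact: L2_measurable A2.
  move=> xi; rewrite (_ : A xi + _ = (1 + sqn xi) * A xi); last by rewrite mulrDl mul1r.
  by rewrite !normrM ler_wpM2r// [leRHS]ger0_norm// addr_ge0// sqn_ge0.
have m1 k : measurable_fun setT (fun xi : 'rV[R]_N => xi 0 k) by exact: measurable_coord.
have b1 k (xi : 'rV[R]_N) : `|xi 0 k| <= 1 + sqn xi.
  have := coord_sqr_le xi k; have := sqr_ge0 (xi 0 k - 1); have := sqr_ge0 (xi 0 k + 1).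
  by rewrite ler_norml => *; apply/andP; split; nra.
have m2 k : measurable_fun setT (fun xi : 'rV[R]_N => xi 0 k ^+ 2) by exact: measurable_funX.
have b2 k (xi : 'rV[R]_N) : `|xi 0 k ^+ 2| <= 1 + sqn xi.
  by rewrite ger0_norm ?sqr_ge0// (le_trans (coord_sqr_le xi k))// lerDr.
have second k : FT (weak_partial k (weak_partial k u))
    (fun xi => - (xi 0 k ^+ 2 * P xi)) (fun xi => - (xi 0 k ^+ 2 * Q xi)).
  have U1 := FT_weak_partial U (dom _ _ (m1 k) (b1 k) P2 sP) (dom _ _ (m1 k) (b1 k) Q2 sQ).
  have eP : (fun xi : 'rV[R]_N => xi 0 k * (xi 0 k * P xi)) = (fun xi => xi 0 k ^+ 2 * P xi).
    by apply/funext => xi; ring.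
  have eQ : (fun xi : 'rV[R]_N => xi 0 k * - (xi 0 k * Q xi)) = (fun xi => - (xi 0 k ^+ 2 * Q xi)).
    by apply/funext => xi; ring.
  have hQ : L2 mu (fun xi => xi 0 k * - (xi 0 k * Q xi)).
    by rewrite eQ; exact: L2N (dom _ _ (m2 k) (b2 k) Q2 sQ).
  have hP : L2 mu (fun xi => xi 0 k * (xi 0 k * P xi)).
    by rewrite eP; exact: (dom _ _ (m2 k) (b2 k) P2 sP).
  by have := FT_weak_partial U1 hQ hP; congr FT; apply/funext => xi; ring.
have := FT_sum (index_enum 'I_N) (fun=> -1) second.
congr FT; apply/funext => xi; rewrite /weak_neg_laplacian /sqn ?mulr_suml -?sumrN;
  by apply: eq_bigr => k _; ring.
Qed.

Lemma FT_iter_laplacian u P Q j : FT u P Q ->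
  (forall i, (i <= j)%N -> L2 mu (fun xi => sqn xi ^+ i * P xi) /\
                           L2 mu (fun xi => sqn xi ^+ i * Q xi)) ->
  FT (iter j (@weak_neg_laplacian R N) u) (fun xi => sqn xi ^+ j * P xi) (fun xi => sqn xi ^+ j * Q xi).
Proof.
move=> U; elim: j => [_|j IH H] /=.
  by move: U; congr FT; apply/funext => xi; rewrite expr0 mul1r.
have E A : (fun xi : 'rV[R]_N => sqn xi ^+ j.+1 * A xi) = (fun xi => sqn xi * (sqn xi ^+ j * A xi)).
  by apply/funext => xi; rewrite exprS mulrA.
have [hP hQ] := H _ (leqnn j.+1); rewrite !E in hP hQ *.
by apply: FT_weak_neg_laplacian => //; apply: IH => i ij; apply: H; exact: leqW.
Qed.

Lemma enormX_shift (sigma : R) l (xi : 'rV[R]_N) : 0 < sigma ->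
  enorm xi `^ (2 * sigma) * sqn xi ^+ l = enorm xi `^ (2 * (sigma + l%:R)).
Proof.
move=> s0; rewrite !enorm_powR powRD ?powR_mulrn ?sqn_ge0//.
by rewrite gt_eqF// ltr_wpDr.
Qed.

Lemma sobolev_symbol_le (s : R) l (xi : 'rV[R]_N) : l%:R <= s -> sqn xi ^+ l <= (1 + sqn xi) `^ s.
Proof.
move=> ls; have q0 := sqn_ge0 xi; apply: (@le_trans _ _ ((1 + sqn xi) `^ l%:R)).
  by rewrite powR_mulrn ?addr_ge0// lerXn2r ?nnegrE ?addr_ge0// lerDr.
by apply: ler_powR => //; rewrite lerDl.
Qed.

End SobolevDerivatives.

Section FourierForm.
Context {R : realType} {N : nat}.
Notation mu := (lebRV R N).
Implicit Types u v P Q : 'rV[R]_N -> R.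
Hypothesis N0 : (0 < N)%N.
Local Open Scope complex_scope.

(** By hermitian symmetry the imaginary part is the integral of an odd function. *)
Lemma cintegral_form (s : R) u v : 0 <= s -> sobolev s u -> sobolev s v ->
  let P w xi := complex.Re (fourier w xi) in let Q w xi := complex.Im (fourier w xi) in
  cintegral (fun xi : 'rV[R]_N => (enorm xi `^ (2 * s))%:C * fourier u xi * conjc (fourier v xi)) =
  (sform s (P u) (Q u) (P v) (Q v))%:C.
Proof.
move=> s0 Hu Hv P Q; have [U HU _] := sobolev_spectrum s0 Hu; have [V HV _] := sobolev_spectrum s0 Hv.
have [_ P2 Q2 _] := U; have [_ P'2 Q'2 _] := V.
pose h xi := enorm xi `^ (2 * s) * cross (P u) (Q u) (fun xi => - Q v xi) (P v) xi.
have Ih : Int mu h.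
  have HV' : finite_energy s (fun xi => - Q v xi) (P v).
    by move: HV; congr Int; apply/funext => xi; rewrite sqrrN addrC.
  exact: (sform_Int P2 Q2 (L2N Q'2) P'2 HU HV').
have h0 : \int[mu]_xi h xi = 0.
  have mh := Int_measurable Ih.
  have oddh : {ae mu, forall xi, h (- xi) = - h xi}.
    have [a1 a2] := FT_hermitian U; have [a3 a4] := FT_hermitian V.
    apply: filterS2 (filterI a1 a2) (filterI a3 a4) => xi [e1 e2] [e3 e4].
    rewrite /h /cross /P /Q e1 e2 e3 e4 (_ : enorm (- xi) = enorm xi); last first.
      by rewrite /enorm; congr Num.sqrt; apply: eq_bigr => i _; rewrite mxE sqrrN.
    move: (complex.Re (fourier u xi)) (complex.Im (fourier u xi)) (complex.Re (fourier v xi))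
      (complex.Im (fourier v xi)) (enorm xi `^ _) => a b c d e; by ring.
  have mh' : measurable_fun setT (fun xi : 'rV[R]_N => h (- xi)) by exact: measurable_opp.
  have e1 : \int[mu]_xi h (- xi) = \int[mu]_xi h xi.
    rewrite /Rintegral; congr fine.
    by apply: (integral_oppRV (f := EFin \o h)); exact/measurable_EFinP.
  have := ae_eq_Rint mh' (measurable_funN mh) oddh.
  by rewrite e1 RintN// => e; lra.
rewrite /cintegral; apply/eqP; rewrite eq_complex /=; apply/andP; split; apply/eqP.
  apply: eq_Rintegral => xi _; rewrite /cross /P /Q.
  by case: (fourier u xi) => a b; case: (fourier v xi) => c d /=; ring.
rewrite -[RHS]h0; apply: eq_Rintegral => xi _; rewrite /h /cross /P /Q.
by case: (fourier u xi) => a b; case: (fourier v xi) => c d /=; ring.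
Qed.

(** For s = l + sigma, the l derivatives multiply the weight |xi|^(2 sigma) by
|xi|^(2 l): for even l directly, for odd l after summing xi_k^2 over the additional
derivative. *)
Lemma Es_sform (s : R) u v : 0 < s -> sobolev s u -> sobolev s v ->
  let P w xi := complex.Re (fourier w xi) in let Q w xi := complex.Im (fourier w xi) in
  Es s u v = (sform s (P u) (Q u) (P v) (Q v))%:C.
Proof.
move=> s0 Hu Hv P Q; rewrite /Es; case: ifPn => [sN|sN].
  exact: (cintegral_form (ltW s0) Hu Hv).
have [U HU LU] := sobolev_spectrum (ltW s0) Hu; have [V HV LV] := sobolev_spectrum (ltW s0) Hv.
case: ifPn => [s1|]; first by rewrite (Esigma_sform N0 s0 s1 U V HU HV).
rewrite -leNgt => s1.
pose l := Num.truncn s; pose sigma := s - l%:R; rewrite -/l -/sigma.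
have /andP[ls sl] : l%:R <= s < l.+1%:R by apply: truncn_itv; exact: ltW.
have sE : s = sigma + l%:R by rewrite /sigma subrK.
have si0 : 0 < sigma.
  rewrite subr_gt0 lt_neqAle ls andbT; apply: contraNneq sN => <-; exact: natr_nat.
have si1 : sigma < 1 by move: sl; rewrite /sigma -natr1 => sl; lra.
have msq i : measurable_fun setT (fun xi : 'rV[R]_N => sqn xi ^+ i).
  by apply: measurable_funX; exact: measurable_sqn.
have small i : (2 * i <= l)%N -> forall xi : 'rV[R]_N, (sqn xi ^+ i) ^+ 2 <= (1 + sqn xi) `^ s.
  move=> il xi; rewrite -exprM mulnC; apply: sobolev_symbol_le.
  by apply: le_trans ls; rewrite ler_nat.
have lE := odd_double_half l.
case: ifPn => odl; rewrite ?odl ?(negbTE odl) in lE.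
  have -> : (l.-1)./2 = l./2 by rewrite -[in LHS]lE /= doubleK.
  set j := l./2 in lE *.
  have lj : l = (1 + 2 * j)%N by rewrite -lE mul2n.
  have Uj w : FT w (P w) (Q w) -> (forall a : 'rV[R]_N -> R, measurable_fun setT a ->
        (forall xi, a xi ^+ 2 <= (1 + sqn xi) `^ s) ->
        L2 mu (fun xi => a xi * P w xi) /\ L2 mu (fun xi => a xi * Q w xi)) ->
      forall k, FT (weak_partial k (iter j (@weak_neg_laplacian R N) w))
        (fun xi => - (xi 0 k * (sqn xi ^+ j * Q w xi))) (fun xi => xi 0 k * (sqn xi ^+ j * P w xi)).
    move=> W LW k; have Wj : FT (iter j (@weak_neg_laplacian R N) w) (fun xi => sqn xi ^+ j * P w xi)
        (fun xi => sqn xi ^+ j * Q w xi).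
      apply: FT_iter_laplacian => // i ij; apply: LW => //; apply: small.
      by rewrite lj; lia.
    have [||hP hQ] := LW (fun xi => xi 0 k * sqn xi ^+ j).
    - by apply: measurable_funM => //; exact: measurable_coord.
    - move=> xi; apply: le_trans (sobolev_symbol_le xi ls).
      rewrite exprMn -exprM lj exprD expr1 (mulnC j) ler_wpM2r ?exprn_ge0 ?sqn_ge0//.
      exact: coord_sqr_le.
    have hP' : L2 mu (fun xi => xi 0 k * (sqn xi ^+ j * P w xi)).
      by move: hP; congr L2; apply/funext => xi; rewrite mulrA.
    have hQ' : L2 mu (fun xi => xi 0 k * (sqn xi ^+ j * Q w xi)).
      by move: hQ; congr L2; apply/funext => xi; rewrite mulrA.
    exact: (FT_weak_partial Wj hP' hQ').
  have wE (xi : 'rV[R]_N) : \sum_(k < N) enorm xi `^ (2 * sigma) * (xi 0 k ^+ 2 * sqn xi ^+ (2 * j)) =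
      enorm xi `^ (2 * s).
    rewrite sE -enormX_shift// lj exprD expr1 -mulr_sumr -mulr_suml; congr (_ * (_ * _)).
  have mw k : measurable_fun setT (fun xi : 'rV[R]_N => enorm xi `^ (2 * sigma) * (xi 0 k ^+ 2 * sqn xi ^+ (2 * j))).
    apply: measurable_funM; first exact: measurable_enormX.
    by apply: measurable_funM => //; apply: measurable_funX; exact: measurable_coord.
  have w0 k (xi : 'rV[R]_N) : 0 <= enorm xi `^ (2 * sigma) * (xi 0 k ^+ 2 * sqn xi ^+ (2 * j)).
    by rewrite mulr_ge0 ?powR_ge0// mulr_ge0 ?sqr_ge0 ?exprn_ge0 ?sqn_ge0.
  have wle k (xi : 'rV[R]_N) : enorm xi `^ (2 * sigma) * (xi 0 k ^+ 2 * sqn xi ^+ (2 * j)) <= enorm xi `^ (2 * s).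
    by rewrite -wE (bigD1 k)//= lerDl sumr_ge0.
  have domI k A : measurable_fun setT A -> Int mu (fun xi => enorm xi `^ (2 * s) * A xi) ->
      Int mu (fun xi => enorm xi `^ (2 * sigma) * (xi 0 k ^+ 2 * sqn xi ^+ (2 * j)) * A xi).
    move=> mA IA; apply: (le_Int _ _ IA); first exact: measurable_funM.
    by move=> xi; rewrite [leLHS]normrM [leRHS]normrM ler_wpM2r// ger0_norm ?w0// ger0_norm ?powR_ge0.
  have Hj w : FT w (P w) (Q w) -> finite_energy s (P w) (Q w) -> forall k, finite_energy sigma
        (fun xi => - (xi 0 k * (sqn xi ^+ j * Q w xi))) (fun xi => xi 0 k * (sqn xi ^+ j * P w xi)).
    move=> [_ p2 q2 _] HW k.
    have mA : measurable_fun setT (fun xi => P w xi ^+ 2 + Q w xi ^+ 2).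
      by apply: measurable_funD; apply: measurable_funX; [exact: L2_measurable p2|exact: L2_measurable q2].
    have := domI k _ mA HW; congr Int; apply/funext => xi.
    by rewrite mulnC exprM; ring.
  have [_ P2 Q2 _] := U; have [_ P'2 Q'2 _] := V.
  have Ic := cross_Int P2 Q2 P'2 Q'2; have Is := sform_Int P2 Q2 P'2 Q'2 HU HV.
  congr (_%:C); rewrite /sform.
  transitivity (\int[mu]_xi (\sum_(k < N) enorm xi `^ (2 * sigma) * (xi 0 k ^+ 2 * sqn xi ^+ (2 * j)) *
    cross (P u) (Q u) (P v) (Q v) xi)); last first.
    by apply: eq_Rintegral => xi _; rewrite -mulr_suml wE.
  rewrite Rint_sum; last by move=> k; apply: domI; [exact: Int_measurable Ic|exact: Is].
  apply: eq_bigr => k _.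
  rewrite (Esigma_sform N0 si0 si1 (Uj u U LU k) (Uj v V LV k) (Hj u U HU k) (Hj v V HV k)).
  apply: eq_Rintegral => xi _; rewrite /cross mulnC exprM.
  move: (P u xi) (Q u xi) (P v xi) (Q v xi) (enorm xi `^ _) (sqn xi ^+ j) (xi 0 k) => a b c d e f g.
  by ring.
set j := l./2 in lE *; have lj : l = (2 * j)%N by rewrite -lE mul2n.
have Uj w : FT w (P w) (Q w) -> (forall a : 'rV[R]_N -> R, measurable_fun setT a ->
      (forall xi, a xi ^+ 2 <= (1 + sqn xi) `^ s) ->
      L2 mu (fun xi => a xi * P w xi) /\ L2 mu (fun xi => a xi * Q w xi)) ->
    FT (iter j (@weak_neg_laplacian R N) w)
      (fun xi => sqn xi ^+ j * P w xi) (fun xi => sqn xi ^+ j * Q w xi).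
  move=> W LW; apply: FT_iter_laplacian => // i ij; apply: LW => //; apply: small.
  by rewrite lj; lia.
have wE (xi : 'rV[R]_N) : enorm xi `^ (2 * sigma) * (sqn xi ^+ j) ^+ 2 = enorm xi `^ (2 * s).
  by rewrite sE -enormX_shift// lj -exprM mulnC.
have Hj w : finite_energy s (P w) (Q w) -> finite_energy sigma
    (fun xi => sqn xi ^+ j * P w xi) (fun xi => sqn xi ^+ j * Q w xi).
  by congr Int; apply/funext => xi; rewrite -wE; ring.
rewrite (Esigma_sform N0 si0 si1 (Uj u U LU) (Uj v V LV) (Hj u HU) (Hj v HV)).
congr (_%:C); apply: eq_Rintegral => xi _; rewrite -wE /cross.
by move: (P u xi) (Q u xi) (P v xi) (Q v xi) (enorm xi `^ _) (sqn xi ^+ j) => a b c d e f; ring.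
Qed.

End FourierForm.

(** * Test functions and the operator *)

Section TestFunctionDecay.
Context {R : realType} {N : nat}.
Notation mu := (lebRV R N).
Notation leb := (@lebesgue_measure R).
Notation D := (`]0%R, +oo[%classic : set R).
Implicit Types (u v phi P Q : 'rV[R]_N -> R).

Let br0 (xi : 'rV[R]_N) : 0 < 1 + sqn xi.
Proof. by rewrite ltr_wpDr ?sqn_ge0. Qed.

Let mbr M : measurable_fun setT (fun xi : 'rV[R]_N => (1 + sqn xi) ^+ M).
Proof. by apply: measurable_funX; apply: measurable_funD => //; exact: measurable_sqn. Qed.

(** Each derivative of a test function is again a test function, so the
transform may be multiplied by any coordinate without leaving L2. *)
Lemma Cc_decay M phi P Q : Cc_infty phi -> FT phi P Q ->
  Int mu (fun xi => (1 + sqn xi) ^+ M * (P xi ^+ 2 + Q xi ^+ 2)).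
Proof.
elim: M phi P Q => [|M IH] phi P Q H U.
  have [_ /L2_sqr[_ P2] /L2_sqr[_ Q2] _] := U.
  by have := IntD P2 Q2; congr Int; apply/funext => xi; rewrite expr0 mul1r.
have I1 k := IH _ _ _ (Cc_infty_partial k H) (FT_Cc_partial k H U).
have := IntD (IH _ _ _ H U) (Int_sum (index_enum 'I_N) I1).
congr Int; apply/funext => xi; rewrite -mulr_sumr -mulrDr (exprSr _ M) -mulrA; congr (_ * _).
rewrite mulrDl mul1r; congr (_ + _); rewrite /sqn mulr_suml; apply: eq_bigr => k _.
by ring.
Qed.

(** Writing the negative power as a superposition of Gaussians, its integral
is a multiple of the Gamma integral at N / 2. *)
Lemma bracket_Int : (0 < N)%N -> Int mu (fun xi : 'rV[R]_N => ((1 + sqn xi) ^+ N)^-1).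
Proof.
move=> N0; have x0 : 0 < N%:R :> R by rewrite ltr0n.
have G0 := Gamma_pos_gt0 x0.
have mi : measurable_fun setT (fun xi : 'rV[R]_N => ((1 + sqn xi) ^+ N)^-1).
  exact: (measurableT_comp (@measurable_invr R) (mbr N)).
pose f (z : 'rV[R]_N * R) := z.2 `^ (N%:R - 1) * expR (- ((1 + sqn z.1) * z.2)).
have mf : measurable_fun setT f.
  apply: measurable_funM.
    by apply: (measurableT_comp (measurable_powR _)); exact: measurable_snd.
  apply: (measurableT_comp (@measurable_expR R)); apply: measurable_funN.
  apply: measurable_funM; last exact: measurable_snd.
  apply: measurable_funD => //.
  by apply: (measurableT_comp (@measurable_sqn R N)); exact: measurable_fst.
have f0 y t : 0 < t -> 0 <= f (y, t) by move=> t0; rewrite mulr_ge0 ?powR_ge0 ?expR_ge0.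
have E : (\int[mu]_xi (Gamma_pos N%:R * ((1 + sqn xi) ^+ N)^-1)%:E =
    \int[mu]_xi \int[leb]_(t in D) (f (xi, t))%:E)%E.
  apply: eq_integral => xi _; rewrite [RHS](eGamma_scale x0 (br0 xi)).
  by rewrite powR_mulrn ?ltW.
have fin : (\int[mu]_xi (Gamma_pos N%:R * ((1 + sqn xi) ^+ N)^-1)%:E < +oo)%E.
  rewrite E tonelli_halfline//.
  have h0 : 0 < N%:R / 2 :> R by rewrite divr_gt0.
  have c0 : 0 <= pi `^ (N%:R / 2) :> R by exact: powR_ge0.
  have hE t : 0 < t -> (\int[mu]_xi (f (xi, t))%:E)%E =
      ((pi `^ (N%:R / 2))%:E * (t `^ (N%:R / 2 - 1) * expR (- t))%:E)%E.
    move=> t0; transitivity ((t `^ (N%:R - 1) * expR (- t))%:E * \int[mu]_xi (expR (- (t * sqn xi)))%:E)%E.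
      rewrite -ge0_integralZl; last 4 first.
      - exact: measurableT.
      - by apply/measurable_EFinP; exact: measurable_gaussN.
      - by move=> xi _; rewrite lee_fin expR_ge0.
      - by rewrite lee_fin mulr_ge0 ?powR_ge0 ?expR_ge0.
      apply: eq_integral => xi _; rewrite -EFinM /f/= -mulrA -expRD; congr (_ * expR _)%:E; ring.
    rewrite gaussN_ge0// -!EFinM; congr EFin.
    rewrite (sqrt_pi_div_powR N t0).
    rewrite (_ : N%:R / 2 - 1 = (N%:R - 1) - N%:R / 2 :> R); last by field.
    rewrite [in RHS]powRD; first by ring.
    by rewrite (gt_eqF t0) implybT.
  have -> : (\int[leb]_(t in D) \int[mu]_x (f (x, t))%:E = \int[leb]_(t in D)
      ((pi `^ (N%:R / 2))%:E * (t `^ (N%:R / 2 - 1) * expR (- t))%:E))%E.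
    by apply: eq_integral => t; rewrite inE/= in_itv/= andbT; exact: hE.
  rewrite ge0_integralZl//; last 2 first.
  - exact: measurable_eGamma.
  - by move=> t _; rewrite lee_fin mulr_ge0 ?powR_ge0 ?expR_ge0.
  by rewrite lte_mul_pinfty ?lee_fin//; exact: eGamma_lty.
have IG : Int mu (fun xi => Gamma_pos N%:R * ((1 + sqn xi) ^+ N)^-1).
  apply/ge0_IntP; last by split; [exact: measurable_funM|exact: fin].
  by move=> xi; rewrite mulr_ge0 ?invr_ge0 ?exprn_ge0 ?ltW.
by have := IntZ (Gamma_pos N%:R)^-1 IG; congr Int; apply/funext => xi; rewrite mulKf ?gt_eqF.
Qed.

(** The inverse bracket of [bracket_Int] trades one power of P for its square. *)
Lemma Cc_weight_Int M phi P Q : (0 < N)%N -> Cc_infty phi -> FT phi P Q ->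
  Int mu (fun xi => (1 + sqn xi) ^+ M * (`|P xi| + `|Q xi|)).
Proof.
move=> N0 H U; have [_ P2 Q2 _] := U.
have I1 := IntZ 2 (bracket_Int N0); have I2 := Cc_decay (N + M + M) H U.
apply: (le_Int _ _ (IntD I1 I2)).
  apply: measurable_funM => //; apply: measurable_funD; apply: measurableT_comp => //.
    exact: L2_measurable P2.
  exact: L2_measurable Q2.
move=> xi; have b0 := br0 xi; set b := 1 + sqn xi in b0 *.
have bM : 0 < b ^+ M by exact: exprn_gt0.
have bN : 0 < b ^+ N by exact: exprn_gt0.
have key (a : R) : b ^+ M * `|a| <= (b ^+ N)^-1 + b ^+ (N + M + M) * a ^+ 2.
  rewrite !exprD -[a ^+ 2]real_normK ?num_real//.
  have e0 : 0 < (b ^+ N)^-1 by rewrite invr_gt0.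
  have e1 : (b ^+ N)^-1 * b ^+ N = 1 by rewrite mulVf ?gt_eqF.
  move: (b ^+ N) (b ^+ N)^-1 (b ^+ M) `|a| (normr_ge0 a) bM bN e0 e1 => B E C z z0 C0 B0 E0 EB.
  rewrite -(ler_pM2l B0) mulrDr mulrC [B * E]mulrC EB.
  have := sqr_ge0 (1 - B * C * z); have : 0 <= B * C * z by rewrite !mulr_ge0// ltW.
  by move=> h1 h2; nra.
have t0 : 0 <= b ^+ M * (`|P xi| + `|Q xi|) by rewrite mulr_ge0// ltW.
rewrite ger0_norm// [leRHS]ger0_norm; last first.
  by rewrite addr_ge0// mulr_ge0 ?invr_ge0 ?addr_ge0 ?sqr_ge0 ?exprn_ge0 ?ltW.
have := key (P xi); have := key (Q xi); lra.
Qed.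

Lemma Cc_finite_energy (s : R) M phi P Q : 0 <= s -> s <= M%:R -> Cc_infty phi -> FT phi P Q ->
  finite_energy s P Q.
Proof.
move=> s0 sM H U; have I0 := Cc_decay M H U; apply: (le_Int _ _ I0).
  have [_ P2 Q2 _] := U; apply: measurable_funM; first exact: measurable_enormX.
  by apply: measurable_funD; apply: measurable_funX; [exact: L2_measurable P2|exact: L2_measurable Q2].
move=> xi; rewrite [leLHS]normrM [leRHS]normrM ler_wpM2r// ger0_norm ?powR_ge0//.
by rewrite ger0_norm ?enormX_le// exprn_ge0// ltW.
Qed.

End TestFunctionDecay.

Section Operator.
Context {R : realType} {N : nat}.
Notation mu := (lebRV R N).
Variables (n : nat) (s : R) (u v : 'rV[R]_N -> R).
Hypotheses (N0 : (0 < N)%N) (s0 : 0 < s) (sn : s < n%:R).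
Hypotheses (Hu : Cc_infty u) (Hv : Cc_infty v).

Let p : R := N%:R + 2 * s.

Let F (z : 'rV[R]_N * 'rV[R]_N) : R := delta n u z.2 z.1 / enorm z.1 `^ p * v z.2.

Let mkernel : measurable_fun setT (fun z : 'rV[R]_N * 'rV[R]_N => delta n u z.2 z.1 / enorm z.1 `^ p).
Proof.
apply: measurable_funM; last exact: (measurable_comp_fst (measurable_enormX_inv p)).
apply: measurable_sum => j; apply: measurable_funM => //.
apply: (measurableT_comp (Cc_infty_measurable Hu)).
apply: measurable_fun_rVP => i.
rewrite (_ : _ \o _ = fun z : 'rV[R]_N * 'rV[R]_N => z.2 0 i + (j%:Z - n%:Z)%:~R * z.1 0 i); last first.
  by apply/funext => z; rewrite /= /rV_coord -scaler_int !mxE.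
apply: measurable_funD; first exact: (measurable_comp_snd (measurable_coord i)).
by apply: measurable_funM => //; exact: (measurable_comp_fst (measurable_coord i)).
Qed.

Let mF : measurable_fun setT F.
Proof.
apply: measurable_funM; first exact: mkernel.
exact: (measurable_comp_snd (Cc_infty_measurable Hv)).
Qed.

(** The sign of the product is absorbed into v, whose transform stays bounded by its L1
norm; on the other factor Plancherel leaves the multiplier of the difference. *)
Let abs_pairing P Q (y : 'rV[R]_N) : FT u P Q -> Int mu (fun xi => `|P xi| + `|Q xi|) ->
  \int[mu]_x `|delta n u x y * v x| <=
  fconst N * (\int[mu]_x `|v x|) * \int[mu]_xi (dsym n (dotrv y xi) * (`|P xi| + `|Q xi|)).
Proof.
move=> U IPQ; have Dy := FT_delta n y U; have [d2 dP dQ _] := Dy.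
have Iv := Cc_infty_Int Hv; have v2 := Cc_infty_L2 Hv.
pose f x := delta n u x y * v x; pose e x := f x * `|f x|^-1; pose w x := e x * v x.
have mf : measurable_fun setT f by apply: measurable_funM; [exact: L2_measurable d2|exact: L2_measurable v2].
have mw : measurable_fun setT w.
  apply: measurable_funM; last exact: L2_measurable v2.
  apply: measurable_funM => //; apply: (measurableT_comp (@measurable_invr R)).
  exact: measurableT_comp.
have wv x : `|w x| <= `|v x|.
  rewrite normrM ler_piMl// normrM normfV normr_id.
  by have [->|f0] := eqVneq (f x) 0; [rewrite normr0 mul0r|rewrite divff// normr_eq0].
have Iw : Int mu w by exact: (le_Int mw wv Iv).
have w2 : L2 mu w by exact: (le_L2 mw wv v2).
have Iav := Int_abs Iv; have c0 : 0 <= fconst N :> R by exact: powR_ge0.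
have tw a xi : `|trig a w xi| <= fconst N * \int[mu]_x `|v x|.
  have Ic := cos_Int a xi Iw; rewrite normrM ger0_norm// ler_wpM2l//.
  have cw x : `|cos (dotrv x xi + a) * w x| <= `|v x|.
    by apply: le_trans (wv x); rewrite normrM ler_piMl// cos_abs_le1.
  rewrite ler_norml; apply/andP; split; last first.
    by apply: le_Rint => // x; exact: le_trans (ler_norm _) (cw x).
  rewrite lerNl -RintN//; apply: le_Rint => //; first exact: IntN.
  by move=> x; apply: le_trans (ler_norm _) _; rewrite normrN; exact: cw.
have [t1 t2] := trig_L2 Iw w2.
have W : FT w (trig 0 w) (trig (pi / 2) w).
  by split => //; exists (fun=> w); split => //; exact: L2cvg_cst.
have -> : \int[mu]_x `|delta n u x y * v x| = \int[mu]_x (delta n u x y * w x).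
  apply: eq_Rintegral => x _; rewrite /w mulrCA -/(f x) /e mulrAC -expr2.
  have [->|f0] := eqVneq (f x) 0; first by rewrite normr0 expr0n mul0r.
  by rewrite -[f x ^+ 2]real_normK ?num_real// expr2 mulfK// normr_eq0.
have := FT_ip Dy W; rewrite /ip => <-; rewrite -RintD; [|exact: L2M|exact: L2M].
have Id := dsymW_Int n y IPQ; rewrite -RintZ//.
apply: le_Rint; [by apply: IntD; exact: L2M|exact: IntZ|move=> xi].
have d0 := dsym_ge0 n (dotrv y xi); rewrite -(mulrA _ (P xi)) -(mulrA _ (Q xi)) -mulrDr [leRHS]mulrCA ler_wpM2l//.
have h1 := tw 0 xi; have h2 := tw (pi / 2) xi; rewrite mulrDr; apply: lerD.
  by apply: le_trans (ler_norm _) _; rewrite normrM mulrC ler_wpM2r.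
by apply: le_trans (ler_norm _) _; rewrite normrM mulrC ler_wpM2r.
Qed.

(** The rapid decay of the transform of u and [abs_pairing] make the double integral
absolutely convergent. Once the integral over x is taken first, it is a Plancherel
pairing. *)
Lemma Lms_sform P Q P' Q' : FT u P Q -> FT v P' Q' ->
  \int[mu]_x (Lms n s u x * v x) = sform s P Q P' Q'.
Proof.
move=> U V; have [_ P2 Q2 _] := U; have [_ P'2 Q'2 _] := V.
have s1 := ltW s0; have s2 := ltW sn.
have HU := Cc_finite_energy s1 s2 Hu U; have HV := Cc_finite_energy s1 s2 Hv V.
have IW := cross_Int P2 Q2 P'2 Q'2; have IsW := sform_Int P2 Q2 P'2 Q'2 HU HV.
have [_ E] := spectral_form N0 s0 sn IW IsW; rewrite /sform -E -/p.
pose W0 xi := `|P xi| + `|Q xi|.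
have I0 : Int mu W0.
  by have := Cc_weight_Int 0 N0 Hu U; congr Int; apply/funext => xi; rewrite expr0 mul1r.
have Is0 : Int mu (fun xi => enorm xi `^ (2 * s) * W0 xi).
  apply: (le_Int _ _ (Cc_weight_Int n N0 Hu U)).
    by apply: measurable_funM; [exact: measurable_enormX|exact: Int_measurable I0].
  move=> xi; rewrite [leLHS]normrM [leRHS]normrM ler_wpM2r// ger0_norm ?powR_ge0//.
  rewrite ger0_norm ?enormX_le//.
  by rewrite exprn_ge0// addr_ge0// sqn_ge0.
have [Ig _] := spectral_form N0 s0 sn I0 Is0; rewrite -/p in Ig.
set C := fconst N * (\int[mu]_x `|v x|).
have d2 y : L2 mu (fun x => delta n u x y) by have [] := FT_delta n y U.
have v2 := Cc_infty_L2 Hv.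
have bound y : (\int[mu]_x `|F (y, x)|%:E <=
    (C * (\int[mu]_xi (dsym n (dotrv y xi) * W0 xi) / enorm y `^ p))%:E)%E.
  have I1 := Int_abs (L2M (d2 y) v2).
  rewrite (eq_integral (fun x => ((enorm y `^ p)^-1 * `|delta n u x y * v x|)%:E)); last first.
    move=> x _; rewrite /F/= mulrAC normrM mulrC; congr ((_ * _)%:E).
    by rewrite ger0_norm// invr_ge0 powR_ge0.
  rewrite -RintegralE; last exact: IntZ.
  rewrite lee_fin RintZ// mulrA mulrC ler_wpM2r ?invr_ge0 ?powR_ge0//.
  exact: (abs_pairing y U I0).
have fin := fubini_dom mF bound (IntZ C Ig).
have [_ I2 EF] := @Rfubini _ _ _ _ _ mu mu F mF fin.
have mF' := measurable_swap_pair mF.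
have fin' : (\int[mu]_x \int[mu]_y `|F (y, x)|%:E < +oo)%E by rewrite -(tonelli_abs mu mu mF).
have [_ aeI _] := @Rfubini_half _ _ _ _ _ mu mu _ mF' fin'.
have mK := measurable_Rint_param mu (measurable_swap_pair mkernel).
have mv := L2_measurable v2.
transitivity (cNms N n s / 2 * \int[mu]_x \int[mu]_y F (y, x)).
  rewrite -RintZ//; apply: ae_eq_Rint.
  - by apply: measurable_funM => //; rewrite /Lms; exact: measurable_funM.
  - by apply: measurable_funM => //; exact: Int_measurable I2.
  - apply: filterS aeI => x Ix; rewrite /Lms -mulrA; congr (_ * _).
    (* Where v x = 0 both sides vanish; elsewhere the integrability of F at x passes to
       the integrand of the operator. *)
    have [vx|vx] := eqVneq (v x) 0.
      rewrite vx mulr0; apply/esym; rewrite -[RHS](@Rint_cst0 _ _ _ mu); apply: eq_Rintegral => y _.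
      by rewrite /F/= vx mulr0.
    have Ik : Int mu (fun y => delta n u x y / enorm y `^ p).
      have := IntZ (v x)^-1 Ix; congr Int; apply/funext => y.
      by rewrite /F/= mulrC mulfK.
    rewrite mulrC -RintZ//; apply: eq_Rintegral => y _.
    by rewrite /F/= mulrC.
congr (_ * _); rewrite -EF; apply: eq_Rintegral => y _.
have [_ dP dQ _] := FT_delta n y U.
transitivity ((enorm y `^ p)^-1 * ip mu (fun x => delta n u x y) v).
  rewrite /ip -RintZ; last exact: L2M.
  by apply: eq_Rintegral => x _; rewrite /F/= mulrAC mulrC.
rewrite -(FT_ip (FT_delta n y U) V) mulrC; congr (_ / _).
rewrite /ip -RintD; [|exact: L2M|exact: L2M].
by apply: eq_Rintegral => xi _; rewrite /cross; ring.
Qed.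

End Operator.

(** * Equality of the forms *)

Local Open Scope complex_scope.

Theorem theorem1p8 (R : realType) (N : nat) (s : R) (n m : nat)
    (hN : (0 < N)%N) (hn : (0 < n)%N) (hm : (0 < m)%N)
    (hs : 0 < s) (hsn : s < n%:R) (hnm : (n <= 2 * m)%N) :
  (forall u v : 'rV[R]_N -> R, sobolev s u -> sobolev s v ->
     (E2ms m s u v)%:C = Es s u v) /\
  (forall u v : 'rV[R]_N -> R, Cc_infty u -> Cc_infty v ->
     \int[lebesgue_rV R N]_x (Lms n s u x * v x) = E2ms m s u v).
Proof.
have hsm : s < (2 * m)%:R by apply: lt_le_trans hsn _; rewrite ler_nat.
split=> u v Hu Hv.
  have [U HU _] := sobolev_spectrum (ltW hs) Hu.
  have [V HV _] := sobolev_spectrum (ltW hs) Hv.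
  by rewrite (Es_sform hN hs Hu Hv) (E2ms_sform hN hs hsm U V HU HV).
have [P [Q U]] := FT_exists (Cc_infty_L2 Hu).
have [P' [Q' V]] := FT_exists (Cc_infty_L2 Hv).
rewrite (E2ms_sform hN hs hsm U V); [|exact: Cc_finite_energy (ltW hs) (ltW hsn) Hu U|exact: Cc_finite_energy (ltW hs) (ltW hsn) Hv V].
exact: Lms_sform U V.
Qed.
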